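(* Let $d\in\mathbb{N}$, $1<p<2$ and $r>\frac1p$. There exists a constant $C_{r,p,d}>0$ such that $$\varrho_{\lceil C_{r,p,d}\,n\log(n+1)^3\rceil}(S^r_pW(\mathbb{T}^d))_{L^2(\mathbb{T}^d)}\lesssim\left(\frac{\log(n+1)^{d-1}}{n}\right)^{r-\frac1p+\frac12}\log(n+1)^{\frac12-(d-1)(\frac1p-\frac12)}.$$
   Context: $\mathbb{T}^d=\mathbb{R}^d/\mathbb{Z}^d$ with normalized Haar measure. $\log$ is the natural logarithm. Sobolev space of mixed smoothness: let $F_r(x)=\sum_{k\in\mathbb{Z}}\max\{1,|k|\}^{-r}\mathrm{e}^{-2\pi\mathrm{i}kx}$ for $x\in\mathbb{T}$ and $F_r(x)=\prod_{j=1}^dF_r(x_j)$ for $x\in\mathbb{T}^d$. For $r>0$, $1<p<\infty$, $S^r_pW(\mathbb{T}^d)$ is the space of all $f\in L^p(\mathbb{T}^d)$ of the form $f=F_r\ast\varphi=\int_{\mathbb{T}^d}F_r(\cdot-y)\varphi(y)\,\mathrm{d}y$ with $\varphi\in L^p(\mathbb{T}^d)$, normed by $\|f\|_{S^r_pW(\mathbb{T}^d)}=\|\varphi\|_{L^p(\mathbb{T}^d)}$. For $r>\frac1p$ every element has a continuous representative, with which it is identified. Sampling numbers: $\varrho_m(\mathcal{F})_X=\inf_{t_1,\ldots,t_m\in\mathbb{T}^d}\inf_{R:\mathbb{C}^m\to X}\sup_{\|f\|_{\mathcal{F}}\le1}\|f-R(f(t_1),\ldots,f(t_m))\|_X$,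 with $R$ ranging over all (not necessarily linear) maps. $a_n\lesssim b_n$ means $a_n\le c\,b_n$ for all $n\in\mathbb{N}$ with a constant $c>0$ independent of $n$ (it may depend on $r,p,d$). *)

(* Defs.v *)
From HB Require Import structures.
From mathcomp Require Import all_boot all_order all_algebra.
From mathcomp Require Import all_classical all_reals all_analysis.
From mathcomp Require Import complex.

Set Implicit Arguments.
Unset Strict Implicit.
Unset Printing Implicit Defensive.

Import Order.TTheory GRing.Theory Num.Theory.
Import numFieldNormedType.Exports.

Local Open Scope classical_set_scope.
Local Open Scope ring_scope.

(* The ascription to [numFieldType] is what gives the complex numbers over [R]
   the topology induced by the modulus. *)
Definition Cx (R : realType) : numFieldType := R[i].

Definition cmod (R : realType) (z : Cx R) : R := complex.Re `|z|.

(* The points of R^d.  A function on the torus T^d = R^d / Z^d is a function on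
   R^d which is 1-periodic in each coordinate (see [torus_periodic]), and a point
   of T^d is given by any of its representatives in R^d. *)
Notation Rd R d := (d.-tuple (measurableTypeR R)).

Section power_probability.
Context {disp : measure_display} {T : measurableType disp} {R : realType}.
Variable P : probability T R.

Definition tuple_consf n (x : T * n.-tuple T) : n.+1.-tuple T :=
  [the n.+1.-tuple T of x.1 :: x.2].

Lemma measurable_tuple_consf n : measurable_fun setT (@tuple_consf n).
Proof. exact: (measurable_cons measurable_fst measurable_snd). Qed.

HB.instance Definition _ n :=
  isMeasurableFun.Build _ _ _ _ (@tuple_consf n) (@measurable_tuple_consf n).

Fixpoint power_prob (n : nat) : probability (n.-tuple T) R :=
  match n with
  | 0 => \d_ [tuple]
  | n.+1 => distribution (P \x power_prob n)%E (@tuple_consf n)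
  end.

End power_probability.

Section torus.
Variables (R : realType) (d : nat).
Implicit Types f g phi : Rd R d -> Cx R.

(* The normalized Haar measure of T^d, carried by the fundamental domain
   [0, 1]^d. *)
Definition haar : probability (Rd R d) R :=
  power_prob (uniform_prob (@ltr01 R) : probability (measurableTypeR R) R) d.

Definition torus_periodic f : Prop :=
  forall (x : Rd R d) (z : 'I_d -> int),
    f [tuple (tnth x i : R) + (z i)%:~R | i < d] = f x.

(* The d-tuples carry no topology in the library; row vectors do. *)
Definition torus_continuous f : Prop :=
  torus_periodic f /\
  continuous (fun v : 'rV[R]_d => f [tuple v ord0 i | i < d]).

Definition torus_measurable f : Prop :=
  [/\ torus_periodic f,
      measurable_fun setT (fun x => complex.Re (f x))
    & measurable_fun setT (fun x => complex.Im (f x))].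

Definition torus_Lnorm (p : R) f : \bar R :=
  Lnorm haar p%:E (fun x => (cmod (f x))%:E).

(* L^p(T^d); almost everywhere equal functions are not identified. *)
Definition torus_Lp (p : R) : set (Rd R d -> Cx R) :=
  [set f | torus_measurable f /\ (torus_Lnorm p f < +oo)%E].

Definition torus_integral f : Cx R :=
  Complex (\int[haar]_x complex.Re (f x)) (\int[haar]_x complex.Im (f x)).

Definition torus_conv f phi (x : Rd R d) : Cx R :=
  torus_integral
    (fun y => f [tuple (tnth x i : R) - (tnth y i : R) | i < d] * phi y).

End torus.

Section mixed_smoothness.
Variable R : realType.

(* max{1,|k|}^(-r) exp(-2 pi i k x) *)
Definition sobolev_term (r : R) (k : int) (x : R) : Cx R :=
  Complex (Num.max 1 `|k%:~R| `^ (- r)) 0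
  * Complex (cos (2 * pi * k%:~R * x)) (- sin (2 * pi * k%:~R * x)).

(* The series over k in Z is the limit of the sums over |k| <= N, where
   k = j - N. For 0 < r <= 1 it is not absolutely convergent, and it diverges at
   the integers, which form a null set. *)
Definition sobolev_kernel1 (r : R) (x : R) : Cx R :=
  lim ((fun N : nat =>
    \sum_(j < (N + N).+1) sobolev_term r (j%:Z - N%:Z) x) @ \oo).

Definition sobolev_kernel (r : R) d (x : Rd R d) : Cx R :=
  \prod_(i < d) sobolev_kernel1 r (tnth x i).

Definition sobolev_repr (r p : R) d (f phi : Rd R d -> Cx R) : Prop :=
  torus_Lp p phi /\
  {ae haar R d, forall x, f x = torus_conv (@sobolev_kernel r d) phi x}.

(* Each class is identified with its continuous representative, so that point
   values make sense. *)
Definition sobolevW (r p : R) d : set (Rd R d -> Cx R) :=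
  [set f | [/\ torus_continuous f, torus_Lp p f
             & exists phi, sobolev_repr r p f phi]].

(* The function phi with f = F_r * phi is unique up to a null set (all Fourier
   coefficients of F_r are nonzero), so the infimum is over a single value when f
   belongs to the space. *)
Definition sobolevW_norm (r p : R) d (f : Rd R d -> Cx R) : \bar R :=
  ereal_inf [set torus_Lnorm p phi | phi in sobolev_repr r p f].

End mixed_smoothness.

(* [F] and [X] are the underlying sets of the spaces normed by [nF] and [nX];
   the recovery map [rec] ranges over all maps from C^m to X. *)
Definition sampling_number (R : realType) (d m : nat)
    (F : set (Rd R d -> Cx R)) (nF : (Rd R d -> Cx R) -> \bar R)
    (X : set (Rd R d -> Cx R)) (nX : (Rd R d -> Cx R) -> \bar R) : \bar R :=
  ereal_inf [set
    ereal_inf [set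
      ereal_sup [set nX (fun x => f x - rec (\row_i f (t i)) x)
                | f in [set f | F f /\ (nF f <= 1)%E]]
      | rec in [set rec : 'rV[Cx R]_m -> (Rd R d -> Cx R)
               | forall y, X (rec y)]]
    | t in [set: 'I_m -> Rd R d]].

(* Main.v *)
Require Import Defs.
From mathcomp Require Import all_boot all_order all_algebra.
From mathcomp Require Import all_classical all_reals all_analysis.
From mathcomp Require Import measurable_realfun complex ring lra zify.

(* Recovery by any function of the unit ball that fits the data reduces the bound
   to an estimate of the L^2 norm of f - g for f, g in the ball with equal samples.
   Expand the real and imaginary parts in the orthonormal system of products of
   [cas x = cos x + sin x]: for f = F_r * phi the coefficients are w_k^(-r) c_k,
   where w_k is the product of the max{1,|k_j|} and, by the Hardy-Littlewood
   inequality, the sum of w_k^(p-2) |c_k|^p is at most C ||phi||_p^p.  By Hoelder,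
   the coefficients with w_k > t have a small l^1 norm, and the hyperbolic cross
   w_k <= t has about t (log t)^(d-1) elements.

   The sampling points are chosen on a grid of polynomial size so that every
   combination of the system with l^1 norm of the coefficients at most B, and
   normalised L^2 norm at least 1, exceeds 1/4 at one of them.  Covering the l^1
   ball by Maurey's empirical method, layer by layer over the dyadic sizes of the
   values, shows that B^2 (log)^3 points suffice.  On the difference f - g, all of
   whose samples vanish, this forces V B <= C ||coefficients||_1, where V is the L^2
   norm; since the l^1 norm is at most (cross cardinality)^(1/2) V plus the tail,
   taking B^2 comparable to the cardinality of the cross bounds V by the tail
   divided by B. *)

Set Implicit Arguments.
Unset Strict Implicit.
Unset Printing Implicit Defensive.

Import Order.TTheory GRing.Theory Num.Theory.
Import numFieldNormedType.Exports.

Local Open Scope ring_scope.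

(** * Sampling points that detect sparse combinations *)

Section compressed_sensing.
Variable R : realType.

(** Covering the l^1 ball at one fixed accuracy would be too costly: it takes about B^2 atoms, while
    a combination of L^2 norm 1 bounded by B may be large only on a set of density B^(-2), so about
    B^4 points would be needed. Tying the accuracy to the height removes the loss. Values of size
    2^i may occur with density as low as 4^(-i), but accuracy 2^i needs only B^2 4^(-i) atoms, and
    the two powers cancel.

    The analytic obstacle is that f equals F_r * phi only almost everywhere, that the series of F_r
    need not converge absolutely, and that the sampling points form a null set. An approximation
    valid at every point is therefore required; it comes from the square summability of w_k^(-r), as
    r > 1/p > 1/2, together with the continuity of f.

    The cas system keeps coefficients, atoms and values real, so that signs and dyadic heights make
    sense; since the coefficients of F_r are even in the frequency, it still diagonalises the
    convolution. *)

Lemma expR_le_quadratic (y : R) : y <= 2^-1 -> expR y <= 1 + y + 2 * y ^+ 2.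
Proof.
move=> hy; have h1 : 1 - y <= expR (- y) by exact: expR_ge1Dx.
have h0 : 0 < 1 - y by lra.
rewrite -[y in expR y]opprK expRN.
apply: (@le_trans _ _ (1 - y)^-1); first by rewrite lef_pV2 ?posrE ?expR_gt0.
rewrite -[leLHS]mul1r ler_pdivrMr //.
have : 0 <= y ^+ 2 * (1 - 2 * y) by rewrite mulr_ge0 ?sqr_ge0//; lra.
by rewrite (_ : _ * (1 - y) = 1 + y ^+ 2 * (1 - 2 * y)) ?lerDl//; ring.
Qed.

Lemma exists_le_of_mean (A : finType) (lam Psi : A -> R) (M : R) :
  (forall a, 0 <= lam a) -> \sum_a lam a = 1 -> \sum_a lam a * Psi a <= M ->
  exists a, Psi a <= M.
Proof.
move=> l0 l1 hM; apply: contrapT => /forallNP hn.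
have hlt a : M < Psi a by rewrite ltNge; apply/negP; exact: hn.
have : \sum_a lam a * M < \sum_a lam a * Psi a.
  have [a la] : exists a, lam a != 0.
    apply: contrapT => /forallNP h; have := l1.
    rewrite big1 => [/eqP|a _]; first by rewrite eq_sym oner_eq0.
    by apply/eqP/negPn/negP; exact: h.
  rewrite [ltLHS](bigD1 a)// [ltRHS](bigD1 a)//=.
  rewrite ltr_leD ?ltr_pM2l ?lt0r ?la ?l0// ler_sum// => b _.
  by rewrite ler_wpM2l// ltW.
by rewrite -mulr_suml l1 mul1r ltNge hM.
Qed.

(* Derandomised Maurey argument: the atoms are chosen one at a time so that the
   exponential moment of the accumulated error grows at most as it does on
   average. *)
Lemma maurey_potential (X A : finType) (g : A -> X -> R) (f : X -> R)
    (lam : A -> R) (theta : R) (L : nat) :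
  (forall a x, `|g a x| <= 1) ->
  (forall a, 0 <= lam a) -> \sum_a lam a = 1 ->
  (forall x, f x = \sum_a lam a * g a x) ->
  0 < theta <= 4^-1 ->
  exists s : L.-tuple A,
    \sum_x (expR (theta * \sum_(a <- s) (g a x - f x)) +
            expR (- (theta * \sum_(a <- s) (g a x - f x))))
    <= 2 * #|X|%:R * expR (8 * theta ^+ 2 * L%:R).
Proof.
move=> hg l0 l1 hf /andP[th0 th4].
have hf1 x : `|f x| <= 1.
  rewrite hf (le_trans (ler_norm_sum _ _ _))// -l1 ler_sum// => a _.
  by rewrite normrM ger0_norm// ler_piMr.
have h0 x : \sum_a lam a * (g a x - f x) = 0.
  under eq_bigr do rewrite mulrBr.
  by rewrite sumrB -hf -mulr_suml l1 mul1r subrr.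
(* The linear term averages to zero by [h0]. Since |g - f| <= 2, the quadratic term 2 y^2 is at most
   8 theta^2, and theta <= 1/4 keeps y below 1/2. *)
have key x (sg : R) : `|sg| = 1 ->
    \sum_a lam a * expR (sg * (theta * (g a x - f x))) <= expR (8 * theta ^+ 2).
  move=> hs; apply: le_trans (expR_ge1Dx _).
  have -> : 1 + 8 * theta ^+ 2 = \sum_a lam a *
      (1 + sg * (theta * (g a x - f x)) + 8 * theta ^+ 2).
    under eq_bigr => a _.
      rewrite (_ : _ * _ = lam a + (sg * theta) * (lam a * (g a x - f x)) +
        lam a * (8 * theta ^+ 2)); last by ring.
      over.
    by rewrite !big_split/= -mulr_suml -mulr_sumr h0 l1; ring.
  apply: ler_sum => a _; apply: ler_wpM2l => //.
  set y := sg * _.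
  have hy : `|y| <= 2 * theta.
    rewrite /y 2!normrM hs mul1r (gtr0_norm th0) mulrC ler_pM2r//.
    by rewrite (le_trans (ler_normB _ _))// (_ : 2 = 1 + 1)// lerD.
  apply: (le_trans (expR_le_quadratic _)).
    by rewrite (le_trans (ler_norm _))// (le_trans hy)//; lra.
  rewrite lerD2l.
  have : `|y| ^+ 2 <= (2 * theta) ^+ 2 by rewrite lerXn2r ?nnegrE//; lra.
  rewrite real_normK ?num_real//; lra.
elim: L => [|L [s IH]].
  exists [tuple]; rewrite mulr0 expR0 mulr1.
  under eq_bigr do rewrite big_nil mulr0 oppr0 expR0.
  by rewrite sumr_const cardE -mulr_natr; lra.
pose P (x : X) sg : R := expR (sg * (theta * \sum_(a <- s) (g a x - f x))).
have [a ha] : exists a, \sum_x (P x 1 * expR (1 * (theta * (g a x - f x))) +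
     P x (-1) * expR ((-1) * (theta * (g a x - f x))))
   <= 2 * #|X|%:R * expR (8 * theta ^+ 2 * L.+1%:R).
  apply: (exists_le_of_mean l0 l1).
  under eq_bigr do rewrite mulr_sumr.
  rewrite exchange_big/=.
  apply: (@le_trans _ _ (expR (8 * theta ^+ 2) * \sum_x (P x 1 + P x (-1)))).
    rewrite mulr_sumr; apply: ler_sum => x _.
    under eq_bigr => a _.
      rewrite mulrDr mulrCA (mulrCA (lam a)); over.
    rewrite big_split/= -!mulr_sumr mulrDr.
    by rewrite lerD// mulrC ler_wpM2r ?expR_ge0// key ?normr1 ?normrN1.
  rewrite -[L.+1%:R]natr1 mulrDr mulr1 expRD [leRHS]mulrA [leRHS]mulrC.
  apply: ler_wpM2l; first exact: expR_ge0.
  by move: IH; congr (_ <= _); apply: eq_bigr => x _; rewrite /P mul1r mulN1r.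
exists [tuple of a :: s]; move: ha; congr (_ <= _); apply: eq_bigr => x _.
by rewrite big_cons /P !mul1r !mulN1r -!expRD -mulrDr -opprD -mulrDr [_ + (g a x - f x)]addrC.
Qed.

(** Each point x contributes one term of the potential, so the bound on the total controls all
    points at once. With theta = eta / 16 both D / theta and 8 theta L are at most eta L / 2. *)
Lemma maurey (X A : finType) (g : A -> X -> R) (f : X -> R)
    (lam : A -> R) (eta D : R) (L : nat) :
  (forall a x, `|g a x| <= 1) ->
  (forall a, 0 <= lam a) -> \sum_a lam a = 1 ->
  (forall x, f x = \sum_a lam a * g a x) ->
  0 < eta <= 4 -> 2 * #|X|%:R <= expR D -> 32 * D <= eta ^+ 2 * L%:R ->
  (0 < L)%N ->
  exists s : L.-tuple A,
    forall x, `|f x - L%:R^-1 * \sum_(a <- s) g a x| <= eta.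
Proof.
move=> hg l0 l1 hf /andP[e0 e4] hD hL L0.
have [|s hs] := @maurey_potential X A g f lam (eta / 16) L hg l0 l1 hf.
  by lra.
exists s => x; set Z := \sum_(a <- s) (g a x - f x).
have hZ : eta / 16 * `|Z| <= D + 8 * (eta / 16) ^+ 2 * L%:R.
  rewrite -ler_expR expRD.
  apply: le_trans (le_trans hs (ler_wpM2r (expR_ge0 _) hD)).
  rewrite (bigD1 x)//= -/Z -[leLHS]addr0.
  apply: lerD; last by apply: sumr_ge0 => y _; rewrite addr_ge0 ?expR_ge0.
  have [z0|z0] := leP 0 Z; first by rewrite (ger0_norm z0) lerDl expR_ge0.
  by rewrite (ltr0_norm z0) mulrN lerDr expR_ge0.
have L0' : 0 < L%:R :> R by rewrite ltr0n.
have -> : f x - L%:R^-1 * \sum_(a <- s) g a x = - (L%:R^-1 * Z).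
  rewrite /Z sumrB big_const_seq count_predT size_tuple iter_addr_0 -mulr_natl.
  by field; rewrite gt_eqF.
rewrite normrN normrM gtr0_norm ?invr_gt0// mulrC ler_pdivrMr//.
have : eta * `|Z| <= eta * (eta * L%:R) by lra.
by rewrite ler_pM2l.
Qed.

(** A union bound by counting: the proportion of m-tuples that miss [E j] is at most (1 - rho j)^m
    <= exp(- rho j m), and these proportions sum to less than 1. *)
Lemma exists_hitting_tuple (X J : finType) (m : nat) (E : J -> {set X})
    (rho : J -> R) :
  (0 < #|X|)%N -> (forall j, rho j * #|X|%:R <= #|E j|%:R) ->
  \sum_j expR (- (rho j * m%:R)) < 1 ->
  exists T : {ffun 'I_m -> X}, forall j, exists i, T i \in E j.
Proof.
move=> X0 hE hs.
pose bad j := [set T : {ffun 'I_m -> X} | [forall i, T i \notin E j]].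
have X0' : 0 < #|X|%:R :> R by rewrite ltr0n.
have cbad j : #|bad j|%:R <= #|X|%:R ^+ m * expR (- (rho j * m%:R)) :> R.
  have -> : #|bad j| = ((#|X| - #|E j|) ^ m)%N.
    transitivity #|@ffun_on_mem 'I_m X (mem (~: E j))|; last first.
      by rewrite card_ffun_on card_ord cardsCs finset.setCK.
    apply: eq_card => T; rewrite inE; apply/forallP/ffun_onP => h i;
      by have := h i; rewrite inE.
  rewrite natrX mulrC -[rho j * _]mulrC -mulrN mulrC expRM_natl -exprMn.
  rewrite lerXn2r ?nnegrE ?mulr_ge0 ?expR_ge0 ?ler0n//.
  rewrite natrB ?max_card//.
  apply: (@le_trans _ _ (#|X|%:R * (1 - rho j))).
    by have := hE j; rewrite mulrBr mulr1 lerD2l lerN2 mulrC.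
  by rewrite ler_wpM2l ?ler0n// expR_ge1Dx.
have : (#|\bigcup_j bad j| < #|{ffun 'I_m -> X}|)%N.
  rewrite -(ltr_nat R).
  apply: (@le_lt_trans _ _ (\sum_j #|bad j|%:R)).
    rewrite -natr_sum ler_nat; elim/big_rec2: _ => [|j y1 y2 _ h].
      by rewrite cards0.
    by rewrite (leq_trans _ (leq_add (leqnn _) h))// cardsU leq_subr.
  apply: (le_lt_trans (ler_sum _ (fun j _ => cbad j))).
  by rewrite -mulr_sumr card_ffun card_ord natrX gtr_pMr ?exprn_gt0.
rewrite -[X in (_ < X)%N]cardsT => h.
have [T _ hT] : exists2 T, T \in [set: {ffun 'I_m -> X}] & T \notin \bigcup_j bad j.
  apply/subsetPn/negP => /subset_leq_card; rewrite leqNgt h//.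
exists T => j; move: hT; apply: contraNP => /forallNP hT.
apply/bigcupP; exists j => //; rewrite inE; apply/forallP => i; apply/negP; exact: hT.
Qed.

End compressed_sensing.

(** * Detection of large combinations, one dyadic height at a time *)

Section sparse_hitting.
Variable R : realType.

(** One layer suffices: for a > 1/2 the highest layer with 2^i / 2 < a has a <= 2^i. Values up to
    1/2 are paid for by the term 1/4. *)
Lemma sqr_le_dyadic_layers (a : R) (I : nat) : 0 <= a <= 2 ^+ I ->
  a ^+ 2 <= 4^-1 + \sum_(i < I.+1) 4 ^+ i * (2 ^+ i / 2 < a)%R%:R.
Proof.
elim: I => [|I IH] /andP[a0 aI].
  rewrite big_ord1 !expr0 mul1r; move: aI; rewrite expr0 => aI.
  have a1 : a ^+ 2 <= a * 1 by rewrite expr2 ler_wpM2l.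
  have [h|h] := ltP (1 / 2) a; rewrite /=; first lra.
  have : a ^+ 2 <= a * (1 / 2) by rewrite expr2 ler_wpM2l.
  lra.
rewrite big_ord_recr/=; have [h|h] := leP a (2 ^+ I).
  apply: le_trans (IH _) _; first by rewrite a0.
  by rewrite addrA lerDl mulr_ge0 ?exprn_ge0 ?ler0n.
rewrite (_ : 2 ^+ I.+1 / 2 = 2 ^+ I); last by rewrite exprS; field.
rewrite h mulr1 addrA -[leLHS]add0r lerD//.
  by rewrite addr_ge0 ?invr_ge0// sumr_ge0// => i _; rewrite mulr_ge0 ?exprn_ge0.
rewrite (_ : 4 = 2 ^+ 2); last by rewrite expr2; lra.
by rewrite -exprM mulnC exprM lerXn2r ?nnegrE ?exprn_ge0.
Qed.

Lemma sum_bool_pair (K : finType) (F : bool * K -> R) :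
  \sum_a F a = \sum_k (F (true, k) + F (false, k)).
Proof.
transitivity (\sum_b \sum_k F (b, k)).
  by rewrite pair_bigA; apply: eq_bigr => -[].
by rewrite big_bool -big_split.
Qed.

(** The atoms are the functions e_k with both signs, weighted by the positive and negative parts of
    v_k / B. The mass missing from a convex combination is spread evenly over both signs, where it
    cancels. *)
Lemma maurey_signed (X K : finType) (e : K -> X -> R) (v : K -> R)
    (B eta D : R) (L : nat) :
  (0 < #|K|)%N -> (forall k x, `|e k x| <= 1) ->
  0 < B -> \sum_k `|v k| <= B ->
  0 < eta <= 4 -> 2 * #|X|%:R <= expR D -> 32 * D <= eta ^+ 2 * L%:R ->
  (0 < L)%N ->
  exists s : L.-tuple (bool * K),
    forall x, `|\sum_k v k * e k x
       - B * (L%:R^-1 * \sum_(a <- s) (-1) ^+ a.1 * e a.2 x)| <= B * eta.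
Proof.
move=> K0 he B0 hv heta hD hL L0.
have K0' : 0 < #|K|%:R :> R by rewrite ltr0n.
pose pad : R := (1 - (\sum_k `|v k|) / B) / (2 * #|K|%:R).
have pad0 : 0 <= pad.
  rewrite divr_ge0 ?mulr_ge0 ?ler0n// subr_ge0 ler_pdivrMr// mul1r//.
pose lam (a : bool * K) := (`|v a.2| + (-1) ^+ a.1 * v a.2) / (2 * B) + pad.
have [||||s hs] := @maurey R X (bool * K)%type (fun a x => (-1) ^+ a.1 * e a.2 x)
  (fun x => (\sum_k v k * e k x) / B) lam eta D L _ _ _ _ heta hD hL L0.
- by move=> a x; rewrite normrM normrX normrN1 expr1n mul1r.
- move=> [b k]; rewrite addr_ge0// divr_ge0 ?mulr_ge0 ?(ltW B0)//=.
  by have := ler_norm (v k); have := ler_norm (- v k); rewrite normrN; case: b => /=; lra.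
- rewrite sum_bool_pair.
  rewrite (eq_bigr (fun k => `|v k| / B + 2 * pad)) => [|k _]; last first.
    by rewrite /lam/= expr1 expr0; field; rewrite gt_eqF.
  rewrite big_split/= -mulr_suml sumr_const -[_ *+ #|K|]mulr_natr /pad.
  by field; rewrite ?gt_eqF.
- move=> x; rewrite sum_bool_pair mulr_suml; apply: eq_bigr => k _.
  by rewrite /lam/= expr1 expr0; field; rewrite gt_eqF.
exists s => x; have := hs x; rewrite -(ler_pM2l B0); congr (_ <= _).
by rewrite -[X in X * _](gtr0_norm B0) -normrM; congr `|_|; field; rewrite !gt_eqF ?ltr0n.
Qed.

(** [D] and [kap] bound the logarithms of twice the sizes of the grid and of the dictionary. At
    height 2^i there are about exp(kap D B^2 / 4^i) candidates up to constants in the exponent, and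
    each has a detection set of density 1 / (2 (I+1) 4^i). The union bound asks that m times the
    density beat the exponent, a condition from which 4^i disappears. *)
Lemma sparse_hitting (X K : finType) (e : K -> X -> R) (I m : nat)
    (B D kap : R) :
  (0 < #|X|)%N -> (0 < #|K|)%N -> (forall k x, `|e k x| <= 1) ->
  1 <= B -> B <= 2 ^+ I -> 2 ^+ I <= 2 * B ->
  1 <= D -> 2 * #|X|%:R <= expR D -> 2 * #|K|%:R <= expR kap ->
  2 * I.+1%:R * B ^+ 2 * (64 * 64 * D * kap + 4 * I.+1%:R) <= m%:R ->
  exists T : {ffun 'I_m -> X}, forall v : K -> R,
    \sum_k `|v k| <= B -> #|X|%:R <= \sum_x (\sum_k v k * e k x) ^+ 2 ->
    exists i, 4^-1 <= `|\sum_k v k * e k (T i)|.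
Proof.
move=> X0 K0 he B1 BI IB D1 hD hkap hm.
have X0' : 0 < #|X|%:R :> R by rewrite ltr0n.
(* This is what [maurey] asks for at accuracy eta = 2^i / (8 B): 32 D / eta^2 = 64 * 32 * D B^2 /
   4^i. *)
have [c hc] : exists c : R, c = 64 * 32 by eexists.
have c4 : 4 <= c by rewrite hc; lra.
rewrite (_ : 64 * 64 = 2 * c) in hm; last by rewrite hc; lra.
have B0 : 0 < B by lra.
have I0 : 0 < I.+1%:R :> R by rewrite ltr0n.
have kap0 : 0 <= kap.
  rewrite -ler_expR expR0; apply: le_trans hkap.
  have : 1 <= #|K|%:R :> R by rewrite ler1n.
  lra.
pose P (i : nat) : R := 4 ^+ i.
have P0 i : 0 < P i by rewrite exprn_gt0.
have P2 i : (2 ^+ i) ^+ 2 = P i by rewrite exprAC; congr (_ ^+ _); rewrite expr2; lra.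
have PB i : (i <= I)%N -> P i <= 4 * B ^+ 2.
  move=> iI; rewrite -P2 (_ : 4 * B ^+ 2 = (2 * B) ^+ 2); last by ring.
  rewrite lerXn2r ?nnegrE ?exprn_ge0//; first lra.
  by apply: le_trans IB; rewrite ler_eXn2l//; lra.
pose y (i : nat) : R := c * D * B ^+ 2 / P i.
pose L (i : nat) : nat := (Num.truncn (y i)).+1.
have y0 i : 0 < y i by rewrite divr_gt0 ?P0// !mulr_gt0 ?exprn_gt0//; lra.
have y1 i : (i <= I)%N -> 1 <= y i.
  move=> iI; rewrite /y ler_pdivlMr// mul1r (le_trans (PB _ iI))//.
  by rewrite ler_wpM2r ?sqr_ge0//; nra.
have Ly i : y i <= (L i)%:R by rewrite ltW// truncnS_gt.
have Ly2 i : (i <= I)%N -> (L i)%:R <= 2 * y i.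
  move=> iI; have := y1 _ iI; rewrite /L -natr1.
  have : (Num.truncn (y i))%:R <= y i by rewrite truncn_le ltW.
  lra.
pose rho (i : nat) : R := (2 * I.+1%:R * P i)^-1.
pose J := {i : 'I_I.+1 & (L i).-tuple (bool * K)}.
pose F (j : J) (x : X) : R :=
  B * ((L (tag j))%:R^-1 * \sum_(a <- tagged j) (-1) ^+ a.1 * e a.2 x).
(* The approximant F will lie within 2^i / 8 of f. Hence |f| > 2^i / 2 forces |F| > 3/8 2^i, and
   this in turn forces |f| > 2^i / 4 >= 1/4. *)
pose E0 (j : J) := [set x | 3 * 2 ^+ tag j / 8 < `|F j x|]%SET.
(* Candidates whose detection set is too thin get the whole grid, so that the density hypothesis
   holds for all of them. The candidate chosen for an actual f at a thick layer never falls under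
   this default. *)
pose E (j : J) := if rho (tag j) * #|X|%:R <= #|E0 j|%:R then E0 j else [set: X].
have rho1 i : rho i <= 1.
  rewrite /rho invf_le1 ?mulr_gt0//.
  have h1 : 1 <= I.+1%:R :> R by rewrite ler1n.
  have h2 : 1 <= P i by rewrite exprn_ege1//; lra.
  nra.
have [||T hT] := @exists_hitting_tuple R X J m E (fun j => rho (tag j)) X0.
- move=> j; rewrite /E; case: ifP => // _.
  by rewrite cardsT ler_piMl// ltW.
- rewrite -(sig_big_dep xpredT (fun=> xpredT)
    (fun (i : 'I_I.+1) (s : (L i).-tuple (bool * K)) => expR (- (rho i * m%:R))))/=.
  (* Each of the I+1 layers is allowed the share 1 / (I+2). The summand 4 (I+1) in the condition on
     m pays for it, through ln (I+2) <= I+1. *)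
  apply: (@le_lt_trans _ _ (\sum_(i < I.+1) (I.+2%:R)^-1 )); last first.
    by rewrite sumr_const card_ord -[_ *+ I.+1]mulr_natl ltr_pdivrMr ?ltr0n// mul1r ltr_nat.
  apply: ler_sum => i _; rewrite sumr_const card_tuple card_prod card_bool -[leLHS]mulr_natr.
  rewrite natrX natrM -[leRHS]lnK ?posrE ?invr_gt0 ?ltr0n//.
  apply: (@le_trans _ _ (expR (- (rho i * m%:R)) * expR ((L i)%:R * kap))).
    rewrite ler_wpM2l ?expR_ge0// expRM_natl lerXn2r ?nnegrE ?expR_ge0//.
  rewrite -expRD ler_expR lnV ?posrE ?ltr0n//.
  have iI : (i <= I)%N by rewrite -ltnS.
  have hln : ln (I.+2%:R) <= I.+1%:R :> R.
    by rewrite -natr1 addrC le_ln1Dx// (lt_le_trans _ (ler0n _ _))// ltrN10.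
  have h1 : (2 * c * D * kap + 4 * I.+1%:R) * B ^+ 2 / P i <= rho i * m%:R.
    rewrite [leRHS]mulrC /rho ler_pdivlMr ?mulr_gt0//.
    apply: le_trans hm; rewrite le_eqVlt; apply/orP; left; apply/eqP.
    by field; rewrite gt_eqF.
  have h2 : I.+1%:R <= 4 * I.+1%:R * B ^+ 2 / P i.
    rewrite ler_pdivlMr// (_ : 4 * _ * _ = I.+1%:R * (4 * B ^+ 2)); last by ring.
    by rewrite ler_pM2l// PB.
  have h3 : (L i)%:R * kap <= 2 * c * D * kap * B ^+ 2 / P i.
    apply: (le_trans (ler_wpM2r kap0 (Ly2 i iI))); rewrite /y le_eqVlt.
    by apply/orP; left; apply/eqP; field; rewrite gt_eqF.
  have h4 : (2 * c * D * kap + 4 * I.+1%:R) * B ^+ 2 / P i =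
     2 * c * D * kap * B ^+ 2 / P i + 4 * I.+1%:R * B ^+ 2 / P i.
    by rewrite -mulrDl -mulrDl.
  lra.
exists T => v hv hf; set f := fun x => \sum_k v k * e k x.
have fB x : `|f x| <= B.
  apply: le_trans hv; rewrite (le_trans (ler_norm_sum _ _ _))// ler_sum// => k _.
  by rewrite normrM ler_piMr.
(* If all layers were thin, the sum of f^2 would be at most |X| / 4 plus the layer terms 4^i rho_i
   |X|, which add up to |X| / 2: less than |X|. *)
have [i hi] : exists i : 'I_I.+1,
    rho i * #|X|%:R <= #|[set x | 2 ^+ i / 2 < `|f x|]%SET|%:R.
  apply: contrapT => /forallNP hn.
  have : #|X|%:R <= \sum_x (4^-1 + \sum_(i < I.+1) 4 ^+ i * (2 ^+ i / 2 < `|f x|)%R%:R) :> R.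
    apply: (le_trans hf); apply: ler_sum => x _.
    by rewrite -real_normK ?num_real// sqr_le_dyadic_layers// normr_ge0 (le_trans (fB x)).
  rewrite big_split/= sumr_const -mulr_natr exchange_big/=.
  have : \sum_(i < I.+1) \sum_x (4 ^+ i * (2 ^+ i / 2 < `|f x|)%R%:R) <=
         \sum_(i < I.+1) 4 ^+ i * (rho i * #|X|%:R) :> R.
    apply: ler_sum => i _; rewrite -mulr_sumr ler_wpM2l ?exprn_ge0//.
    have -> : \sum_x (2 ^+ i / 2 < `|f x|)%R%:R =
              #|[set x | 2 ^+ i / 2 < `|f x|]%SET|%:R :> R.
      rewrite cardsE -sum1_card natr_sum [RHS]big_mkcond; apply: eq_bigr => x _.
      by rewrite [x \in _](_ : _ = (2 ^+ i / 2 < `|f x|)%R)//; case: (_ < _)%R.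
    by apply: ltW; rewrite ltNge; apply/negP; exact: hn.
  have -> : \sum_(i < I.+1) 4 ^+ i * (rho i * #|X|%:R) = #|X|%:R / 2 :> R.
    rewrite (eq_bigr (fun=> #|X|%:R / (2 * I.+1%:R))) => [|i _]; last first.
      by rewrite /rho /P; field; rewrite !gt_eqF// exprn_gt0.
    rewrite sumr_const card_ord -[LHS]mulr_natr.
    by field; rewrite gt_eqF.
  lra.
have heta : 0 < 2 ^+ i / (8 * B) <= 4.
  rewrite divr_gt0 ?exprn_gt0 ?mulr_gt0//= ler_pdivrMr ?mulr_gt0//.
  have := PB i; rewrite -ltnS ltn_ord => /(_ isT).
  rewrite -P2 (_ : 4 * B ^+ 2 = (2 * B) ^+ 2); last by ring.
  rewrite ler_pXn2r ?nnegrE ?exprn_ge0 ?mulr_ge0 ?(ltW B0)//; lra.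
have [||s hs] := @maurey_signed X K e v B (2 ^+ i / (8 * B)) D (L i) K0 he B0 hv heta hD.
- apply: le_trans (ler_wpM2l (sqr_ge0 _) (Ly i)).
  rewrite /y hc expr_div_n P2 le_eqVlt; apply/orP; left; apply/eqP.
  by field; rewrite !gt_eqF.
- by [].
have hs' x : `|f x - F (existT _ i s : J) x| <= 2 ^+ i / 8.
  by move: (hs x); rewrite (_ : B * (_ / _) = 2 ^+ i / 8)//; field; rewrite gt_eqF.
have [t ht] := hT (existT _ i s : J).
have {}ht : 3 * 2 ^+ i / 8 < `|F (existT _ i s : J) (T t)|.
  move: ht; rewrite /E ifT/=; first by rewrite inE.
  apply: (le_trans hi); rewrite ler_nat subset_leq_card//; apply/fintype.subsetP => x.
  rewrite !inE/= => hx.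
  have := ler_normD (f x - F (existT _ i s : J) x) (F (existT _ i s : J) x).
  rewrite subrK; have := hs' x; lra.
exists t; have := hs' (T t); rewrite -/(f (T t)).
have := ler_normB (f (T t)) (f (T t) - F (existT _ i s : J) (T t)).
rewrite subKr.
have : 1 <= 2 ^+ i :> R by rewrite exprn_ege1//; lra.
lra.
Qed.

End sparse_hitting.


Local Open Scope classical_set_scope.
Local Open Scope ring_scope.

(** * Bounded functions and orthonormal systems on the torus *)

Section bounded_measurable.
Context {dd : measure_display} {T : measurableType dd} {R : realType}.

(** A class closed under sums, products and powers and integrable for every probability, so that
    identities between integrals need no separate integrability argument. *)
Definition bounded_measurable (f : T -> R) :=
  measurable_fun setT f /\ exists M : R, forall x, `|f x| <= M.

Lemma bmC (c : R) : bounded_measurable (fun=> c).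
Proof. by split; [exact: measurable_cst | exists `|c|]. Qed.

Lemma bmD f g : bounded_measurable f -> bounded_measurable g ->
  bounded_measurable (fun x => f x + g x).
Proof.
move=> [mf [M hM]] [mg [N hN]]; split; first exact: measurable_funD.
by exists (M + N) => x; rewrite (le_trans (ler_normD _ _))// lerD.
Qed.

Lemma bmM f g : bounded_measurable f -> bounded_measurable g ->
  bounded_measurable (fun x => f x * g x).
Proof.
move=> [mf [M hM]] [mg [N hN]]; split; first exact: measurable_funM.
by exists (M * N) => x; rewrite normrM ler_pM.
Qed.

Lemma bmN f : bounded_measurable f -> bounded_measurable (fun x => - f x).
Proof.
move=> bf; have := bmM (bmC (-1)) bf; congr bounded_measurable.
by apply/funext => x; rewrite mulN1r.
Qed.

Lemma bmB f g : bounded_measurable f -> bounded_measurable g ->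
  bounded_measurable (fun x => f x - g x).
Proof. by move=> bf bg; apply: bmD => //; exact: bmN. Qed.

Lemma bmZ c f : bounded_measurable f -> bounded_measurable (fun x => c * f x).
Proof. by move=> bf; apply: bmM => //; exact: bmC. Qed.

Lemma bm_sum (I : Type) (s : seq I) (P : pred I) (F : I -> T -> R) :
  (forall i, bounded_measurable (F i)) ->
  bounded_measurable (fun x => \sum_(i <- s | P i) F i x).
Proof.
move=> hF; elim: s => [|i s IH].
  by under eq_fun do rewrite big_nil; exact: bmC.
under eq_fun do rewrite big_cons.
by case: (P i) => //; exact: bmD.
Qed.

Lemma bm_prod (I : Type) (s : seq I) (P : pred I) (F : I -> T -> R) :
  (forall i, bounded_measurable (F i)) ->
  bounded_measurable (fun x => \prod_(i <- s | P i) F i x).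
Proof.
move=> hF; elim: s => [|i s IH].
  by under eq_fun do rewrite big_nil; exact: bmC.
under eq_fun do rewrite big_cons.
by case: (P i) => //; exact: bmM.
Qed.

Lemma bm_norm f : bounded_measurable f -> bounded_measurable (fun x => `|f x|).
Proof.
move=> [mf [M hM]]; split; first exact: measurableT_comp.
by exists M => x; rewrite normr_id.
Qed.

Lemma bmX f n : bounded_measurable f -> bounded_measurable (fun x => f x ^+ n).
Proof.
move=> bf; elim: n => [|n IH]; first by under eq_fun do rewrite expr0; exact: bmC.
by under eq_fun do rewrite exprS; exact: bmM.
Qed.

Lemma bm_powR f p : 0 <= p -> bounded_measurable f ->
  bounded_measurable (fun x => `|f x| `^ p).
Proof.
move=> p0 [mf [M hM]]; split.
  by apply: (measurableT_comp (measurable_powR p)); exact: measurableT_comp.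
exists (M `^ p) => x; rewrite ger0_norm ?powR_ge0//.
by rewrite ge0_ler_powR// nnegrE// (le_trans _ (hM x)).
Qed.

Lemma bm_if f g (b : T -> bool) : measurable_fun setT b ->
  bounded_measurable f -> bounded_measurable g ->
  bounded_measurable (fun x => if b x then f x else g x).
Proof.
move=> mb [mf [M hM]] [mg [N hN]]; split; first exact: measurable_fun_ifT.
exists (`|M| + `|N|) => x; case: (b x).
  by rewrite (le_trans (hM x))// (le_trans (ler_norm _))// lerDl.
by rewrite (le_trans (hN x))// (le_trans (ler_norm _))// lerDr.
Qed.

Variable P : probability T R.

Lemma bm_integrable f : bounded_measurable f -> P.-integrable setT (EFin \o f).
Proof.
move=> [mf [M hM]]; have ic := @finite_measure_integrable_cst _ T R P setT `|M| measurableT.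
apply: (le_integrable measurableT _ _ ic).
- exact/measurable_EFinP.
- by move=> x _ /=; rewrite lee_fin normr_id (le_trans (hM x))// ler_norm.
Qed.

Lemma EFin_bm_int f : bounded_measurable f ->
  ((\int[P]_x f x)%:E = \int[P]_x (f x)%:E)%E.
Proof.
move=> bf; rewrite /Rintegral fineK//.
exact: (integrable_fin_num measurableT (bm_integrable bf)).
Qed.

Lemma bm_intD f g : bounded_measurable f -> bounded_measurable g ->
  \int[P]_x (f x + g x) = \int[P]_x f x + \int[P]_x g x.
Proof. by move=> bf bg; rewrite RintegralD//; exact: bm_integrable. Qed.

Lemma bm_intZ c f : bounded_measurable f ->
  \int[P]_x (c * f x) = c * \int[P]_x f x.
Proof. by move=> bf; rewrite RintegralZl//; exact: bm_integrable. Qed.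

Lemma prob_int_cst (c : R) : \int[P]_x c = c.
Proof.
rewrite Rintegral_cst// -[RHS]mulr1; congr (_ * _).
by have := @probability_setT _ _ _ P; move=> /= ->.
Qed.

Lemma bm_int_sum (I : Type) (s : seq I) (Q : pred I) (F : I -> T -> R) :
  (forall i, bounded_measurable (F i)) ->
  \int[P]_x (\sum_(i <- s | Q i) F i x) = \sum_(i <- s | Q i) \int[P]_x F i x.
Proof.
move=> hF; elim: s => [|i s IH].
  by under eq_Rintegral do rewrite big_nil; rewrite big_nil prob_int_cst.
under eq_Rintegral do rewrite big_cons.
rewrite big_cons; case: (Q i) => //.
by rewrite bm_intD ?IH//; exact: bm_sum.
Qed.

Lemma bm_int_le f g : bounded_measurable f -> bounded_measurable g ->
  (forall x, f x <= g x) -> \int[P]_x f x <= \int[P]_x g x.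
Proof. by move=> bf bg fg; rewrite le_Rintegral//; exact: bm_integrable. Qed.

Lemma bm_int_norm f : bounded_measurable f ->
  `|\int[P]_x f x| <= \int[P]_x `|f x|.
Proof. by move=> bf; rewrite le_normr_Rintegral//; exact: bm_integrable. Qed.

(* Expand [0 <= int (u - sum_k c_k e_k)^2] with [c_k = int u e_k]. *)
Lemma bessel (K : finType) (e : K -> T -> R) (u : T -> R) :
  (forall k, bounded_measurable (e k)) -> bounded_measurable u ->
  (forall k l, \int[P]_x (e k x * e l x) = (k == l)%:R) ->
  \sum_k (\int[P]_x (u x * e k x)) ^+ 2 <= \int[P]_x (u x ^+ 2).
Proof.
move=> be bu oe; pose c k := \int[P]_x (u x * e k x).
have bs : bounded_measurable (fun x => \sum_k c k * e k x).
  by apply: bm_sum => k; exact: bmZ.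
have h1 : \int[P]_x (u x * \sum_k c k * e k x) = \sum_k c k ^+ 2.
  transitivity (\int[P]_x (\sum_k c k * (u x * e k x))).
    by apply: eq_Rintegral => x _; rewrite mulr_sumr; apply: eq_bigr => k _; rewrite mulrCA.
  rewrite bm_int_sum; last by move=> k; apply: bmZ; exact: bmM.
  by apply: eq_bigr => k _; rewrite bm_intZ//; exact: bmM.
have h2 : \int[P]_x ((\sum_k c k * e k x) ^+ 2) = \sum_k c k ^+ 2.
  transitivity (\int[P]_x (\sum_k \sum_l (c k * c l) * (e k x * e l x))).
    apply: eq_Rintegral => x _; rewrite expr2 mulr_suml; apply: eq_bigr => k _.
    by rewrite mulr_sumr; apply: eq_bigr => l _; rewrite mulrACA.
  rewrite bm_int_sum; last first.
    by move=> k; apply: bm_sum => l; apply: bmZ; exact: bmM.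
  apply: eq_bigr => k _; rewrite bm_int_sum; last first.
    by move=> l; apply: bmZ; exact: bmM.
  rewrite (bigD1 k)//= big1 ?addr0 => [|l lk]; rewrite bm_intZ ?oe; try exact: bmM.
    by rewrite eqxx mulr1 expr2.
  by rewrite eq_sym (negbTE lk) mulr0.
have : 0 <= \int[P]_x ((u x - \sum_k c k * e k x) ^+ 2).
  by apply: Rintegral_ge0 => x _; exact: sqr_ge0.
rewrite (_ : \int[P]_x ((u x - \sum_k c k * e k x) ^+ 2) =
   \int[P]_x (u x ^+ 2) - \sum_k c k ^+ 2) ?subr_ge0//.
transitivity (\int[P]_x (u x ^+ 2 + ((-2) * (u x * \sum_k c k * e k x) +
                         (\sum_k c k * e k x) ^+ 2))).
  by apply: eq_Rintegral => x _; ring.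
rewrite bm_intD; [|exact: bmX|by apply: bmD; [apply: bmZ; exact: bmM|exact: bmX]].
rewrite bm_intD; [|by apply: bmZ; exact: bmM|exact: bmX].
by rewrite bm_intZ; [rewrite h1 h2; ring|exact: bmM].
Qed.

Lemma parseval (K : finType) (e : K -> T -> R) (v : K -> R) :
  (forall k, bounded_measurable (e k)) ->
  (forall k l, \int[P]_x (e k x * e l x) = (k == l)%:R) ->
  \int[P]_x ((\sum_k v k * e k x) ^+ 2) = \sum_k v k ^+ 2.
Proof.
move=> be oe.
transitivity (\int[P]_x (\sum_k \sum_l (v k * v l) * (e k x * e l x))).
  apply: eq_Rintegral => x _; rewrite expr2 mulr_suml; apply: eq_bigr => k _.
  by rewrite mulr_sumr; apply: eq_bigr => l _; rewrite mulrACA.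
rewrite bm_int_sum; last first.
  by move=> k; apply: bm_sum => l; apply: bmZ; exact: bmM.
apply: eq_bigr => k _; rewrite bm_int_sum; last first.
  by move=> l; apply: bmZ; exact: bmM.
rewrite (bigD1 k)//= big1 ?addr0 => [|l lk]; rewrite bm_intZ ?oe; try exact: bmM.
  by rewrite eqxx mulr1 expr2.
by rewrite eq_sym (negbTE lk) mulr0.
Qed.

End bounded_measurable.

Section power_probability.
Context {dd : measure_display} {T : measurableType dd} {R : realType}.
Variable P : probability T R.
Local Notation cns x y := [the _.-tuple T of x :: y].

Lemma measurable_comp_cons n (dZ : measure_display) (Z : measurableType dZ)
    (f : n.+1.-tuple T -> Z) : measurable_fun setT f ->
  measurable_fun setT (fun z : T * n.-tuple T => f (tuple_consf z)).
Proof. by move=> mf; apply: measurableT_comp => //; exact: measurable_tuple_consf. Qed.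

Lemma bm_cons n (f : n.+1.-tuple T -> R) : bounded_measurable f ->
  forall y : n.-tuple T, bounded_measurable (fun x => f (cns x y)).
Proof.
move=> [mf [M hM]] y; split; last by exists M.
exact: (measurableT_comp (measurable_comp_cons mf) (pair2_measurable y)).
Qed.

Lemma bm_int_cons n (f : n.+1.-tuple T -> R) : bounded_measurable f ->
  bounded_measurable (fun y : n.-tuple T => \int[P]_x f (cns x y)) /\
  \int[power_prob P n.+1]_x f x = \int[power_prob P n]_y \int[P]_x f (cns x y).
Proof.
move=> bf; have [mf [M hM]] := bf.
have bfc : bounded_measurable (f \o @tuple_consf _ T n).
  by split; [exact: (measurable_comp_cons mf)|exists M => z; exact: hM].
have ic := bm_integrable (P \x power_prob P n)%E bfc.
have bG : bounded_measurable (fun y : n.-tuple T => \int[P]_x f (cns x y)).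
  split.
    have := measurable_fubini_G ic; rewrite /fubini_G => h.
    by apply: measurableT_comp h.
  exists M => y; have by_ := bm_cons bf y.
  apply: (le_trans (bm_int_norm P by_)).
  rewrite -[leRHS](prob_int_cst P); apply: bm_int_le => //; [exact: bm_norm|exact: bmC].
split => //; apply: EFin_inj.
rewrite EFin_bm_int// EFin_bm_int//=.
rewrite integral_distribution//; last exact/measurable_EFinP.
rewrite -integral21_prod_meas1//; apply: eq_integral => y _.
by rewrite EFin_bm_int//; exact: bm_cons.
Qed.

End power_probability.

(** * The Hardy-Littlewood inequality *)

Section hardy_littlewood.
Variable R : realType.

Lemma powR2_gt1 (q : R) : 0 < q -> 1 < 2 `^ q.
Proof.
move=> q0; have := @gt0_ltr_powR R q q0 1 2.
by rewrite !nnegrE powR1 => /(_ _ _ _); apply; lra.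
Qed.

Lemma powR_addr (x r s : R) : 0 < x -> x `^ (r + s) = x `^ r * x `^ s.
Proof. by move=> x0; rewrite powRD// (gt_eqF x0) implybT. Qed.

Lemma powRX (x q : R) i : 0 <= x -> (x ^+ i) `^ q = (x `^ q) ^+ i.
Proof.
move=> x0; rewrite -(powR_mulrn i (powR_ge0 x q)) -powRrM mulrC powRrM.
by rewrite powR_mulrn.
Qed.

Lemma geometric_layers_lt (q rho z : R) n : 0 < q -> 0 < rho -> 0 <= z ->
  \sum_(i < n) (rho * 2 ^+ i) `^ q * (rho * 2 ^+ i < z)%R%:R
    <= 2 `^ q / (2 `^ q - 1) * z `^ q.
Proof.
move=> q0 rho0 z0; set b := 2 `^ q.
have b1 : 1 < b by exact: powR2_gt1.
have b0 : 0 < b by lra.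
have lE i : (rho * 2 ^+ i) `^ q = rho `^ q * b ^+ i.
  by rewrite powRM ?exprn_ge0 ?(ltW rho0)// powRX.
have hU m : \sum_(i < m) rho `^ q * b ^+ i <= rho `^ q * b ^+ m / (b - 1).
  elim: m => [|m IH]; first by rewrite big_ord0 divr_ge0 ?mulr_ge0 ?powR_ge0//; lra.
  rewrite big_ord_recr/=; apply: (le_trans (lerD IH (lexx _))).
  rewrite le_eqVlt; apply/orP; left; apply/eqP; rewrite exprS.
  by field; lra.
elim: n => [|n IH].
  by rewrite big_ord0 mulr_ge0 ?powR_ge0// divr_ge0//; lra.
rewrite big_ord_recr/=; have [h|h] := ltP; last by rewrite mulr0 addr0.
rewrite mulr1; apply: (@le_trans _ _ (\sum_(i < n.+1) rho `^ q * b ^+ i)).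
  rewrite big_ord_recr/= lE lerD2r; apply: ler_sum => i _; rewrite -lE.
  by rewrite ler_piMr ?powR_ge0// lern1 leq_b1.
apply: (le_trans (hU _)).
rewrite exprS (_ : _ / _ = b / (b - 1) * (rho `^ q * b ^+ n)); last first.
  by field; lra.
rewrite -lE ler_wpM2l ?divr_ge0//; try lra.
by rewrite ge0_ler_powR ?nnegrE ?mulr_ge0 ?exprn_ge0 ?(ltW rho0) ?(ltW q0) ?(ltW h).
Qed.

(** The terms decrease, so the first level above z dominates. The induction doubles [rho] as long as
    it is below z, since those levels contribute nothing. *)
Lemma geometric_layers_ge (q rho z : R) n : 0 < q -> 0 < rho -> 0 < z ->
  \sum_(i < n) (rho * 2 ^+ i) `^ (- q) * (z <= rho * 2 ^+ i)%R%:R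
    <= 2 `^ q / (2 `^ q - 1) * z `^ (- q).
Proof.
move=> q0 rho0 z0; set b := 2 `^ q.
have b1 : 1 < b by exact: powR2_gt1.
have b0 : 0 < b by lra.
have lE r i : 0 < r -> (r * 2 ^+ i) `^ (- q) = r `^ (- q) * b ^- i.
  move=> r0; rewrite powRM ?exprn_ge0 ?(ltW r0)//; congr (_ * _).
  by rewrite powRN powRX.
have hU m r : 0 < r -> \sum_(i < m) r `^ (- q) * b ^- i <= b / (b - 1) * r `^ (- q).
  move=> r0; rewrite -mulr_sumr mulrC ler_wpM2r ?powR_ge0//.
  suff : \sum_(i < m) b ^- i = b / (b - 1) - b ^- m * (b / (b - 1)).
    by move=> ->; rewrite lerBlDr lerDl mulr_ge0 ?invr_ge0 ?exprn_ge0 ?divr_ge0//; lra.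
  elim: m => [|m IH]; first by rewrite big_ord0 expr0 invr1 mul1r subrr.
  rewrite big_ord_recr/= IH exprS invfM; field.
  by rewrite ?subr_eq0 ?expf_neq0 ?gt_eqF.
elim: n rho rho0 => [|n IH] rho rho0.
  by rewrite big_ord0 mulr_ge0 ?powR_ge0// divr_ge0//; lra.
have [h|h] := leP z rho.
  apply: (@le_trans _ _ (b / (b - 1) * rho `^ (- q))).
    apply: le_trans (hU n.+1 _ rho0); apply: ler_sum => i _.
    by rewrite -lE// ler_piMr ?powR_ge0// lern1 leq_b1.
  rewrite ler_wpM2l ?divr_ge0//; try lra.
  rewrite !powRN lef_pV2 ?posrE ?powR_gt0//.
  by rewrite ge0_ler_powR ?nnegrE// ltW.
rewrite big_ord_recl expr0 mulr1 [z <= rho]leNgt h mulr0 add0r.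
have := IH (rho * 2) ltac:(by rewrite mulr_gt0); congr (_ <= _).
by apply: eq_bigr => i _; rewrite /= /bump/= add1n exprS mulrA.
Qed.

Lemma powR_le_layers (p rho a : R) n : 0 <= p -> 0 < rho -> rho < a ->
  a <= rho * 2 ^+ n ->
  a `^ p <= \sum_(i < n) (2 * (rho * 2 ^+ i)) `^ p * (rho * 2 ^+ i < a)%R%:R.
Proof.
move=> p0 rho0 ra; elim: n => [|n IH] h.
  by move: h; rewrite expr0 mulr1 leNgt ra.
rewrite big_ord_recr/=; have [h'|h'] := ltP.
  rewrite mulr1 -[leLHS]add0r lerD//.
    by apply: sumr_ge0 => i _; rewrite mulr_ge0 ?powR_ge0.
  rewrite ge0_ler_powR ?nnegrE ?mulr_ge0 ?exprn_ge0//; try lra.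
  by rewrite mulrCA -exprS.
by rewrite mulr0 addr0; exact: IH.
Qed.

(** Finitely many dyadic levels see every nonzero value of a finite family; this replaces the
    integral over all levels in the layer-cake formula. *)
Lemma exists_layer_range (K : finType) (a : K -> R) : (forall k, 0 <= a k) ->
  exists rho : R, exists n : nat, 0 < rho /\
   forall k, a k = 0 \/ (rho < a k /\ a k <= rho * 2 ^+ n).
Proof.
(* As the inverse of 0 is 0, vanishing entries do not enter, and s^(-1) is below every nonzero
   entry. *)
move=> a0; pose s := 1 + \sum_k (a k)^-1.
have s0 : 0 < s by rewrite ltr_pwDl// sumr_ge0// => k _; rewrite invr_ge0.
exists s^-1, (Num.truncn (s * \sum_k a k)).+1; split; first by rewrite invr_gt0.
move=> k; have [->|ak] := eqVneq (a k) 0; [by left|right].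
have ak0 : 0 < a k by rewrite lt0r ak a0.
split.
  rewrite -[ltRHS]invrK ltf_pV2 ?posrE ?invr_gt0// /s (bigD1 k)//=.
  by rewrite addrCA ltrDl ltr_pwDl// sumr_ge0// => l _; rewrite invr_ge0.
rewrite ler_pdivlMl//; apply: (@le_trans _ _ (s * \sum_k a k)).
  by rewrite ler_wpM2l ?(ltW s0)// (bigD1 k)//= lerDl sumr_ge0.
apply: (le_trans (ltW (truncnS_gt _))).
by rewrite -natrX ler_nat ltnW// ltn_expl.
Qed.

(* Marcinkiewicz interpolation between weak (1,1) and (2,2), with the measure
   that gives [k] the mass [w k ^- 2]: at each dyadic level the function is cut
   at that same height. *)
Lemma hardy_littlewood_finite {dd : measure_display} {T : measurableType dd}
    (P : probability T R) (K : finType) (e : K -> T -> R) (w : K -> R)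
    (u : T -> R) (p Cw : R) :
  1 < p < 2 -> (forall k, bounded_measurable (e k)) ->
  (forall k x, `|e k x| <= 2) ->
  (forall k l, \int[P]_x (e k x * e l x) = (k == l)%:R) ->
  (forall k, 0 < w k) -> 0 <= Cw ->
  (forall t, 0 < t -> \sum_(k | t < w k) (w k) ^- 2 <= Cw / t) ->
  bounded_measurable u ->
  \sum_k w k `^ (p - 2) * `|\int[P]_x (u x * e k x)| `^ p <=
  2 `^ p * (4 * Cw * (2 `^ (p - 1) / (2 `^ (p - 1) - 1)) +
            4 * (2 `^ (2 - p) / (2 `^ (2 - p) - 1))) * \int[P]_x (`|u x| `^ p).
Proof.
move=> /andP[p1 p2] be e2 oe w0 Cw0 hw bu.
pose c k := \int[P]_x (u x * e k x).
pose a k := w k * `|c k|.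
have a0 k : 0 <= a k by rewrite mulr_ge0 ?(ltW (w0 k)).
have [rho [n [rho0 hrho]]] := exists_layer_range a0.
pose l (i : nat) : R := rho * 2 ^+ i.
have l0 i : 0 < l i by rewrite mulr_gt0 ?exprn_gt0.
pose u1 (i : nat) x := if l i < `|u x| then u x else 0.
pose u2 (i : nat) x := if l i < `|u x| then 0 else u x.
have mb i : measurable_fun setT (fun x => l i < `|u x|).
  have := (bm_norm bu).1; move=> m; exact: measurable_fun_ltr.
have bu1 i : bounded_measurable (u1 i) by apply: bm_if => //; exact: bmC.
have bu2 i : bounded_measurable (u2 i) by apply: bm_if => //; exact: bmC.
(* If w |c| exceeds the level l, one of the two parts reaches l / 2. For the large part |c1| <= 2 A,
   so w > l / (4 A), a set whose mass is bounded by [hw]. The small part is counted by Chebyshev and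
   Bessel. *)
have level i : \sum_k (w k) ^- 2 * (l i < a k)%R%:R <=
    4 * Cw / l i * \int[P]_x `|u1 i x| + 4 / l i ^+ 2 * \int[P]_x (u2 i x ^+ 2).
  pose c1 k := \int[P]_x (u1 i x * e k x).
  pose c2 k := \int[P]_x (u2 i x * e k x).
  have cE k : c k = c1 k + c2 k.
    rewrite /c /c1 /c2 -bm_intD; try exact: bmM.
    apply: eq_Rintegral => x _; rewrite -mulrDl /u1 /u2.
    by case: ifP; rewrite ?addr0 ?add0r.
  set A := \int[P]_x `|u1 i x|.
  have A0 : 0 <= A by apply: Rintegral_ge0.
  have c1A k : `|c1 k| <= 2 * A.
    apply: (le_trans (bm_int_norm _ _)); first exact: bmM.
    rewrite /A -bm_intZ; last exact: bm_norm.
    apply: bm_int_le => [|| x]; first by apply: bm_norm; exact: bmM.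
      by apply: bmZ; exact: bm_norm.
    by rewrite normrM mulrC ler_wpM2r.
  have hk k : (w k) ^- 2 * (l i < a k)%R%:R <=
      (w k) ^- 2 * (l i < 4 * A * w k)%R%:R + 4 / l i ^+ 2 * c2 k ^+ 2.
    have wk : 0 < (w k) ^- 2 by rewrite invr_gt0 exprn_gt0.
    have t2 : 0 <= 4 / l i ^+ 2 * c2 k ^+ 2.
      by rewrite mulr_ge0 ?sqr_ge0 ?divr_ge0 ?sqr_ge0.
    have [h|h] := ltP (l i) (a k); last first.
      by rewrite mulr0 addr_ge0// mulr_ge0 ?(ltW wk).
    have [h1|h1] := ltP (l i) (4 * A * w k); first by rewrite lerDl.
    rewrite mulr1 mulr0 add0r.
    have h2 : l i <= 2 * (w k * `|c2 k|).
      have : a k <= w k * `|c1 k| + w k * `|c2 k|.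
        by rewrite -mulrDr /a cE ler_wpM2l ?ler_normD ?(ltW (w0 k)).
      have : w k * `|c1 k| <= w k * (2 * A) by rewrite ler_wpM2l ?c1A ?(ltW (w0 k)).
      lra.
    have h3 : l i ^+ 2 <= (2 * (w k * `|c2 k|)) ^+ 2.
      have h4 : 0 <= w k * `|c2 k| by rewrite mulr_ge0 ?(ltW (w0 k)).
      by rewrite lerXn2r// ?nnegrE ?(ltW (l0 i))// mulr_ge0.
    rewrite mulrAC ler_pdivlMr ?exprn_gt0// mulrC ler_pdivrMr ?exprn_gt0//.
    apply: (le_trans h3); rewrite !exprMn real_normK ?num_real//.
    by rewrite le_eqVlt; apply/orP; left; apply/eqP; ring.
  apply: (le_trans (ler_sum _ (fun k _ => hk k))).
  rewrite big_split/=; apply: lerD; last first.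
    rewrite -mulr_sumr ler_wpM2l ?divr_ge0 ?sqr_ge0//.
    exact: bessel.
  have [A00|Ap] := eqVneq A 0.
    rewrite A00 mulr0 big1 => [|k _]; first by rewrite mulr0.
    by rewrite (_ : (l i < _) = false) ?mulr0//; apply/negbTE; rewrite -leNgt mul0r ltW.
  have {}Ap : 0 < 4 * A by rewrite mulr_gt0// lt0r Ap.
  have := hw (l i / (4 * A)) (divr_gt0 (l0 i) Ap).
  rewrite (_ : Cw / (l i / (4 * A)) = 4 * Cw / l i * A); last first.
    by field; rewrite !gt_eqF//; lra.
  apply: le_trans; rewrite [leRHS]big_mkcond; apply: ler_sum => k _.
  rewrite ltr_pdivrMr// [w k * _]mulrC.
  by case: ifP => _; rewrite ?mulr1 ?mulr0.
have step1 : \sum_k w k `^ (p - 2) * `|c k| `^ p <=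
    \sum_k \sum_(i < n) (2 * l i) `^ p * ((w k) ^- 2 * (l i < a k)%R%:R).
  apply: ler_sum => k _.
  have -> : w k `^ (p - 2) * `|c k| `^ p = (w k) ^- 2 * a k `^ p.
    rewrite /a powRM ?(ltW (w0 k))// mulrA; congr (_ * _).
    rewrite powRB; last by rewrite (gt_eqF (w0 k)) implybT.
    by rewrite powR_mulrn ?(ltW (w0 k))// mulrC.
  under eq_bigr do rewrite mulrCA.
  rewrite -mulr_sumr ler_wpM2l ?invr_ge0 ?exprn_ge0 ?(ltW (w0 k))//.
  have [->|[h1 h2]] := hrho k; last by apply: powR_le_layers => //; lra.
  rewrite powR0 ?gt_eqF//; last by lra.
  by apply: sumr_ge0 => i _; rewrite mulr_ge0 ?powR_ge0.
apply: (le_trans step1); rewrite exchange_big/=.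
have step2 : \sum_(i < n) \sum_k (2 * l i) `^ p * ((w k) ^- 2 * (l i < a k)%R%:R) <=
   \int[P]_x (\sum_(i < n) (2 * l i) `^ p * (4 * Cw / l i * `|u1 i x| +
         4 / l i ^+ 2 * u2 i x ^+ 2)).
  have b1 i : bounded_measurable (fun x => 4 * Cw / l i * `|u1 i x|).
    by apply: bmZ; exact: bm_norm.
  have b2 i : bounded_measurable (fun x => 4 / l i ^+ 2 * u2 i x ^+ 2).
    by apply: bmZ; exact: bmX.
  rewrite bm_int_sum; last by move=> i; apply: bmZ; exact: bmD.
  apply: ler_sum => i _; rewrite -mulr_sumr bm_intZ; last exact: bmD.
  rewrite ler_wpM2l ?powR_ge0// bm_intD//.
  rewrite bm_intZ; last exact: bm_norm.
  by rewrite bm_intZ//; exact: bmX.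
apply: (le_trans step2); rewrite -bm_intZ; last by apply: bm_powR => //; lra.
apply: bm_int_le => [|| x].
- apply: bm_sum => i; apply: bmZ; apply: bmD; apply: bmZ; first exact: bm_norm.
  exact: bmX.
- by apply: bmZ; apply: bm_powR => //; lra.
set G1 := 2 `^ (p - 1) / _; set G2 := 2 `^ (2 - p) / _.
set z := `|u x|.
have z0 : 0 <= z by exact: normr_ge0.
(* At a given point the large part is present at the levels below z and the small part at the levels
   from z on. The level powers p - 1 > 0 and -(2 - p) < 0 make both geometric sums concentrate near
   z; this is where 1 < p < 2 enters. *)
have tE i : (2 * l i) `^ p * (4 * Cw / l i * `|u1 i x| + 4 / l i ^+ 2 * u2 i x ^+ 2) =
   2 `^ p * (4 * Cw * z * (l i `^ (p - 1) * (l i < z)%R%:R) +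
             4 * z ^+ 2 * (l i `^ (- (2 - p)) * (z <= l i)%R%:R)).
  have pE : l i `^ p = l i `^ (p - 1) * l i.
    by rewrite mulrC mulr_powRB1 ?(ltW (l0 i))//; lra.
  have pE2 : l i `^ p = l i `^ (- (2 - p)) * l i ^+ 2.
    rewrite -powR_mulrn ?(ltW (l0 i))// -powR_addr//.
    by congr (_ `^ _); ring.
  rewrite powRM ?(ltW (l0 i))// -mulrA; congr (_ * _).
  rewrite /u1 /u2 -/z; have [h|h] := ltP (l i) z.
    by rewrite /= -/z pE; field; rewrite gt_eqF.
  rewrite /= normr0 -[u x ^+ 2]real_normK ?num_real// -/z pE2.
  by field; rewrite gt_eqF.
under eq_bigr do rewrite tE.
rewrite -mulr_sumr -[leRHS]mulrA ler_wpM2l ?powR_ge0// big_split/= -!mulr_sumr [leRHS]mulrDl.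
have [z00|zp] := eqVneq z 0.
  by rewrite z00 powR0 ?gt_eqF ?expr2 ?(mulr0, mul0r, addr0)//; lra.
have {}zp : 0 < z by rewrite lt0r zp.
have zE1 : z `^ p = z * z `^ (p - 1).
  by rewrite mulr_powRB1 ?(ltW zp)//; lra.
have zE2 : z `^ p = z ^+ 2 * z `^ (- (2 - p)).
  rewrite -powR_mulrn ?(ltW zp)// -powR_addr//.
  by congr (_ `^ _); ring.
apply: lerD.
  rewrite zE1 (_ : 4 * Cw * G1 * _ = 4 * Cw * z * (G1 * z `^ (p - 1))); last by ring.
  by rewrite ler_wpM2l ?mulr_ge0// geometric_layers_lt//; lra.
rewrite zE2 (_ : 4 * G2 * _ = 4 * z ^+ 2 * (G2 * z `^ (- (2 - p)))); last by ring.
by rewrite ler_wpM2l ?mulr_ge0 ?sqr_ge0// geometric_layers_ge//; lra.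
Qed.

End hardy_littlewood.

Lemma integrable_of_Lp {dd : measure_display} {T : measurableType dd} {R : realType}
    (P : probability T R) (p A : R) (u : T -> R) : 1 <= p ->
  measurable_fun setT u -> (\int[P]_x (`|u x| `^ p)%:E <= A%:E)%E ->
  P.-integrable setT (EFin \o u).
Proof.
move=> p1 mu hA.
have mup : measurable_fun setT (fun x => `|u x| `^ p).
  by apply: (measurableT_comp (measurable_powR p)); exact: measurableT_comp.
have ip : P.-integrable setT (EFin \o (fun x => `|u x| `^ p)).
  apply/integrableP; split; first exact/measurable_EFinP.
  apply: (@le_lt_trans _ _ A%:E); last exact: ltry.
  apply: le_trans hA; rewrite le_eqVlt; apply/orP; left; apply/eqP.
  by apply: eq_integral => x _; rewrite gee0_abs ?lee_fin ?powR_ge0.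
have i1 := integrableD measurableT (bm_integrable P (bmC 1)) ip.
apply: (le_integrable measurableT _ _ i1); first exact/measurable_EFinP.
move=> x _ /=; rewrite lee_fin [leRHS]ger0_norm ?addr_ge0 ?powR_ge0//.
have [h|h] := leP `|u x| 1; first by rewrite (le_trans h)// lerDl powR_ge0.
by rewrite -[leLHS]add0r lerD// le1r_powR// ltW.
Qed.

(** * Tensor products and the Hardy-Littlewood inequality in several variables *)

Section tensor.
Context {dd : measure_display} {T : measurableType dd} {R : realType}.
Variable P : probability T R.
Local Notation cns x y := [the _.-tuple _ of x :: y].

Lemma sum_tuple_cons (K : finType) n (F : n.+1.-tuple K -> R) :
  \sum_k F k = \sum_a \sum_(k : n.-tuple K) F (cns a k).
Proof.
rewrite pair_bigA/=.
rewrite (reindex (fun z : K * n.-tuple K => cns z.1 z.2))//=.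
exists (fun t : n.+1.-tuple K => (thead t, [tuple of behead t])) => [[a t] _|t _].
  by congr pair; apply/val_inj.
by rewrite [RHS]tuple_eta; apply/val_inj.
Qed.

Lemma int_power_prob0 (f : 0.-tuple T -> R) : bounded_measurable f ->
  \int[power_prob P 0]_x f x = f [tuple].
Proof.
move=> [mf _]; rewrite /Rintegral integral_dirac//=; last exact/measurable_EFinP.
by rewrite indicT mul1r.
Qed.

Lemma int_prod n (g : 'I_n -> T -> R) :
  (forall i, bounded_measurable (g i)) ->
  bounded_measurable (fun x : n.-tuple T => \prod_(i < n) g i (tnth x i)) /\
  \int[power_prob P n]_x \prod_(i < n) g i (tnth x i) =
  \prod_(i < n) \int[P]_x g i x.
Proof.
move=> bg.
have bp m (h : 'I_m -> T -> R) : (forall i, bounded_measurable (h i)) ->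
    bounded_measurable (fun x : m.-tuple T => \prod_(i < m) h i (tnth x i)).
  move=> bh; apply: bm_prod => i; split; last by have [_ [M hM]] := bh i; exists M.
  by apply: (measurableT_comp (bh i).1); exact: measurable_tnth.
split; first exact: bp.
elim: n g bg => [|n IH] g bg.
  by rewrite int_power_prob0 ?big_ord0//; exact: bp.
pose h i := g (lift ord0 i); have bh i : bounded_measurable (h i) by exact: bg.
rewrite (bm_int_cons P (bp _ _ bg)).2 big_ord_recl -(IH h bh).
rewrite -bm_intZ; last exact: bp.
apply: eq_Rintegral => y _; rewrite [RHS]mulrC -bm_intZ//.
apply: eq_Rintegral => x _; rewrite big_ord_recl mulrC; congr (_ * _).
by apply: eq_bigr => i _; rewrite tnthS.
Qed.

Variables (K : finType) (e : K -> T -> R) (w : K -> R).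

Definition tensor_fun n (k : n.-tuple K) (x : n.-tuple T) : R :=
  \prod_(i < n) e (tnth k i) (tnth x i).

Definition tensor_weight n (k : n.-tuple K) : R := \prod_(i < n) w (tnth k i).

Hypothesis be : forall k, bounded_measurable (e k).

Lemma bm_tensor_fun n (k : n.-tuple K) : bounded_measurable (tensor_fun k).
Proof. by have [] := @int_prod n (fun i => e (tnth k i)) (fun i => be _). Qed.

Lemma tensor_fun_cons n a (k : n.-tuple K) (x : T) (y : n.-tuple T) :
  tensor_fun (cns a k) (cns x y) = e a x * tensor_fun k y.
Proof.
rewrite /tensor_fun big_ord_recl; congr (_ * _).
by apply: eq_bigr => i _; rewrite !tnthS.
Qed.

Lemma tensor_weight_cons n a (k : n.-tuple K) :
  tensor_weight (cns a k) = w a * tensor_weight k.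
Proof.
rewrite /tensor_weight big_ord_recl; congr (_ * _).
by apply: eq_bigr => i _; rewrite !tnthS.
Qed.

Lemma tensor_fun_bound n (k : n.-tuple K) x : (forall k x, `|e k x| <= 2) ->
  `|tensor_fun k x| <= 2 ^+ n.
Proof.
move=> e2; rewrite normr_prod -[n in 2 ^+ n]card_ord -prodr_const.
by apply: ler_prod => i _; rewrite normr_ge0 e2.
Qed.

Lemma prod_eq_tuple n (k l : n.-tuple K) :
  \prod_(i < n) (tnth k i == tnth l i)%:R = (k == l)%:R :> R.
Proof.
have [->|kl] := eqVneq k l; first by rewrite big1// => i _; rewrite eqxx.
have [i hi] : exists i, tnth k i != tnth l i.
  apply: contrapT => /forallNP h; move/eqP: kl; apply; apply: eq_from_tnth => i.
  by apply/eqP/negPn/negP.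
by rewrite (bigD1 i)//= (negbTE hi) mul0r.
Qed.

Lemma tensor_orthonormal n (k l : n.-tuple K) :
  (forall k l, \int[P]_x (e k x * e l x) = (k == l)%:R) ->
  \int[power_prob P n]_x (tensor_fun k x * tensor_fun l x) = (k == l)%:R.
Proof.
move=> oe; transitivity (\int[power_prob P n]_x
    (\prod_(i < n) (e (tnth k i) (tnth x i) * e (tnth l i) (tnth x i)))).
  by apply: eq_Rintegral => x _; rewrite -big_split.
have [|_ ->] := @int_prod n (fun i x => e (tnth k i) x * e (tnth l i) x).
  by move=> i; exact: bmM.
by rewrite -prod_eq_tuple; apply: eq_bigr => i _; rewrite oe.
Qed.

(** Both sides are p-th powers, so the coordinates separate by Fubini. The induction hypothesis
    handles the partial coefficients [ua a] as functions of the remaining variables; the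
    one-dimensional inequality in the first variable, with the others frozen, then costs one more
    factor C. *)
Lemma hardy_littlewood_tensor (p C : R) n (u : n.-tuple T -> R) : 0 <= p -> 0 <= C ->
  (forall k, 0 < w k) ->
  (forall v : T -> R, bounded_measurable v ->
    \sum_k w k `^ (p - 2) * `|\int[P]_x (v x * e k x)| `^ p <=
    C * \int[P]_x (`|v x| `^ p)) ->
  bounded_measurable u ->
  \sum_k tensor_weight k `^ (p - 2) *
      `|\int[power_prob P n]_x (u x * tensor_fun k x)| `^ p <=
    C ^+ n * \int[power_prob P n]_x (`|u x| `^ p).
Proof.
move=> p0 C0 w0 h1; elim: n u => [|n IH] u bu.
  rewrite int_power_prob0; last exact: bm_powR.
  rewrite expr0 mul1r (bigD1 [tuple])//= big1 ?addr0; last first.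
    by move=> k /negP[]; rewrite [k]tuple0.
  rewrite /tensor_weight big_ord0 powR1 mul1r int_power_prob0.
    by rewrite /tensor_fun big_ord0 mulr1.
  by apply: bmM => //; exact: bm_tensor_fun.
pose ua a (y : n.-tuple T) := \int[P]_x (u (cns x y) * e a x).
have bv a : bounded_measurable (fun z : n.+1.-tuple T => u z * e a (thead z)).
  apply: bmM => //; split; last by have [_ [M hM]] := be a; exists M.
  apply: (measurableT_comp (be a).1); exact: (@measurable_tnth _ T n.+1 ord0).
have bua a : bounded_measurable (ua a).
  by have [h _] := bm_int_cons P (bv a); exact: h.
have cE a (k : n.-tuple K) :
    \int[power_prob P n.+1]_x (u x * tensor_fun (cns a k) x) =
    \int[power_prob P n]_y (ua a y * tensor_fun k y).
  rewrite (bm_int_cons P _).2; last by apply: bmM => //; exact: bm_tensor_fun.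
  apply: eq_Rintegral => y _; rewrite mulrC -bm_intZ; last first.
    by apply: bmM => //; exact: bm_cons.
  by apply: eq_Rintegral => x _; rewrite tensor_fun_cons; ring.
rewrite sum_tuple_cons.
apply: (@le_trans _ _ (\sum_a w a `^ (p - 2) *
    (C ^+ n * \int[power_prob P n]_y (`|ua a y| `^ p)))).
  apply: ler_sum => a _; apply: le_trans (ler_wpM2l (powR_ge0 _ _) (IH _ (bua a))).
  rewrite mulr_sumr; apply: ler_sum => k _; rewrite cE tensor_weight_cons.
  rewrite powRM ?mulrA// ?(ltW (w0 a))// prodr_ge0// => i _; exact: ltW.
have bp a : bounded_measurable (fun y => `|ua a y| `^ p) by exact: bm_powR.
rewrite (bm_int_cons P _).2; last exact: bm_powR.
apply: (@le_trans _ _ (C ^+ n * \int[power_prob P n]_y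
    (\sum_a w a `^ (p - 2) * `|ua a y| `^ p))).
  rewrite bm_int_sum; last by move=> a; exact: bmZ.
  rewrite mulr_sumr; apply: ler_sum => a _; rewrite bm_intZ//.
  by rewrite mulrCA.
rewrite exprSr -mulrA ler_wpM2l ?exprn_ge0//.
have bi : bounded_measurable (fun y : n.-tuple T => \int[P]_x (`|u (cns x y)| `^ p)).
  by have [h _] := bm_int_cons P (bm_powR p0 bu).
rewrite -bm_intZ//; apply: bm_int_le; [|exact: bmZ|].
  by apply: bm_sum => a; exact: bmZ.
by move=> y; apply: h1; exact: bm_cons.
Qed.

(* The truncations of [u] have at least half of each coefficient once the
   truncation level is high, which costs only the factor [2 `^ p]. *)
Lemma hardy_littlewood_Lp (p C A : R) n (u : n.-tuple T -> R) : 1 <= p -> 0 <= C ->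
  (forall k, 0 < w k) ->
  (forall v : T -> R, bounded_measurable v ->
    \sum_k w k `^ (p - 2) * `|\int[P]_x (v x * e k x)| `^ p <=
    C * \int[P]_x (`|v x| `^ p)) ->
  measurable_fun setT u ->
  (\int[power_prob P n]_x (`|u x| `^ p)%:E <= A%:E)%E ->
  \sum_k tensor_weight k `^ (p - 2) *
      `|\int[power_prob P n]_x (u x * tensor_fun k x)| `^ p <=
    2 `^ p * (C ^+ n * A).
Proof.
move=> p1 C0 w0 h1 mu hA; have p0 : 0 <= p by lra.
pose um (m : nat) x := if `|u x| <= m%:R then u x else 0.
have mm m : measurable_fun setT (fun x => `|u x| <= m%:R).
  by apply: measurable_fun_ler => //; exact: measurableT_comp.
have bum m : bounded_measurable (um m).
  split; first exact: measurable_fun_ifT.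
  by exists m%:R => x; rewrite /um; case: ifP => // _; rewrite normr0.
have mup : measurable_fun setT (fun x => `|u x| `^ p).
  by apply: (measurableT_comp (measurable_powR p)); exact: measurableT_comp.
have iu := integrable_of_Lp p1 mu hA.
have hlim (k : n.-tuple K) : (\int[power_prob P n]_x (um m x * tensor_fun k x)) @[m --> \oo]
     --> \int[power_prob P n]_x (u x * tensor_fun k x).
  have [mk [B hB]] := bm_tensor_fun k.
  have iuk : (power_prob P n).-integrable setT (EFin \o (fun x => u x * tensor_fun k x)).
    have i2 : (power_prob P n).-integrable setT (EFin \o (fun x => B * u x)).
      exact: (integrableZl measurableT B iu).
    apply: (le_integrable measurableT _ _ i2).
      by apply/measurable_EFinP; exact: measurable_funM.
    move=> x _ /=; rewrite lee_fin !normrM mulrC ler_wpM2r//.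
    by rewrite (le_trans (hB x))// ler_norm.
  have := @dominated_convergence _ _ _ (power_prob P n) setT measurableT
    (fun m x => (um m x * tensor_fun k x)%:E) (fun x => (u x * tensor_fun k x)%:E)
    (abse \o (EFin \o (fun x => u x * tensor_fun k x))).
  case.
  - by move=> m; apply/measurable_EFinP; apply: measurable_funM => //; exact: (bum m).1.
  - by apply/measurable_EFinP; exact: measurable_funM.
  - apply: aeW => x _; apply: cvg_near_cst; near=> m.
    rewrite /um ifT//; near: m; exact: nbhs_infty_ger.
  - exact: integrable_abse.
  - apply: aeW => x m _ /=; rewrite lee_fin !normrM ler_wpM2r// /um.
    by case: ifP => // _; rewrite normr0.
  move=> _ _ hc; apply: fine_cvg.
  rewrite fineK//; exact: (integrable_fin_num measurableT iuk).
have [m hm] : exists m, forall k : n.-tuple K,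
   `|\int[power_prob P n]_x (u x * tensor_fun k x)| <=
   2 * `|\int[power_prob P n]_x (um m x * tensor_fun k x)|.
  have hk (k : n.-tuple K) : \forall m \near \oo,
     `|\int[power_prob P n]_x (u x * tensor_fun k x)| <=
     2 * `|\int[power_prob P n]_x (um m x * tensor_fun k x)|.
    set c := \int[power_prob P n]_x (u x * tensor_fun k x).
    have [->|c0] := eqVneq c 0; first by near=> m; rewrite normr0 mulr_ge0.
    have c0' : 0 < `|c| / 2 by rewrite divr_gt0 ?normr_gt0.
    move/cvgrPdist_lt: (hlim k) => /(_ _ c0').
    apply: filterS => m hm; rewrite -/c in hm.
    set cm := \int[power_prob P n]_x (um m x * tensor_fun k x) in hm *.
    have := ler_normD (c - cm) cm; rewrite subrK; lra.
  have hall := filter_forall _ hk.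
  by have [m hm] := filter_ex (hall _); exists m.
apply: (@le_trans _ _ (2 `^ p * \sum_k tensor_weight k `^ (p - 2) *
      `|\int[power_prob P n]_x (um m x * tensor_fun k x)| `^ p)).
  rewrite mulr_sumr; apply: ler_sum => k _; rewrite mulrCA ler_wpM2l ?powR_ge0//.
  by rewrite -powRM// ge0_ler_powR ?nnegrE ?mulr_ge0.
rewrite ler_wpM2l ?powR_ge0//.
apply: (le_trans (hardy_littlewood_tensor p0 C0 w0 h1 (bum m))).
rewrite ler_wpM2l ?exprn_ge0// -lee_fin.
rewrite EFin_bm_int; last exact: bm_powR.
apply: le_trans hA; apply: ge0_le_integral => //.
- by apply/measurable_EFinP; have [] := bm_powR p0 (bum m).
- exact/measurable_EFinP.
- move=> x _; rewrite lee_fin ge0_ler_powR ?nnegrE//.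
  by rewrite /um; case: ifP => // _; rewrite normr0.
Unshelve. all: by end_near.
Qed.

End tensor.

(** * Hyperbolic crosses *)

Section hyperbolic_cross.
Variable R : realType.

Lemma sum_layer_count (t : R) N : 0 <= t ->
  \sum_(i < N) (i.+1%:R <= t)%R%:R <= t.
Proof.
move=> t0; elim: N => [|N IH]; first by rewrite big_ord0.
rewrite big_ord_recr/=; have [h|h] := leP (N.+1%:R) t; last by rewrite addr0.
apply: le_trans h; rewrite -natr1 lerD2r.
rewrite -[N in leRHS]card_ord -sum1_card natr_sum; apply: ler_sum => i _.
by rewrite lern1 leq_b1.
Qed.

Lemma harmonic_le_ln N : \sum_(i < N.+1) (i.+1%:R)^-1 <= 1 + ln (N.+1%:R) :> R.
Proof.
elim: N => [|N IH]; first by rewrite big_ord1 invr1 ln1 addr0.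
rewrite big_ord_recr/= (le_trans (lerD IH (lexx _)))// -addrA lerD2l.
have h0 : 0 < (N.+2%:R : R)^-1 by rewrite invr_gt0 ltr0n.
have h1 : (N.+2%:R : R)^-1 < 1 by rewrite invf_lt1 ?ltr0n// ltr1n.
have h2 : -1 < - (N.+2%:R : R)^-1 by rewrite ltrN2.
have := le_ln1Dx h2.
have -> : 1 - (N.+2%:R : R)^-1 = N.+1%:R / N.+2%:R.
  have n0 : 0 < (N.+2%:R : R) by rewrite ltr0n.
  have nE : N.+1%:R = N.+2%:R - 1 :> R by rewrite -[N.+2%:R]natr1 addrK.
  by rewrite nE; field; rewrite gt_eqF.
rewrite ln_div ?posrE ?ltr0n// => h.
by rewrite -lerBrDl -[leRHS]opprB lerNr.
Qed.

Lemma sum_layer_harmonic (t : R) N : 1 <= t ->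
  \sum_(i < N) (i.+1%:R)^-1 * (i.+1%:R <= t)%R%:R <= 1 + ln t.
Proof.
move=> t1; elim: N => [|N IH]; first by rewrite big_ord0 addr_ge0// ln_ge0.
rewrite big_ord_recr/=; have [h|h] := leP (N.+1%:R) t; last by rewrite mulr0 addr0.
apply: (@le_trans _ _ (1 + ln (N.+1%:R))); last first.
  by rewrite lerD2l ler_ln ?posrE ?ltr0n//; lra.
apply: le_trans (harmonic_le_ln N); rewrite big_ord_recr/= mulr1 lerD2r.
by apply: ler_sum => i _; rewrite ler_piMr ?invr_ge0 ?ler0n// lern1 leq_b1.
Qed.

(** A discrete form of the integral test, with a right-hand side that telescopes. The difference is
    at least (k+1)^(-g) g / (k+1), because ((k+1)/k)^g - 1 >= g ln ((k+1)/k) >= g / (k+1); the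
    factor 2^(g+1) pays for k + 1 <= 2 k. *)
Lemma powR_forward_difference (g k : R) : 0 < g -> 1 <= k ->
  k `^ (- (g + 1)) <= 2 `^ (g + 1) / g * (k `^ (- g) - (k + 1) `^ (- g)).
Proof.
move=> g0 k1; have k0 : 0 < k by lra.
have k10 : 0 < k + 1 by lra.
have h1 : g / (k + 1) <= ((k + 1) / k) `^ g - 1.
  rewrite /powR gt_eqF ?divr_gt0// lerBrDl.
  apply: le_trans (expR_ge1Dx _); rewrite lerD2l ler_wpM2l ?(ltW g0)//.
  have h0 : 0 < (k + 1)^-1 by rewrite invr_gt0.
  have h2 : (k + 1)^-1 < 1 by rewrite invf_lt1//; lra.
  have := @le_ln1Dx R (- (k + 1)^-1) ltac:(lra).
  have -> : 1 - (k + 1)^-1 = k / (k + 1) by field; lra.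
  by rewrite !ln_div ?posrE//; lra.
have h3 : k `^ (- g) - (k + 1) `^ (- g) = (k + 1) `^ (- g) * (((k + 1) / k) `^ g - 1).
  rewrite mulrBr mulr1; congr (_ - _).
  rewrite powRM ?invr_ge0 ?(ltW k0) ?(ltW k10)// mulrA -powR_addr// addNr powRr0 mul1r.
  by rewrite -powR_inv1 ?(ltW k0)// -powRrM mulN1r.
rewrite h3.
apply: (@le_trans _ _ (2 `^ (g + 1) / g * ((k + 1) `^ (- g) * (g / (k + 1))))); last first.
  by rewrite ler_wpM2l ?divr_ge0 ?powR_ge0 ?(ltW g0)// ler_wpM2l ?powR_ge0.
have -> : 2 `^ (g + 1) / g * ((k + 1) `^ (- g) * (g / (k + 1))) =
          2 `^ (g + 1) * (k + 1) `^ (- (g + 1)).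
  rewrite opprD (powR_addr _ _ k10) powR_inv1 ?(ltW k10)//; field; lra.
rewrite !powRN -[leRHS]mulrC ler_pdivlMl ?powR_gt0// ler_pdivrMr ?powR_gt0//.
rewrite -powRM ?(ltW k0)// ge0_ler_powR ?nnegrE//; lra.
Qed.

Lemma sum_layer_tail (g t : R) N : 0 < g -> 0 < t ->
  \sum_(i < N) (i.+1%:R) `^ (- (g + 1)) * (t < i.+1%:R)%R%:R <=
  2 `^ (g + 1) / g * t `^ (- g).
Proof.
move=> g0 t0; set A := 2 `^ (g + 1) / g.
have A0 : 0 <= A by rewrite divr_ge0 ?powR_ge0 ?ltW.
(* The claim is strengthened by the telescoped remainder. The maximum with t keeps the remainder
   constant until the first index above t is reached. *)
suff : \sum_(i < N) (i.+1%:R) `^ (- (g + 1)) * (t < i.+1%:R)%R%:R <=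
    A * t `^ (- g) - A * (Num.max t N.+1%:R) `^ (- g).
  by move/le_trans; apply; rewrite lerBlDr lerDl mulr_ge0 ?powR_ge0.
have mono (x y : R) : 0 < x -> x <= y -> A * y `^ (- g) <= A * x `^ (- g).
  move=> x0 xy; rewrite ler_wpM2l// !powRN lef_pV2 ?posrE ?powR_gt0//; last lra.
  by rewrite ge0_ler_powR ?nnegrE//; lra.
elim: N => [|N IH].
  by rewrite big_ord0 subr_ge0 mono// le_max lexx.
rewrite big_ord_recr/=; have [h|h] := ltP t N.+1%:R.
  move: IH; rewrite (max_r (ltW h)) max_r; last first.
    by rewrite (le_trans (ltW h))// ler_nat.
  rewrite mulr1; have := @powR_forward_difference g N.+1%:R g0.
  by rewrite ler1n natr1 -/A => /(_ isT); rewrite mulrBr; lra.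
rewrite mulr0 addr0; apply: (le_trans IH); rewrite lerD2l lerN2 mono//.
  by rewrite lt_max t0.
by rewrite ge_max le_max lexx/= le_max ler_nat leqnSn orbT.
Qed.

(** The ordinal j stands for the frequency j - N, as in the symmetric partial sums that define
    F_r. *)
Definition freq_weight N (j : 'I_(N + N).+1) : R :=
  Num.max 1 `|(j%:Z - N%:Z)%:~R|.

Lemma freq_weight_ge1 N (j : 'I_(N + N).+1) : 1 <= freq_weight j.
Proof. by rewrite le_max lexx. Qed.

Lemma sum_symmetric_range (F : nat -> R) N :
  \sum_(j < (N + N).+1) F `|j%:Z - N%:Z|%N = F 0 + 2 * \sum_(i < N) F i.+1.
Proof.
rewrite -addnS big_split_ord/= big_ord_recl/= addn0 subrr absz0.
have -> : \sum_(i < N) F `|(N + bump 0 i)%:Z - N%:Z|%N = \sum_(i < N) F i.+1.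
  by apply: eq_bigr => i _; rewrite PoszD addrC addKr.
rewrite (_ : \sum_(i < N) F `|i%:Z - N%:Z|%N = \sum_(i < N) F i.+1); last first.
  rewrite (reindex_inj rev_ord_inj)/=; apply: eq_bigr => i _; congr F.
  by rewrite -subzn ?ltn_ord// addrAC subrr add0r abszN.
ring.
Qed.

Lemma sum_freq_weight (F : R -> R) N :
  \sum_(j < (N + N).+1) F (freq_weight j) = F 1 + 2 * \sum_(i < N) F i.+1%:R.
Proof.
transitivity (\sum_(j < (N + N).+1) F (Num.max 1 (`|j%:Z - N%:Z|%N)%:R)).
  by apply: eq_bigr => j _; rewrite /freq_weight -intr_norm natr_absz.
rewrite (sum_symmetric_range (fun d => F (Num.max 1 d%:R))).
congr (F _ + 2 * _); first by rewrite max_l.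
by apply: eq_bigr => i _; rewrite max_r// ler1n.
Qed.

Lemma freq_weight_count N (t : R) : 1 <= t ->
  \sum_(j < (N + N).+1) (freq_weight j <= t)%R%:R <= 3 * t.
Proof.
move=> t1; rewrite (sum_freq_weight (fun x => (x <= t)%R%:R)) t1.
have := @sum_layer_count t N ltac:(lra).
by move=> h; rewrite /=; lra.
Qed.

Lemma freq_weight_harmonic N (t : R) : 1 <= t ->
  \sum_(j < (N + N).+1) (freq_weight j)^-1 * (freq_weight j <= t)%R%:R <=
  3 * (1 + ln t).
Proof.
move=> t1; rewrite (sum_freq_weight (fun x => x^-1 * (x <= t)%R%:R)) t1 invr1 mulr1.
have := @sum_layer_harmonic t N t1; have := ln_ge0 t1.
by move=> h; rewrite /=; lra.
Qed.

Lemma freq_weight_tail N (g t : R) : 0 < g -> 0 < t ->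
  \sum_(j < (N + N).+1) freq_weight j `^ (- (g + 1)) * (t < freq_weight j)%R%:R <=
  (1 + 2 * (2 `^ (g + 1) / g)) * t `^ (- g).
Proof.
move=> g0 t0.
rewrite (sum_freq_weight (fun x => x `^ (- (g + 1)) * (t < x)%R%:R)) powR1 mul1r.
rewrite [leRHS]mulrDl mul1r -[X in _ <= _ + X]mulrA lerD//; last first.
  by rewrite ler_pM2l// sum_layer_tail.
have [h|h] := ltP; last by rewrite powR_ge0.
rewrite powRN invf_ge1 ?powR_gt0//.
have := @ge0_ler_powR R g (ltW g0) t 1.
by rewrite !nnegrE powR1 => /(_ _ _ _); apply; lra.
Qed.

(** The case g = 1 of the tail bound, with 9 = 1 + 2 * 2^2. It is the mass condition under which the
    Hardy-Littlewood inequality is applied. *)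
Lemma freq_weight_sqr_tail N (t : R) : 0 < t ->
  \sum_(j < (N + N).+1 | t < freq_weight j) (freq_weight j) ^- 2 <= 9 / t.
Proof.
move=> t0; have := @freq_weight_tail N 1 t ltr01 t0.
rewrite powR_inv1 ?(ltW t0)// divr1 (_ : 1 + 1 = 2%:R)//.
rewrite powR_mulrn// (_ : 1 + 2 * _ = 9); last by rewrite expr2; lra.
apply: le_trans; rewrite big_mkcond; apply: ler_sum => j _.
rewrite powR_invn; last by rewrite (le_trans ler01)// freq_weight_ge1.
by case: ifP => _; rewrite ?mulr1 ?mulr0.
Qed.

Section tuples.
Variables (K : finType) (w : K -> R).
Hypothesis w1 : forall k, 1 <= w k.

Let w0 k : 0 < w k. Proof. by rewrite (lt_le_trans ltr01). Qed.

Lemma tensor_weight_ge1 n (k : n.-tuple K) : 1 <= tensor_weight w k.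
Proof.
rewrite /tensor_weight; elim/big_ind: _ => // x y x1 y1.
by rewrite -[leLHS]mulr1 ler_pM.
Qed.

Lemma ln1_mono (x t : R) : 1 <= x -> x <= t -> 0 <= 1 + ln x <= 1 + ln t.
Proof.
move=> x1 xt; rewrite addr_ge0 ?ln_ge0//= lerD2l ler_ln ?posrE//; lra.
Qed.

Hypothesis harmonic : forall t, 1 <= t ->
  \sum_k (w k)^-1 * (w k <= t)%R%:R <= 3 * (1 + ln t).

(** The slice at a first frequency a is a cross of level t / w_a in one variable less. Its size is
    proportional to 1 / w_a, and the harmonic sum over w_a <= t produces one more logarithm. *)
Lemma hyperbolic_cross_count n (t : R) :
  (forall t, 1 <= t -> \sum_k (w k <= t)%R%:R <= 3 * t) -> 1 <= t ->
  \sum_(k : n.+1.-tuple K) (tensor_weight w k <= t)%R%:R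
   <= 3 ^+ n.+1 * t * (1 + ln t) ^+ n.
Proof.
move=> cnt; elim: n t => [|n IH] t t1; rewrite sum_tuple_cons.
  rewrite expr0 mulr1 expr1; apply: le_trans (cnt _ t1); apply: ler_sum => a _.
  rewrite (bigD1 [tuple])//= big1 ?addr0; last by move=> k /negP[]; rewrite [k]tuple0.
  by rewrite tensor_weight_cons /tensor_weight big_ord0 mulr1.
apply: (@le_trans _ _ (\sum_a (3 ^+ n.+1 * t * (1 + ln t) ^+ n) *
    ((w a)^-1 * (w a <= t)%R%:R))).
  apply: ler_sum => a _; have [h|h] := leP (w a) t; last first.
    rewrite !mulr0 big1// => k _; rewrite tensor_weight_cons.
    rewrite leNgt (lt_le_trans h)// ler_peMr ?tensor_weight_ge1//; exact: ltW.
  have ta : 1 <= t / w a by rewrite ler_pdivlMr// mul1r.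
  apply: (@le_trans _ _ (\sum_(k : n.+1.-tuple K) (tensor_weight w k <= t / w a)%R%:R)).
    by apply: ler_sum => k _; rewrite tensor_weight_cons ler_pdivlMr// mulrC.
  apply: (le_trans (IH _ ta)); rewrite mulr1.
  rewrite [leRHS](_ : _ = 3 ^+ n.+1 * (t / w a) * (1 + ln t) ^+ n); last by ring.
  have tat : t / w a <= t by rewrite ler_pdivrMr// ler_peMr//; lra.
  have /andP[l0 l1] := ln1_mono ta tat.
  apply: ler_wpM2l; first by rewrite mulr_ge0 ?exprn_ge0//; lra.
  by apply: lerXn2r; rewrite ?nnegrE//; lra.
rewrite -mulr_sumr; have h := harmonic t1.
have l0 := ln_ge0 t1.
apply: (le_trans (ler_wpM2l _ h)).
  by rewrite !mulr_ge0 ?exprn_ge0//; lra.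
rewrite [3 ^+ n.+2]exprS [(1 + ln t) ^+ n.+1]exprS le_eqVlt; apply/orP; left; apply/eqP.
ring.
Qed.

Lemma hyperbolic_cross_total (b S : R) n : 0 <= S ->
  \sum_k w k `^ (- b) <= S ->
  \sum_(k : n.-tuple K) tensor_weight w k `^ (- b) <= S ^+ n.
Proof.
move=> S0 hS; elim: n => [|n IH].
  rewrite (bigD1 [tuple])//= big1 ?addr0; last by move=> k /negP[]; rewrite [k]tuple0.
  by rewrite /tensor_weight big_ord0 powR1 expr0.
rewrite sum_tuple_cons exprS; apply: (@le_trans _ _ (\sum_a w a `^ (- b) * S ^+ n)).
  apply: ler_sum => a _; apply: le_trans (ler_wpM2l (powR_ge0 _ _) IH).
  rewrite mulr_sumr; apply: ler_sum => k _; rewrite tensor_weight_cons powRM//.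
    exact: ltW.
  by rewrite (le_trans ler01)// tensor_weight_ge1.
by rewrite -mulr_suml ler_wpM2r ?exprn_ge0.
Qed.

Fixpoint tail_const (C S : R) (n : nat) : R :=
  if n is m.+1 then 3 * tail_const C S m + C * S ^+ n else C.

(** Split by the first frequency a. If w_a <= t, the remaining weight exceeds t / w_a, and
    w_a^(-(g+1)) (t / w_a)^(-g) = t^(-g) / w_a leaves a harmonic sum. If w_a > t, the remaining
    coordinates are summed freely, which gives S^(n+1) times the one-dimensional tail. The recursion
    of [tail_const] records these two contributions. *)
Lemma hyperbolic_cross_tail (g C S : R) n (t : R) : 0 < g -> 0 <= C -> 0 <= S ->
  (forall t, 0 < t -> \sum_k w k `^ (- (g + 1)) * (t < w k)%R%:R <= C * t `^ (- g)) ->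
  \sum_k w k `^ (- (g + 1)) <= S -> 1 <= t ->
  \sum_(k : n.+1.-tuple K)
     tensor_weight w k `^ (- (g + 1)) * (t < tensor_weight w k)%R%:R
   <= tail_const C S n * (t `^ (- g) * (1 + ln t) ^+ n).
Proof.
move=> g0 C0 S0 hC hS; elim: n t => [|n IH] t t1; rewrite sum_tuple_cons.
  rewrite expr0 mulr1; apply: le_trans (hC _ (lt_le_trans ltr01 t1)); apply: ler_sum => a _.
  rewrite (bigD1 [tuple])//= big1 ?addr0; last by move=> k /negP[]; rewrite [k]tuple0.
  by rewrite tensor_weight_cons /tensor_weight big_ord0 mulr1.
have t0 : 0 < t by lra.
have l0 := ln_ge0 t1.
have T0 m : 0 <= tail_const C S m.
  by elim: m => //= m hm; rewrite addr_ge0 ?mulr_ge0 ?exprn_ge0.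
have W0 m (k : m.-tuple K) : 0 < tensor_weight w k.
  by rewrite (lt_le_trans ltr01)// tensor_weight_ge1.
apply: (@le_trans _ _ (\sum_a
   ((tail_const C S n * (t `^ (- g) * (1 + ln t) ^+ n)) * ((w a)^-1 * (w a <= t)%R%:R) +
    S ^+ n.+1 * (w a `^ (- (g + 1)) * (t < w a)%R%:R)))).
  apply: ler_sum => a _.
  under eq_bigr do rewrite tensor_weight_cons (powRM _ (ltW (w0 a)) (ltW (W0 _ _))) -mulrA.
  rewrite -mulr_sumr; have [h|h] := leP (w a) t.
    rewrite mulr0 mulr0 addr0 mulr1.
    have ta : 1 <= t / w a by rewrite ler_pdivlMr// mul1r.
    have ta0 : 0 < t / w a by lra.
    apply: (@le_trans _ _ (w a `^ (- (g + 1)) *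
        (tail_const C S n * ((t / w a) `^ (- g) * (1 + ln (t / w a)) ^+ n)))).
      rewrite ler_wpM2l ?powR_ge0//; apply: le_trans (IH _ ta).
      by apply: ler_sum => k _; rewrite ltr_pdivrMr// [_ * w a]mulrC.
    have wE : w a `^ (- (g + 1)) * (t / w a) `^ (- g) = t `^ (- g) / w a.
      rewrite opprD powR_addr// powR_inv1 ?(ltW (w0 a))// mulrAC.
      by rewrite -powRM ?(ltW (w0 a)) ?(ltW ta0)// mulrCA divff ?gt_eqF// mulr1.
    rewrite (_ : _ * (_ * _) = tail_const C S n *
       ((w a `^ (- (g + 1)) * (t / w a) `^ (- g)) * (1 + ln (t / w a)) ^+ n)); last by ring.
    rewrite wE -!mulrA ler_wpM2l// ler_wpM2l ?powR_ge0// mulrC ler_wpM2r ?invr_ge0 ?(ltW (w0 a))//.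
    have tat : t / w a <= t by rewrite ler_pdivrMr// ler_peMr//; lra.
    have /andP[l2 l1] := ln1_mono ta tat.
    by apply: lerXn2r; rewrite ?nnegrE//; lra.
  rewrite mulr0 mulr0 add0r mulr1 mulrC ler_wpM2r ?powR_ge0//.
  apply: le_trans (hyperbolic_cross_total n.+1 S0 hS); apply: ler_sum => k _.
  by rewrite ler_piMr ?powR_ge0// lern1 leq_b1.
rewrite big_split/= -!mulr_sumr.
have h1 := harmonic t1.
have h2 := hC _ t0.
have m1 : 0 <= tail_const C S n * (t `^ (- g) * (1 + ln t) ^+ n).
  by rewrite !mulr_ge0 ?powR_ge0 ?exprn_ge0//; lra.
have m2 : 0 <= S ^+ n.+1 by rewrite exprn_ge0.
apply: (le_trans (lerD (ler_wpM2l m1 h1) (ler_wpM2l m2 h2))).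
have m3 : 1 <= (1 + ln t) ^+ n.+1 by rewrite exprn_ege1//; lra.
have m4 : 0 <= S ^+ n.+1 * (C * t `^ (- g)) by rewrite !mulr_ge0 ?powR_ge0.
rewrite [leRHS]mulrDl lerD//.
  by rewrite [(1 + ln t) ^+ n.+1]exprS le_eqVlt; apply/orP; left; apply/eqP; ring.
apply: (@le_trans _ _ (S ^+ n.+1 * (C * t `^ (- g)) * (1 + ln t) ^+ n.+1)).
  by rewrite ler_peMr.
by rewrite le_eqVlt; apply/orP; left; apply/eqP; ring.
Qed.

End tuples.

End hyperbolic_cross.

(** * The cas system and the kernel F_r *)

Section cas_system.
Variable R : realType.

Local Notation unif := (uniform_prob (@ltr01 R) : probability (measurableTypeR R) R).

Lemma cos_addint (x : R) (m : int) : cos (x + 2 * pi * m%:~R) = cos x.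
Proof.
have h (y : R) (n : nat) : cos (y + 2 * pi * n%:R) = cos y.
  rewrite -(periodicn (@cosD2pi R) n y); congr (cos (_ + _)).
  by rewrite -[RHS]mulr_natr -[pi *+ 2]mulr_natr; ring.
case: m => n; first exact: h.
by rewrite NegzE -[LHS](h _ n.+1); congr cos; rewrite mulrNz mulrN; exact: subrK.
Qed.

Lemma sin_addint (x : R) (m : int) : sin (x + 2 * pi * m%:~R) = sin x.
Proof.
have h (y : R) (n : nat) : sin (y + 2 * pi * n%:R) = sin y.
  rewrite -(periodicn (@sinD2pi R) n y); congr (sin (_ + _)).
  by rewrite -[RHS]mulr_natr -[pi *+ 2]mulr_natr; ring.
case: m => n; first exact: h.
by rewrite NegzE -[LHS](h _ n.+1); congr sin; rewrite mulrNz mulrN; exact: subrK.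
Qed.

Lemma bm_continuous (g : R -> R) : continuous g -> (exists M : R, forall x, `|g x| <= M) ->
  @bounded_measurable _ (measurableTypeR R) R g.
Proof. by move=> cg hg; split => //; exact: continuous_measurable_fun. Qed.

Lemma uniform_int_ftc (g G : R -> R) : continuous g -> (forall x, `|g x| <= 1) ->
  (forall x, is_derive x (1 : R) G (g x)) ->
  \int[unif]_x g x = G 1 - G 0.
Proof.
move=> cg g1 dG.
have bg : @bounded_measurable _ (measurableTypeR R) R g.
  by apply: bm_continuous => //; exists 1.
(* The integrand is shifted by 1 to make it nonnegative, as the integral formula for the uniform law
   requires. *)
have b1 : @bounded_measurable _ (measurableTypeR R) R (fun x => 1 + g x).
  by apply: bmD => //; exact: bmC.
have c1 : continuous (fun x => 1 + g x).
  by move=> x; apply: cvgD; [exact: cvg_cst|exact: cg].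
have dH x : is_derive x (1 : R) (fun y => y + G y) (1 + g x).
  by apply: is_deriveD.
suff h : \int[unif]_x (1 + g x) = (1 + G 1) - (0 + G 0).
  have : \int[unif]_x (1 + g x) = 1 + \int[unif]_x g x.
    by rewrite bm_intD ?prob_int_cst//; exact: bmC.
  by move=> hD; apply: (addrI 1); rewrite -hD h; ring.
apply: EFin_inj; rewrite EFin_bm_int//.
rewrite (@integral_uniform R 0 1 ltr01 (fun x => (1 + g x)%:E)); last 2 first.
- by apply/measurable_EFinP; exact: b1.1.
- by move=> x; rewrite lee_fin; have := g1 x; rewrite ler_norml; lra.
rewrite subr0 invr1 mul1e (@continuous_FTC2 R (fun x => 1 + g x) (fun y => y + G y) 0 1)//.
- by apply: continuous_subspaceT.
- have cH : continuous (fun y => y + G y).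
    move=> x; apply: differentiable_continuous; apply/derivable1_diffP.
    by have [] := dH x.
  split.
  + by move=> x _; have [] := dH x.
  + by apply: cvg_at_right_filter; exact: cH.
  + by apply: cvg_at_left_filter; exact: cH.
- by move=> x _; rewrite derive1E; have [] := dH x.
Qed.

Lemma continuous_cos_lin (c : R) : continuous (fun x => cos (c * x)).
Proof.
move=> x; apply: (@continuous_comp _ _ _ (fun x => c * x) cos).
  by apply: cvgM; [exact: cvg_cst|exact: cvg_id].
exact: continuous_cos.
Qed.

Lemma continuous_sin_lin (c : R) : continuous (fun x => sin (c * x)).
Proof.
move=> x; apply: (@continuous_comp _ _ _ (fun x => c * x) sin).
  by apply: cvgM; [exact: cvg_cst|exact: cvg_id].
exact: continuous_sin.
Qed.

Lemma bm_cos_lin (c : R) : @bounded_measurable _ (measurableTypeR R) R (fun x => cos (c * x)).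
Proof.
apply: bm_continuous; first exact: continuous_cos_lin.
by exists 1 => x; exact: cos_max.
Qed.

Lemma bm_sin_lin (c : R) : @bounded_measurable _ (measurableTypeR R) R (fun x => sin (c * x)).
Proof.
apply: bm_continuous; first exact: continuous_sin_lin.
by exists 1 => x; exact: sin_max.
Qed.

Lemma uniform_int_cos (m : int) :
  \int[unif]_x cos (2 * pi * m%:~R * x) = (m == 0)%:R.
Proof.
have [->|m0] := eqVneq m 0.
  under eq_Rintegral do rewrite mulr0 mul0r cos0.
  by rewrite prob_int_cst.
set c := 2 * pi * m%:~R.
have c0 : c != 0 by rewrite mulf_neq0 ?intr_eq0// mulf_neq0// gt_eqF// pi_gt0.
have dG (x : R) : is_derive x (1 : R) (fun x => c^-1 * sin (c * x)) (cos (c * x)).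
  apply: is_derive_eq; rewrite /GRing.scale/=; field; exact: c0.
rewrite (uniform_int_ftc (@continuous_cos_lin c) _ dG); last by move=> x; exact: cos_max.
by rewrite mulr1 mulr0 sin0 mulr0 subr0 -[c in sin c]add0r sin_addint sin0 mulr0.
Qed.

Lemma uniform_int_sin (m : int) : \int[unif]_x sin (2 * pi * m%:~R * x) = 0.
Proof.
have [->|m0] := eqVneq m 0.
  under eq_Rintegral do rewrite mulr0 mul0r sin0.
  by rewrite prob_int_cst.
set c := 2 * pi * m%:~R.
have c0 : c != 0 by rewrite mulf_neq0 ?intr_eq0// mulf_neq0// gt_eqF// pi_gt0.
have dG (x : R) : is_derive x (1 : R) (fun x => - c^-1 * cos (c * x)) (sin (c * x)).
  apply: is_derive_eq; rewrite /GRing.scale/=; field; exact: c0.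
rewrite (uniform_int_ftc (@continuous_sin_lin c) _ dG); last by move=> x; exact: sin_max.
by rewrite mulr1 mulr0 cos0 -[c in cos c]add0r cos_addint cos0 subrr.
Qed.

(** The Dirichlet kernel identity, stated without division. It serves both the orthogonality on the
    grid and the boundedness of the cosine sums in the convergence of F_r. *)
Lemma sum_cos_sin_telescope (th : R) q :
  (\sum_(a < q) cos (th * a%:R)) * (2 * sin (th / 2)) =
     sin (th * q%:R - th / 2) + sin (th / 2) /\
  (\sum_(a < q) sin (th * a%:R)) * (2 * sin (th / 2)) =
     cos (th / 2) - cos (th * q%:R - th / 2).
Proof.
elim: q => [|q [IH1 IH2]].
  rewrite !big_ord0 !mulr0 sub0r sinN cosN !mul0r; split; lra.
have -> : th * q.+1%:R - th / 2 = th * q%:R + th / 2 by rewrite -natr1; field.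
rewrite !big_ord_recr/=; set z := 2 * sin (th / 2) in IH1 IH2 *.
rewrite !mulrDl IH1 IH2 /z (sinD (th * q%:R) (th / 2)) (cosD (th * q%:R) (th / 2)).
by rewrite sinB cosB; split; ring.
Qed.

(** For th = 2 pi m / q the boundary terms of the telescoped sum cancel by periodicity, and 0 < |m|
    < q keeps the factor sin (pi m / q) away from zero. *)
Lemma grid_sums (q : nat) (m : int) : (0 < q)%N -> (`|m| < q)%N ->
  \sum_(a < q) cos (2 * pi * m%:~R * (a%:R / q%:R)) = q%:R * (m == 0)%:R :> R /\
  \sum_(a < q) sin (2 * pi * m%:~R * (a%:R / q%:R)) = 0 :> R.
Proof.
move=> q0 mq; have q0' : 0 < (q%:R : R) by rewrite ltr0n.
have [->|m0] := eqVneq m 0.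
  split.
    under eq_bigr do rewrite mulr0 mul0r cos0.
    by rewrite sumr_const card_ord mulr1.
  by rewrite big1// => a _; rewrite mulr0 mul0r sin0.
set th : R := 2 * pi * m%:~R / q%:R.
have s0 : sin (th / 2) != 0.
  have -> : th / 2 = Num.sg (m%:~R) * (pi * (`|m|%N%:R / q%:R)).
    rewrite /th [m%:~R in LHS]numEsg -intr_norm natr_absz.
    by field; rewrite gt_eqF.
  rewrite sin_sg mulf_neq0 ?sgr_eq0 ?intr_eq0// gt_eqF// sin_gt0_pi//.
  have m1 : 0 < (`|m|%N%:R : R) by rewrite ltr0n absz_gt0.
  rewrite mulr_gt0 ?pi_gt0 ?divr_gt0//= -[ltRHS]mulr1 ltr_pM2l ?pi_gt0//.
  by rewrite ltr_pdivrMr// mul1r ltr_nat.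
have [h1 h2] := sum_cos_sin_telescope th q.
have thq : th * q%:R - th / 2 = - (th / 2) + 2 * pi * m%:~R.
  by rewrite /th; field; rewrite gt_eqF.
have e x : 2 * pi * m%:~R * (x / q%:R) = th * x.
  by rewrite /th; field; rewrite gt_eqF.
rewrite mulr0; split; under eq_bigr do rewrite e.
  move: h1; rewrite thq sin_addint sinN addNr => /eqP.
  by rewrite mulf_eq0 (negbTE (mulf_neq0 _ s0)) ?orbF ?pnatr_eq0// => /eqP.
move: h2; rewrite thq cos_addint cosN subrr => /eqP.
by rewrite mulf_eq0 (negbTE (mulf_neq0 _ s0)) ?orbF ?pnatr_eq0// => /eqP.
Qed.

Definition freq N (j : 'I_(N + N).+1) : int := j%:Z - N%:Z.

(** The Hartley system: a real, uniformly bounded, orthonormal family indexed by the same integers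
    as the exponentials, so the frequency weights carry over unchanged. *)
Definition cas N (j : 'I_(N + N).+1) (x : R) : R :=
  cos (2 * pi * (freq j)%:~R * x) + sin (2 * pi * (freq j)%:~R * x).

Lemma bm_cas N (j : 'I_(N + N).+1) : @bounded_measurable _ (measurableTypeR R) R (cas j).
Proof. by apply: bmD; [exact: bm_cos_lin|exact: bm_sin_lin]. Qed.

Lemma cas_le2 N (j : 'I_(N + N).+1) x : `|cas j x| <= 2.
Proof.
rewrite (le_trans (ler_normD _ _))// (_ : 2 = 1 + 1)//.
by rewrite lerD ?cos_max ?sin_max.
Qed.

Lemma cas_addint N (j : 'I_(N + N).+1) x (z : int) : cas j (x + z%:~R) = cas j x.
Proof.
rewrite /cas mulrDr (_ : _ * z%:~R = 2 * pi * (freq j * z)%:~R).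
  by rewrite cos_addint sin_addint.
by rewrite intrM mulrA.
Qed.

Lemma continuous_cas N (j : 'I_(N + N).+1) : continuous (cas j).
Proof.
by move=> x; apply: cvgD; [exact: continuous_cos_lin|exact: continuous_sin_lin].
Qed.

Lemma cas_mul N (j k : 'I_(N + N).+1) x y : cas j x * cas k y =
  cos (2 * pi * (freq j)%:~R * x - 2 * pi * (freq k)%:~R * y) +
  sin (2 * pi * (freq j)%:~R * x + 2 * pi * (freq k)%:~R * y).
Proof. by rewrite /cas cosB sinD; ring. Qed.

Lemma freq_sub_eq0 N (j k : 'I_(N + N).+1) : (freq j - freq k == 0) = (j == k).
Proof. by rewrite /freq subr_eq0 (inj_eq (addIr _)) eqz_nat. Qed.

Lemma cas_orthonormal N (j k : 'I_(N + N).+1) :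
  \int[unif]_x (cas j x * cas k x) = (j == k)%:R.
Proof.
transitivity (\int[unif]_x (cos (2 * pi * (freq j - freq k)%:~R * x) +
                           sin (2 * pi * (freq j + freq k)%:~R * x))).
  apply: eq_Rintegral => x _; rewrite cas_mul.
  by congr (cos _ + sin _); rewrite ?intrB ?intrD; ring.
rewrite bm_intD; [|exact: bm_cos_lin|exact: bm_sin_lin].
by rewrite uniform_int_cos uniform_int_sin addr0 freq_sub_eq0.
Qed.

(** No aliasing occurs: sums and differences of two frequencies are at most 2 N in modulus, and the
    grid has 2 N + 1 points. *)
Lemma cas_grid_orthogonal N (j k : 'I_(N + N).+1) :
  \sum_(a < (N + N).+1) cas j (a%:R / (N + N).+1%:R) * cas k (a%:R / (N + N).+1%:R) =
  (N + N).+1%:R * (j == k)%:R.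
Proof.
have h1 : (`|freq j - freq k| < (N + N).+1)%N.
  by have := ltn_ord j; have := ltn_ord k; rewrite /freq; lia.
have h2 : (`|(freq j + freq k)%R| < (N + N).+1)%N.
  by have := ltn_ord j; have := ltn_ord k; rewrite /freq; lia.
have [g1 _] := grid_sums (ltn0Sn (N + N)) h1.
have [_ g2] := grid_sums (ltn0Sn (N + N)) h2.
rewrite -freq_sub_eq0 -g1 -[RHS]addr0 -[X in _ = _ + X]g2 -big_split/=.
apply: eq_bigr => a _; rewrite cas_mul.
by congr (cos _ + sin _); rewrite ?intrB ?intrD; ring.
Qed.

Definition kernel_sum N (r x : R) : R :=
  \sum_(j < (N + N).+1) freq_weight R j `^ (- r) * cos (2 * pi * (freq j)%:~R * x).

Lemma freq_rev N (j : 'I_(N + N).+1) : freq (rev_ord j) = - freq j.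
Proof. by have := ltn_ord j; rewrite /freq /=; lia. Qed.

Lemma freq_weight_rev N (j : 'I_(N + N).+1) :
  freq_weight R (rev_ord j) = freq_weight R j.
Proof. by rewrite /freq_weight -!/(freq _) freq_rev mulrNz normrN. Qed.

Lemma sum_odd_freq N (r x : R) :
  \sum_(j < (N + N).+1) freq_weight R j `^ (- r) * sin (2 * pi * (freq j)%:~R * x) = 0.
Proof.
set s := LHS; suff : s = - s by move=> h; lra.
rewrite {1}/s (reindex_inj rev_ord_inj)/= -sumrN; apply: eq_bigr => j _.
by rewrite freq_weight_rev freq_rev mulrNz mulrN mulNr sinN mulrN.
Qed.

Lemma prod_sum_tuple (K : finType) n (F : 'I_n -> K -> R) :
  \prod_(i < n) \sum_a F i a = \sum_(k : n.-tuple K) \prod_(i < n) F i (tnth k i).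
Proof.
elim: n F => [|n IH] F.
  rewrite (bigD1 [tuple])//= [X in _ = _ + X]big1 ?addr0 ?big_ord0//.
  by move=> k /negP[]; rewrite [k]tuple0.
rewrite big_ord_recl IH sum_tuple_cons mulr_suml; apply: eq_bigr => a _.
rewrite mulr_sumr; apply: eq_bigr => k _; rewrite big_ord_recl; congr (_ * _).
by apply: eq_bigr => i _; rewrite tnthS.
Qed.

Lemma tensor_weight_powR (K : finType) (w : K -> R) n (k : n.-tuple K) s :
  (forall k, 0 <= w k) ->
  tensor_weight w k `^ s = \prod_(i < n) w (tnth k i) `^ s.
Proof.
move=> w0; rewrite /tensor_weight.
elim: n k => [|n IH] k; first by rewrite !big_ord0 powR1.
rewrite !big_ord_recl powRM ?prodr_ge0//; congr (_ * _).
have := IH [tuple of behead k].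
rewrite (eq_bigr (fun i => w (tnth k (lift ord0 i)))) => [->|i _].
  by apply: eq_bigr => i _; rewrite [k in RHS]tuple_eta tnthS.
by rewrite [k in RHS]tuple_eta tnthS.
Qed.

Definition grid_point N d (t : d.-tuple 'I_(N + N).+1) : d.-tuple R :=
  [tuple (tnth t i)%:R / (N + N).+1%:R | i < d].

Lemma tensor_grid_orthogonal N d (k l : d.-tuple 'I_(N + N).+1) :
  \sum_t tensor_fun (@cas N) k (@grid_point N d t) * tensor_fun (@cas N) l (@grid_point N d t) =
  (N + N).+1%:R ^+ d * (k == l)%:R.
Proof.
rewrite -prod_eq_tuple -[d in _ ^+ d]card_ord -prodr_const -big_split/=.
under [RHS]eq_bigr do rewrite -cas_grid_orthogonal.
rewrite prod_sum_tuple; apply: eq_bigr => t _; rewrite /tensor_fun -big_split/=.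
by apply: eq_bigr => i _; rewrite !tnth_mktuple.
Qed.

End cas_system.

(** * Pointwise convergence and measurability of the kernel F_r *)

Section kernel_limit.
Variable R : realType.

Lemma continuous_bigsum (T : topologicalType) (I : Type) (s : seq I) (F : I -> T -> R) :
  (forall i, continuous (F i)) -> continuous (fun x => \sum_(i <- s) F i x).
Proof.
move=> cF x; elim: s => [|i s IH].
  by under eq_fun do rewrite big_nil; exact: cvg_cst.
under eq_fun do rewrite big_cons.
by apply: cvgD => //; exact: cF.
Qed.

Lemma continuous_bigprod (T : topologicalType) (I : Type) (s : seq I) (F : I -> T -> R) :
  (forall i, continuous (F i)) -> continuous (fun x => \prod_(i <- s) F i x).
Proof.
move=> cF x; elim: s => [|i s IH].
  by under eq_fun do rewrite big_nil; exact: cvg_cst.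
under eq_fun do rewrite big_cons.
by apply: cvgM => //; exact: cF.
Qed.

(** Summation by parts gives convergence of the series of F_r off the integers for every r > 0,
    including r <= 1, where absolute convergence fails. *)
Lemma dirichlet_test (a c : nat -> R) (B : R) :
  (forall i, a i.+1 <= a i) -> a @ \oo --> (0 : R) ->
  (forall n, `|\sum_(i < n) c i| <= B) ->
  cvgn (fun n => \sum_(i < n) a i * c i).
Proof.
move=> da a0 cB; pose C n := \sum_(i < n) c i.
have abel n : \sum_(i < n) a i * c i =
    \sum_(0 <= i < n) (a i - a i.+1) * C i.+1 + a n * C n.
  elim: n => [|n IH]; first by rewrite big_ord0 big_nil /C big_ord0 mulr0 addr0.
  have CS : C n.+1 = C n + c n by rewrite /C big_ord_recr.
  by rewrite big_ord_recr/= IH big_nat_recr//= CS; ring.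
have -> : (fun n => \sum_(i < n) a i * c i) =
    series (fun i => (a i - a i.+1) * C i.+1) + (fun n => a n * C n).
  by apply/funext => n; rewrite abel.
apply: is_cvgD.
  apply: normed_cvg.
  apply: (@series_le_cvg _ _ (fun i => B * (a i - a i.+1))) => //=.
  - by move=> n; rewrite mulr_ge0 ?subr_ge0// (le_trans _ (cB 0%N)).
  - move=> n; have an : 0 <= a n - a n.+1 by rewrite subr_ge0.
    by rewrite normrM (ger0_norm an) mulrC ler_wpM2r//; exact: cB.
  have -> : series (fun i => B * (a i - a i.+1)) = (fun n => B * (a 0%N - a n)).
    apply/funext => n; rewrite /series/= -big_distrr/=; congr (_ * _).
    elim: n => [|n IH]; first by rewrite big_nil subrr.
    by rewrite big_nat_recr//= IH; ring.
  apply: is_cvgM; first exact: is_cvg_cst.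
  by apply: is_cvgB; [exact: is_cvg_cst|apply/cvg_ex; exists 0].
apply/cvg_ex; exists 0.
apply/cvgrPdist_lt => e e0.
have B0 : 0 < B + 1 by rewrite ltr_pwDr// (le_trans _ (cB 0%N)).
move/cvgrPdist_lt: a0 => /(_ (e / (B + 1)) (divr_gt0 e0 B0)); apply: filterS => n.
rewrite !sub0r !normrN normrM ltr_pdivlMr// => h.
apply: le_lt_trans h; rewrite ler_wpM2l// (le_trans (cB n))// lerDl//.
Qed.

Lemma sin_pi_eq0 (x : R) : sin (pi * x) = 0 ->
  forall k : int, cos (2 * pi * k%:~R * x) = 1 /\ sin (2 * pi * k%:~R * x) = 0.
Proof.
move=> s0.
have c1 : cos (2 * (pi * x)) = 1.
  by rewrite mulr_natl cos_mulr2n cos2sin2 s0; ring.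
have s1 : sin (2 * (pi * x)) = 0 by rewrite mulr_natl sin_mulr2n s0 mulr0 mul0rn.
have hn (n : nat) : cos (2 * (pi * x) * n%:R) = 1 /\ sin (2 * (pi * x) * n%:R) = 0.
  elim: n => [|n [IH1 IH2]]; first by rewrite mulr0 cos0 sin0.
  by rewrite -[n.+1%:R]natr1 mulrDr mulr1 cosD sinD IH1 IH2 c1 s1; split; ring.
case=> n.
  by rewrite (_ : 2 * pi * _ * x = 2 * (pi * x) * n%:R)//; rewrite -pmulrn; ring.
rewrite NegzE (_ : 2 * pi * _ * x = - (2 * (pi * x) * n.+1%:R)).
  by rewrite cosN sinN; have [-> ->] := hn n.+1; rewrite oppr0.
by rewrite mulrNz -pmulrn; ring.
Qed.

Lemma sum_cos_bounded (x : R) : sin (pi * x) != 0 ->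
  forall n, `|\sum_(i < n) cos (2 * pi * i.+1%:R * x)| <= `|sin (pi * x)|^-1 + 1.
Proof.
move=> s0 n; have [h _] := sum_cos_sin_telescope (2 * pi * x) n.+1.
move: h; rewrite big_ord_recl/= mulr0 cos0.
rewrite (eq_bigr (fun i : 'I_n => cos (2 * pi * i.+1%:R * x))); last first.
  by move=> i _; rewrite /bump/= add1n; congr cos; ring.
have -> : 2 * pi * x / 2 = pi * x by field.
set S := \sum_(i < n) _ => h.
have s0' : 0 < `|sin (pi * x)| by rewrite normr_gt0.
have h1 : `|1 + S| <= `|sin (pi * x)|^-1.
  rewrite -[leRHS]mul1r ler_pdivlMr// -normrM.
  have -> : (1 + S) * sin (pi * x) = ((1 + S) * (2 * sin (pi * x))) / 2 by field.
  rewrite h normrM [`|2^-1|]ger0_norm ?invr_ge0// ler_pdivrMr// (le_trans (ler_normD _ _))//.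
  by rewrite mul1r (_ : 2 = 1 + 1)// lerD// sin_max.
have := ler_normB (1 + S) 1; rewrite addrAC subrr add0r normr1; lra.
Qed.

Lemma kernel_sumE N (r x : R) : kernel_sum N r x =
  1 + 2 * \sum_(i < N) (i.+1%:R) `^ (- r) * cos (2 * pi * i.+1%:R * x).
Proof.
transitivity (\sum_(j < (N + N).+1) (fun d : nat =>
   (Num.max 1 d%:R) `^ (- r) * cos (2 * pi * d%:R * x)) `|j%:Z - N%:Z|%N).
  apply: eq_bigr => j _; rewrite /freq_weight -intr_norm natr_absz; congr (_ * _).
  rewrite -[RHS]cos_norm -[LHS]cos_norm; congr cos.
  by rewrite !normrM intr_norm normr_id.
rewrite (sum_symmetric_range (fun d => (Num.max 1 d%:R) `^ (- r) * cos (2 * pi * d%:R * x))).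
rewrite max_l// powR1 mulr0 mul0r cos0 mulr1; congr (_ + 2 * _).
by apply: eq_bigr => i _; rewrite max_r// ler1n.
Qed.

Lemma kernel_sum_cvg (r x : R) : 0 < r -> sin (pi * x) != 0 ->
  cvgn (fun N => kernel_sum N r x).
Proof.
move=> r0 s0; under eq_fun do rewrite kernel_sumE.
apply: is_cvgD; first exact: is_cvg_cst.
apply: is_cvgM; first exact: is_cvg_cst.
have da i : (i.+2%:R : R) `^ (- r) <= i.+1%:R `^ (- r).
  rewrite !powRN lef_pV2 ?posrE ?powR_gt0 ?ltr0n//.
  by rewrite ge0_ler_powR ?nnegrE ?ler0n ?ler_nat// ltW.
apply: (@dirichlet_test (fun i => i.+1%:R `^ (- r))
  (fun i => cos (2 * pi * i.+1%:R * x)) _ da _ (sum_cos_bounded s0)).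
apply/cvgrPdist_lt => e e0.
pose M := e^-1 `^ r^-1.
near=> n; rewrite sub0r normrN ger0_norm ?powR_ge0// powRN.
rewrite -[ltRHS]invrK ltf_pV2 ?posrE ?powR_gt0 ?invr_gt0 ?ltr0n//.
have -> : e^-1 = M `^ r.
  by rewrite /M -powRrM mulVf ?gt_eqF// powRr1// invr_ge0 ltW.
rewrite gt0_ltr_powR ?nnegrE ?ler0n ?powR_ge0//.
apply: (@lt_trans _ _ n%:R); last by rewrite ltr_nat.
near: n; exact: nbhs_infty_gtr.
Unshelve. all: by end_near. Qed.

(** The value 0 is a convention at the integers, where the partial sums diverge for r <= 1. The
    integers are recognised by the sine because this test is visibly measurable. *)
Definition kernel_lim (r x : R) : R :=
  if sin (pi * x) == 0 then 0 else limn (fun N => kernel_sum N r x).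

Lemma kernel_lim_cvg (r x : R) : 0 < r -> sin (pi * x) != 0 ->
  (fun N => kernel_sum N r x) @ \oo --> kernel_lim r x.
Proof.
by move=> r0 s0; rewrite /kernel_lim (negbTE s0); exact: kernel_sum_cvg.
Qed.

Lemma continuous_kernel_sum N r : continuous (@kernel_sum R N r).
Proof.
apply: continuous_bigsum => j x; apply: cvgM; first exact: cvg_cst.
exact: continuous_cos_lin.
Qed.

Lemma measurable_kernel_sum N r :
  measurable_fun [set: measurableTypeR R] (@kernel_sum R N r).
Proof. by apply: continuous_measurable_fun; exact: continuous_kernel_sum. Qed.

Lemma measurable_sin_pi_eq0 :
  measurable_fun [set: measurableTypeR R] (fun x : R => sin (pi * x) == 0).
Proof.
apply: measurable_fun_eqr => //.
by apply: continuous_measurable_fun; exact: continuous_sin_lin.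
Qed.

Lemma measurable_kernel_lim r : 0 < r ->
  measurable_fun [set: measurableTypeR R] (kernel_lim r).
Proof.
move=> r0; apply: (@measurable_fun_cvg _ (measurableTypeR R) R setT
  (fun N x => if sin (pi * x) == 0 then 0 else kernel_sum N r x)).
  move=> N; apply: measurable_fun_ifT => //; first exact: measurable_sin_pi_eq0.
  exact: measurable_kernel_sum.
move=> x _; have [s0|s0] := eqVneq (sin (pi * x)) 0.
  by apply: cvg_near_cst; apply: nearW => N /=; rewrite /kernel_lim s0 eqxx.
apply: cvg_trans (kernel_lim_cvg r0 s0); apply: near_eq_cvg.
by apply: nearW => N.
Qed.

Lemma sum_Complex n (a b : 'I_n -> R) :
  \sum_(i < n) (Complex (a i) (b i) : Cx R) = Complex (\sum_(i < n) a i) (\sum_(i < n) b i).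
Proof.
elim: n a b => [|n IH] a b; first by rewrite !big_ord0.
by rewrite !big_ord_recr/= IH.
Qed.

Lemma sobolev_sumE N (r x : R) :
  \sum_(j < (N + N).+1) sobolev_term r (j%:Z - N%:Z) x =
  (Complex (kernel_sum N r x) 0 : Cx R).
Proof.
transitivity (\sum_(j < (N + N).+1)
   (Complex (freq_weight R j `^ (- r) * cos (2 * pi * (freq j)%:~R * x))
      (- (freq_weight R j `^ (- r) * sin (2 * pi * (freq j)%:~R * x))) : Cx R)).
  apply: eq_bigr => j _; rewrite /sobolev_term -/(freq j) -/(freq_weight R j).
  by apply/eqP; rewrite eq_complex/= mul0r subr0 mul0r addr0 mulrN !eqxx.
by rewrite sum_Complex sumrN sum_odd_freq oppr0.
Qed.

Lemma cvg_Complex (u : nat -> R) (l : R) : u @ \oo --> l ->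
  (fun n => Complex (u n) 0 : Cx R) @ \oo --> (Complex l 0 : Cx R).
Proof.
move=> ul; apply/cvgrPdist_lt => e e0.
have [er ei] : 0 < complex.Re e /\ complex.Im e = 0.
  by move: e0; case: e => a b; rewrite ltcE/= => /andP[/eqP -> ->].
move/cvgrPdist_lt: ul => /(_ _ er); apply: filterS => n h.
rewrite (_ : (Complex l 0 : Cx R) - Complex (u n) 0 = (Complex (l - u n) 0 : Cx R)).
  rewrite normc_def/= expr0n/= addr0 sqrtr_sqr ltcE/= ei eqxx//.
by apply/eqP; rewrite eq_complex/= subrr !eqxx.
Qed.

Lemma sobolev_kernel1E (r x : R) : 0 < r -> sin (pi * x) != 0 ->
  sobolev_kernel1 r x = (Complex (kernel_lim r x) 0 : Cx R).
Proof.
move=> r0 s0; rewrite /sobolev_kernel1.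
under eq_fun do rewrite sobolev_sumE.
by apply/cvg_lim => //; apply: cvg_Complex; exact: kernel_lim_cvg.
Qed.

(** Whatever value [lim] takes at the integers, it is the same at all of them, since the partial
    sums coincide there. This is enough for the measurability of the kernel. *)
Lemma sobolev_kernel1_eq0 (r x : R) : sin (pi * x) = 0 ->
  sobolev_kernel1 r x = sobolev_kernel1 r 0.
Proof.
move=> s0; rewrite /sobolev_kernel1; congr (lim _); congr (_ @ \oo).
apply/funext => N; rewrite !sobolev_sumE; congr (Complex _ 0).
apply: eq_bigr => j _; congr (_ * _).
by rewrite mulr0 cos0; have [-> _] := sin_pi_eq0 s0 (freq j).
Qed.

End kernel_limit.

(** * Truncated kernels in several variables and their mean square distance *)

Section torus_kernel.
Variable R : realType.

Local Notation unif := (uniform_prob (@ltr01 R) : probability (measurableTypeR R) R).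

(** With weights even in the frequency, the sines of the sum in [cas_mul] cancel between j and -j,
    and only a function of x - y remains. This is why the cas system, though not made of characters,
    diagonalises the convolution with F_r. *)
Lemma cas_even_kernel N (a : nat -> R) (x y : R) :
  \sum_(j < (N + N).+1) a `|freq j|%N * (cas j x * cas j y) =
  a 0%N + 2 * \sum_(i < N) a i.+1 * cos (2 * pi * i.+1%:R * (x - y)).
Proof.
pose b d := a d * cos (2 * pi * d%:R * (x - y)).
have -> : a 0%N = b 0%N by rewrite /b mulr0 mul0r cos0 mulr1.
rewrite -(sum_symmetric_range b).
have odd0 : \sum_(j < (N + N).+1) a `|freq j|%N * sin (2 * pi * (freq j)%:~R * (x + y)) = 0.
  set s := LHS; suff : s = - s by move=> h; lra.
  rewrite {1}/s (reindex_inj rev_ord_inj)/= -sumrN; apply: eq_bigr => j _.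
  by rewrite freq_rev abszN mulrNz mulrN mulNr sinN mulrN.
rewrite -[RHS]addr0 -[X in _ = _ + X]odd0 -big_split/=.
apply: eq_bigr => j _; rewrite cas_mul -/(freq j) /b -[RHS]mulrDr; congr (_ * (_ + _)).
  rewrite -[RHS]cos_norm -[LHS]cos_norm; congr cos.
  rewrite (_ : _ - _ = 2 * pi * (freq j)%:~R * (x - y)); last by ring.
  by rewrite !normrM natr_absz intr_norm normr_id.
by congr sin; ring.
Qed.

(** Writes the kernel sum of order M in the system of a larger order N, so that sums of different
    orders are compared inside one orthonormal system. *)
Lemma box_kernel M N (r x y : R) : (M <= N)%N ->
  \sum_(j < (N + N).+1) (`|freq j| <= M)%N%:R * freq_weight R j `^ (- r) *
     (cas j x * cas j y) = kernel_sum M r (x - y).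
Proof.
move=> MN; rewrite kernel_sumE.
pose a d : R := (d <= M)%N%:R * (Num.max 1 d%:R) `^ (- r).
transitivity (\sum_(j < (N + N).+1) a `|freq j|%N * (cas j x * cas j y)).
  by apply: eq_bigr => j _; rewrite /a natr_absz /freq_weight intr_norm.
rewrite cas_even_kernel /a leq0n mul1r max_l// powR1; congr (_ + 2 * _).
rewrite (big_ord_widen _ (fun i => i.+1%:R `^ (- r) * cos (2 * pi * i.+1%:R * (x - y))) MN).
rewrite [RHS]big_mkcond; apply: eq_bigr => i _; rewrite max_r ?ler1n//.
by case: ltnP => _; rewrite ?mul1r ?mul0r.
Qed.

Definition in_box M N d (k : d.-tuple 'I_(N + N).+1) : bool :=
  [forall i, `|freq (tnth k i)| <= M]%N.

Lemma prod_bool_forall d (b : 'I_d -> bool) :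
  \prod_(i < d) (b i)%:R = [forall i, b i]%:R :> R.
Proof.
have [/forallP h|/forallPn[i hi]] := boolP [forall i, b i].
  by rewrite big1// => i _; rewrite h.
by rewrite (bigD1 i)//= (negbTE hi) mul0r.
Qed.

(** Reduces tails outside a cube of frequencies to tails outside the hyperbolic cross of level M. *)
Lemma tensor_weight_gt_box M N d (k : d.-tuple 'I_(N + N).+1) : ~~ in_box M k ->
  M%:R < tensor_weight (@freq_weight R N) k.
Proof.
move=> /forallPn[i hi]; rewrite -ltnNge in hi.
rewrite /tensor_weight (bigD1 i)//=.
apply: (@lt_le_trans _ _ (freq_weight R (tnth k i))).
  by rewrite lt_max /freq_weight -intr_norm -natr_absz ltr_nat hi orbT.
rewrite ler_peMr//; first by rewrite (le_trans ler01)// freq_weight_ge1.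
elim/big_ind: _ => // [x y x1 y1|j _]; last exact: freq_weight_ge1.
by rewrite -[leLHS]mulr1 ler_pM.
Qed.

Definition tkernel M r d (x y : Rd R d) : R :=
  \prod_(i < d) kernel_sum M r (tnth x i - tnth y i).

Definition tkernel_lim r d (x y : Rd R d) : R :=
  \prod_(i < d) kernel_lim r (tnth x i - tnth y i).

Local Notation W N := (tensor_weight (@freq_weight R N)).
Local Notation E N := (tensor_fun (@cas R N)).

Lemma tkernelE M N r d (x y : Rd R d) : (M <= N)%N ->
  tkernel M r x y = \sum_(k : d.-tuple 'I_(N + N).+1)
     (in_box M k)%:R * W N k `^ (- r) * (E N k x * E N k y).
Proof.
move=> MN; rewrite /tkernel; under eq_bigr do rewrite -(box_kernel _ _ _ MN).
rewrite prod_sum_tuple; apply: eq_bigr => k _.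
rewrite tensor_weight_powR; last first.
  by move=> j; rewrite (le_trans ler01)// freq_weight_ge1.
by rewrite /tensor_fun /in_box -prod_bool_forall -!big_split.
Qed.

Lemma in_box_self N d (k : d.-tuple 'I_(N + N).+1) : in_box N k.
Proof.
by apply/forallP => i; have := ltn_ord (tnth k i); rewrite /freq; lia.
Qed.

Lemma tkernel_selfE N r d (x y : Rd R d) :
  tkernel N r x y = \sum_(k : d.-tuple 'I_(N + N).+1)
     W N k `^ (- r) * (E N k x * E N k y).
Proof.
rewrite (tkernelE _ _ _ (leqnn N)); apply: eq_bigr => k _.
by rewrite in_box_self mul1r.
Qed.

Lemma bmE N d (k : d.-tuple 'I_(N + N).+1) :
  @bounded_measurable _ (d.-tuple (measurableTypeR R)) R (E N k).
Proof. by apply: (bm_tensor_fun unif) => j; exact: bm_cas. Qed.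

Lemma E_orthonormal N d (k l : d.-tuple 'I_(N + N).+1) :
  \int[haar R d]_x (E N k x * E N l x) = (k == l)%:R.
Proof.
apply: tensor_orthonormal; first by move=> j; exact: bm_cas.
exact: cas_orthonormal.
Qed.

Lemma E_bound N d (k : d.-tuple 'I_(N + N).+1) x : `|E N k x| <= 2 ^+ d.
Proof. by apply: tensor_fun_bound => j t; exact: cas_le2. Qed.

Lemma bm_tkernel M r d (y : Rd R d) :
  @bounded_measurable _ (d.-tuple (measurableTypeR R)) R (fun x => tkernel M r x y).
Proof.
under eq_fun do rewrite tkernel_selfE.
by apply: bm_sum => k; apply: bmZ; apply: bmM; [exact: bmE|exact: bmC].
Qed.

(** The tail of the sum of w_k^(-2r), written with the decay exponent g = 2 r - 1; the factor 4^d
    bounds the squares of the tensor functions. [tail_const] counts the coordinates beyond the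
    first, hence [d.-1]. *)
Definition box_tail (r : R) d (M : nat) : R :=
  4 ^+ d * (tail_const (1 + 2 * (2 `^ (2 * r - 1 + 1) / (2 * r - 1)))
     ((1 + 2 * (2 `^ (2 * r - 1 + 1) / (2 * r - 1))) * 2 `^ (2 * r - 1)) d.-1 *
     (M%:R `^ (- (2 * r - 1)) * (1 + ln M%:R) ^+ d.-1)).

(** The tail beyond t = 1/2 is the whole sum, since every weight is at least 1. *)
Lemma freq_weight_total N (g : R) : 0 < g ->
  \sum_(j < (N + N).+1) freq_weight R j `^ (- (g + 1)) <=
  (1 + 2 * (2 `^ (g + 1) / g)) * 2 `^ g.
Proof.
move=> g0; have := @freq_weight_tail R N g 2^-1 g0 ltac:(lra).
rewrite -powR_inv1// -powRrM mulN1r opprK.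
apply: le_trans; rewrite le_eqVlt; apply/orP; left; apply/eqP.
apply: eq_bigr => j _; rewrite powR_inv1// (lt_le_trans _ (freq_weight_ge1 R j)) ?mulr1//.
lra.
Qed.

Lemma cross_tail N d (g t : R) : 0 < g -> 1 <= t ->
  \sum_(k : d.+1.-tuple 'I_(N + N).+1)
     W N k `^ (- (g + 1)) * (t < W N k)%R%:R <=
  tail_const (1 + 2 * (2 `^ (g + 1) / g))
     ((1 + 2 * (2 `^ (g + 1) / g)) * 2 `^ g) d * (t `^ (- g) * (1 + ln t) ^+ d).
Proof.
move=> g0 t1.
have C0 : 0 <= 1 + 2 * (2 `^ (g + 1) / g).
  by rewrite addr_ge0// mulr_ge0// divr_ge0 ?powR_ge0// ltW.
apply: hyperbolic_cross_tail => //.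
- exact: freq_weight_ge1.
- exact: freq_weight_harmonic.
- by rewrite mulr_ge0 ?powR_ge0.
- by move=> s s0; exact: freq_weight_tail.
- exact: freq_weight_total.
Qed.

(** Parseval in x with y frozen. The bound depends neither on y nor on N: the tensor functions at y
    are uniformly bounded, and the squares w_k^(-2r) are summable because 2 r > 1. *)
Lemma int_tkernel_sub_sqr M N r d (y : Rd R d.+1) : 2^-1 < r ->
  (0 < M)%N -> (M <= N)%N ->
  \int[haar R d.+1]_x ((tkernel N r x y - tkernel M r x y) ^+ 2) <= box_tail r d.+1 M.
Proof.
move=> r2 M0 MN.
have w0 (k : d.+1.-tuple 'I_(N + N).+1) : 0 < W N k.
  by rewrite (lt_le_trans ltr01)// tensor_weight_ge1//; exact: freq_weight_ge1.
pose v (k : d.+1.-tuple 'I_(N + N).+1) := (~~ in_box M k)%:R * (W N k `^ (- r) * E N k y).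
have -> : \int[haar R d.+1]_x ((tkernel N r x y - tkernel M r x y) ^+ 2) =
    \int[haar R d.+1]_x ((\sum_k v k * E N k x) ^+ 2).
  apply: eq_Rintegral => x _; rewrite tkernel_selfE (tkernelE _ _ _ MN) -sumrB.
  congr (_ ^+ 2); apply: eq_bigr => k _; rewrite /v.
  by case: (in_box M k); rewrite /= ?mul1r ?mul0r; ring.
rewrite parseval; [|exact: bmE|exact: E_orthonormal].
rewrite /box_tail /=.
apply: (@le_trans _ _ (4 ^+ d.+1 * \sum_(k : d.+1.-tuple 'I_(N + N).+1)
     W N k `^ (- (2 * r - 1 + 1)) * (M%:R < W N k)%R%:R)); last first.
  rewrite ler_wpM2l ?exprn_ge0//; apply: cross_tail; first lra.
  by rewrite ler1n.
rewrite mulr_sumr; apply: ler_sum => k _; rewrite /v.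
have [_|hk] := boolP (in_box M k).
  by rewrite mul0r expr0n mulr_ge0 ?exprn_ge0// mulr_ge0 ?powR_ge0.
rewrite mul1r (tensor_weight_gt_box hk) mulr1 exprMn mulrC.
have -> : W N k `^ (- (2 * r - 1 + 1)) = W N k `^ (- r) ^+ 2.
  by rewrite -powR_mulrn ?powR_ge0// -powRrM; congr (_ `^ _); ring.
rewrite ler_wpM2r ?sqr_ge0// -[E N k y ^+ 2]real_normK ?num_real//.
rewrite (_ : 4 = 2 ^+ 2); last by rewrite expr2; lra.
by rewrite -exprM mulnC exprM lerXn2r ?nnegrE ?exprn_ge0// E_bound.
Qed.

End torus_kernel.

(** * Error of replacing F_r by a truncated kernel *)

Section kernel_error.
Variable R : realType.

Local Notation unif := (uniform_prob (@ltr01 R) : probability (measurableTypeR R) R).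

Lemma sin_pi_eq0_int (t : R) : sin (pi * t) = 0 -> t = (Num.floor t)%:~R.
Proof.
move=> s0; set z := Num.floor t; pose u := t - z%:~R.
have u0 : 0 <= u by rewrite subr_ge0 floor_le.
have u1 : u < 1 by rewrite ltrBlDl; have := lt_succ_floor t; rewrite intrD.
have c1 : cos (2 * (pi * u)) = 1.
  have [h _] := sin_pi_eq0 s0 1; rewrite -[RHS]h -[RHS](cos_addint _ (- z)); congr cos.
  by rewrite /u mulrNz (_ : 1%:~R = 1)//; ring.
have su : sin (pi * u) ^+ 2 = 0.
  by move: c1; rewrite mulr_natl cos_mulr2n cos2sin2; lra.
have [u00|un0] := eqVneq u 0; first by move/eqP: u00; rewrite subr_eq0 => /eqP.
have : 0 < sin (pi * u).
  apply: sin_gt0_pi; rewrite mulr_gt0 ?pi_gt0 ?lt0r ?un0//=.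
  by rewrite -[ltRHS]mulr1 ltr_pM2l ?pi_gt0.
by move/eqP: su; rewrite sqrf_eq0 => /eqP ->; rewrite ltxx.
Qed.

Lemma measurable_sin_pi_sub_eq0 (c : R) :
  measurable_fun [set: measurableTypeR R] (fun x : R => sin (pi * (x - c)) == 0).
Proof.
have mB : measurable_fun [set: measurableTypeR R] (fun x => x - c : measurableTypeR R).
  by apply: measurable_funB; [exact: measurable_id|exact: measurable_cst].
exact: (measurableT_comp (@measurable_sin_pi_eq0 R) mB).
Qed.

Lemma uniform_null (c : R) : unif [set x : R | sin (pi * (x - c)) = 0] = 0%E.
Proof.
set A := [set _ | _].
have cA : countable A.
  apply: (@sub_countable _ _ _ (\bigcup_(z in [set: int]) [set c + z%:~R])).
    apply: subset_card_le => x /sin_pi_eq0_int h; exists (Num.floor (x - c)) => //=.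
    by rewrite -h addrC subrK.
  by apply: bigcup_countable => [|z _]; [exact: countableP|exact: countable1].
have mA : measurable (A : set (measurableTypeR R)).
  have -> : A = (fun x : R => sin (pi * (x - c)) == 0) @^-1` [set true].
    by apply/seteqP; split => x /= => [->|/eqP//]; rewrite eqxx.
  rewrite -[X in measurable X]setTI.
  by apply: (measurable_sin_pi_sub_eq0 c).
have /null_content_dominatesP h := dominates_uniform_prob (@ltr01 R).
exact: (h _ mA (countable_lebesgue_measure0 cA)).
Qed.

Lemma haar_null d (y : Rd R d) :
  {ae haar R d, forall x : Rd R d, forall i, sin (pi * (tnth x i - tnth y i)) != 0}.
Proof.
apply: filter_forall => i.
(* The indicator of the exceptional slab is written as a product over the coordinates, so that its
   integral factors and contains the vanishing factor of coordinate i. *)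
pose g (j : 'I_d) (t : measurableTypeR R) : R :=
  if j == i then (sin (pi * (t - tnth y i)) == 0)%:R else 1.
have mb : measurable_fun [set: measurableTypeR R]
    (fun t : R => sin (pi * (t - tnth y i)) == 0).
  exact: measurable_sin_pi_sub_eq0.
have bb : @bounded_measurable _ (measurableTypeR R) R
    (fun t => (sin (pi * (t - tnth y i)) == 0)%:R).
  rewrite (_ : (fun t => _) = (fun t : measurableTypeR R =>
      if sin (pi * ((t : R) - tnth y i)) == 0 then 1 else 0)).
    by apply: bm_if => //; exact: bmC.
  by apply/funext => t; case: ifP.
have bg j : bounded_measurable (g j).
  by rewrite /g; case: (j == i) => //; exact: bmC.
have i0 : \int[unif]_t g i t = 0.
  rewrite /g eqxx; apply: EFin_inj; rewrite (EFin_bm_int unif bb).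
  transitivity (unif [set x : R | sin (pi * (x - tnth y i)) = 0]); last first.
    exact: uniform_null.
  have mA : measurable ([set x : R | sin (pi * (x - tnth y i)) = 0] : set (measurableTypeR R)).
    rewrite [X in measurable X](_ : _ =
      setT `&` (fun x : R => sin (pi * (x - tnth y i)) == 0) @^-1` [set true]).
      exact: mb.
    by rewrite setTI; apply/seteqP; split => x /= => [->|/eqP//]; rewrite eqxx.
  rewrite -[X in _ = _ X]setIT -integral_indic//.
  apply: eq_integral => t _; rewrite indicE; congr ((nat_of_bool _)%:R%:E).
  by apply/eqP/idP => h; [rewrite inE|rewrite inE in h].
have [bG hG] := int_prod unif bg.
have G0 : \int[haar R d]_x \prod_(j < d) g j (tnth x j) = 0.
  by rewrite hG (bigD1 i)//= i0 mul0r.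
have : ae_eq (haar R d) setT (fun x => (\prod_(j < d) g j (tnth x j))%:E) (cst 0%E).
  apply/ae_eq_integral_abs => //; first by apply/measurable_EFinP; exact: bG.1.
  rewrite -(EFin_bm_int (haar R d) (bm_norm bG)).
  rewrite -[RHS]/(0%:E) -G0; congr EFin; apply: eq_Rintegral => x _.
  rewrite ger0_norm// prodr_ge0// => j _; rewrite /g; case: ifP => // _.
apply: filterS => x /(_ I) /=; rewrite (bigD1 i)//= big1; last first.
  by move=> j ji; rewrite /g (negbTE ji).
by rewrite /g eqxx mulr1 => -[] /eqP; rewrite pnatr_eq0 eqb0.
Qed.

Lemma measurable_sub_tnth d (i : 'I_d) :
  measurable_fun [set: Rd R d * Rd R d]
    (fun z => tnth z.1 i - tnth z.2 i : measurableTypeR R).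
Proof.
apply: measurable_funB.
  exact: (measurableT_comp (@measurable_tnth _ _ d i) measurable_fst).
exact: (measurableT_comp (@measurable_tnth _ _ d i) measurable_snd).
Qed.

Lemma measurable_bigprod {dd : measure_display} {T : measurableType dd}
    (I : Type) (s : seq I) (F : I -> T -> R) :
  (forall i, measurable_fun setT (F i)) ->
  measurable_fun setT (fun x => \prod_(i <- s) F i x).
Proof.
move=> mF; elim: s => [|i s IH].
  by under eq_fun do rewrite big_nil; exact: measurable_cst.
by under eq_fun do rewrite big_cons; exact: measurable_funM.
Qed.

Lemma measurable_tkernel M r d :
  measurable_fun [set: Rd R d * Rd R d] (fun z => tkernel M r z.1 z.2).
Proof.
apply: measurable_bigprod => i.
apply: (measurableT_comp (@measurable_kernel_sum R M r)); exact: measurable_sub_tnth.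
Qed.

Lemma measurable_tkernel_lim r d : 0 < r ->
  measurable_fun [set: Rd R d * Rd R d] (fun z => tkernel_lim r z.1 z.2).
Proof.
move=> r0; apply: measurable_bigprod => i.
apply: (measurableT_comp (measurable_kernel_lim r0)); exact: measurable_sub_tnth.
Qed.

Lemma cvg_bigprod (I : Type) (s : seq I) (F : I -> nat -> R) (l : I -> R) :
  (forall i, F i @ \oo --> l i) ->
  (fun n => \prod_(i <- s) F i n) @ \oo --> \prod_(i <- s) l i.
Proof.
move=> cF; elim: s => [|i s IH].
  by under eq_fun do rewrite big_nil; rewrite big_nil; exact: cvg_cst.
by under eq_fun do rewrite big_cons; rewrite big_cons; exact: cvgM.
Qed.

(** Fatou in the order of the larger truncation: the bound for two truncated kernels is uniform in
    that order, and the truncated kernels converge at almost every x. *)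
Lemma int_tkernel_lim_sqr M r d (y : Rd R d.+1) : 2^-1 < r -> (0 < M)%N ->
  (\int[haar R d.+1]_x ((tkernel_lim r x y - tkernel M r x y) ^+ 2)%:E
   <= (box_tail r d.+1 M)%:E)%E.
Proof.
move=> r2 M0; have r0 : 0 < r by lra.
pose f N (x : Rd R d.+1) := ((tkernel (M + N) r x y - tkernel M r x y) ^+ 2)%:E.
have bf N : @bounded_measurable _ (d.+1.-tuple (measurableTypeR R)) R
    (fun x => (tkernel (M + N) r x y - tkernel M r x y) ^+ 2).
  by apply: bmX; apply: bmB; exact: bm_tkernel.
have mf N : measurable_fun setT (f N) by apply/measurable_EFinP; exact: (bf N).1.
have f0 N x : setT x -> (0 <= f N x)%E by move=> _; rewrite lee_fin sqr_ge0.
have mlim : measurable_fun setT (fun x : Rd R d.+1 => tkernel_lim r x y).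
  exact: (measurableT_comp (@measurable_tkernel_lim r d.+1 r0) (pair2_measurable y)).
apply: (@le_trans _ _ (\int[haar R d.+1]_x limn_einf (f^~ x))%E).
  apply: ae_ge0_le_integral => //.
  - by move=> x _; rewrite lee_fin sqr_ge0.
  - apply/measurable_EFinP; apply: measurable_funX; apply: measurable_funB => //.
    exact: (bm_tkernel M r y).1.
  - move=> x _; rewrite limn_einf_lim; apply: lime_ge; first exact: is_cvg_einfs.
    by apply: nearW => n; apply: le_ereal_inf_tmp => _ [k _ <-]; exact: f0.
  - rewrite /limn_einf; apply: measurableT_comp => //.
    by apply: measurable_fun_limn_esup => n; apply: measurableT_comp => //; exact: mf.
  apply: filterS (haar_null y) => x hx _.
  have hc : f^~ x @ \oo --> ((tkernel_lim r x y - tkernel M r x y) ^+ 2)%:E.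
    apply/fine_cvgP; split; first by apply: nearW.
    have hk : (fun N => tkernel N r x y) @ \oo --> tkernel_lim r x y.
      by apply: cvg_bigprod => i; apply: kernel_lim_cvg.
    have hk2 : (fun N => tkernel (M + N) r x y) @ \oo --> tkernel_lim r x y.
      have : [sequence tkernel (n + M) r x y]_n @ \oo --> tkernel_lim r x y.
        by rewrite (cvg_shiftn M (fun N => tkernel N r x y)).
      by apply: cvg_trans; apply: near_eq_cvg; apply: nearW => n /=; rewrite addnC.
    have hB : (fun N => tkernel (M + N) r x y - tkernel M r x y) @ \oo -->
       tkernel_lim r x y - tkernel M r x y by apply: cvgB => //; exact: cvg_cst.
    rewrite expr2; apply: cvg_trans (cvgM hB hB); apply: near_eq_cvg.
    by apply: nearW => n.
  by have [-> _] := cvg_limn_einf_sup hc.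
apply: (le_trans (@fatou _ _ _ (haar R d.+1) setT measurableT f mf f0)).
rewrite limn_einf_lim; apply: lime_le; first exact: is_cvg_einfs.
apply: nearW => n; apply: (@le_trans _ _ (\int[haar R d.+1]_x f n x)%E).
  by apply: ereal_inf_lbound; exists n => //=.
rewrite /f -EFin_bm_int// lee_fin.
by apply: int_tkernel_sub_sqr => //; exact: leq_addr.
Qed.

Lemma int_tkernel_lim_abs M r d (y : Rd R d.+1) (eta : R) : 2^-1 < r -> (0 < M)%N ->
  0 < eta -> box_tail r d.+1 M <= eta ^+ 2 ->
  (\int[haar R d.+1]_x (`|tkernel_lim r x y - tkernel M r x y|)%:E <= eta%:E)%E.
Proof.
move=> r2 M0 eta0 heta; have r0 : 0 < r by lra.
have mlim : measurable_fun setT (fun x : Rd R d.+1 => tkernel_lim r x y - tkernel M r x y).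
  apply: measurable_funB; last exact: (bm_tkernel M r y).1.
  exact: (measurableT_comp (@measurable_tkernel_lim r d.+1 r0) (pair2_measurable y)).
set D := fun x => tkernel_lim r x y - tkernel M r x y in mlim *.
apply: (@le_trans _ _ (\int[haar R d.+1]_x
   ((eta / 2)%:E + (2 * eta)^-1%:E * (D x ^+ 2)%:E))%E).
  apply: ge0_le_integral => //.
  - by apply/measurable_EFinP; exact: measurableT_comp.
  - by apply: emeasurable_funD => //; apply/measurable_EFinP;
      apply: measurable_funM => //; exact: measurable_funX.
  move=> x _; rewrite -EFinM -EFinD lee_fin.
  (* AM-GM: [2 eta |D| <= eta^2 + D^2] *)
  rewrite -[D x ^+ 2]real_normK ?num_real// -subr_ge0.
  rewrite (_ : _ - _ = (eta - `|D x|) ^+ 2 / (2 * eta)); last by field; lra.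
  by rewrite divr_ge0 ?sqr_ge0//; lra.
rewrite ge0_integralD//; last 3 first.
- by move=> x _; rewrite lee_fin; lra.
- by move=> x _; rewrite -EFinM lee_fin mulr_ge0 ?sqr_ge0// invr_ge0; lra.
- by apply/measurable_EFinP; apply: measurable_funM => //; exact: measurable_funX.
rewrite integral_cst// ge0_integralZl//; last 3 first.
- by apply/measurable_EFinP; exact: measurable_funX.
- by move=> x _; rewrite lee_fin sqr_ge0.
- by rewrite lee_fin invr_ge0; lra.
rewrite [X in (_ * X + _)%E](@probability_setT _ _ _ (haar R d.+1)).
rewrite mule1.
apply: (@le_trans _ _ ((eta / 2)%:E + (2 * eta)^-1%:E * (eta ^+ 2)%:E)%E).
  rewrite leeD2l// lee_wpmul2l ?lee_fin ?invr_ge0//; first lra.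
  by apply: (le_trans (int_tkernel_lim_sqr y r2 M0)); rewrite lee_fin.
by rewrite -EFinM -EFinD lee_fin le_eqVlt; apply/orP; left; apply/eqP; field; lra.
Qed.

(** Young's inequality in L^1, obtained from Tonelli and the bound on the kernel error that is
    uniform in y. Keeping the absolute values inside makes the statement meaningful before the
    convolution is known to converge absolutely. *)
Lemma int_kernel_error M r d (u : Rd R d.+1 -> R) (eta : R) : 2^-1 < r -> (0 < M)%N ->
  0 < eta -> box_tail r d.+1 M <= eta ^+ 2 -> measurable_fun setT u ->
  measurable_fun setT (fun x => \int[haar R d.+1]_y
      (`|tkernel_lim r x y - tkernel M r x y| * `|u y|)%:E)%E /\
  (\int[haar R d.+1]_x \int[haar R d.+1]_y
      (`|tkernel_lim r x y - tkernel M r x y| * `|u y|)%:E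
   <= eta%:E * \int[haar R d.+1]_y (`|u y|)%:E)%E.
Proof.
move=> r2 M0 eta0 heta mu; have r0 : 0 < r by lra.
pose g (z : Rd R d.+1 * Rd R d.+1) :=
  (`|tkernel_lim r z.1 z.2 - tkernel M r z.1 z.2| * `|u z.2|)%:E.
have mg : measurable_fun setT g.
  apply/measurable_EFinP; apply: measurable_funM; apply: measurableT_comp => //.
    by apply: measurable_funB; [exact: measurable_tkernel_lim|exact: measurable_tkernel].
  exact: (measurableT_comp mu measurable_snd).
have g0 z : (0 <= g z)%E by rewrite lee_fin mulr_ge0.
split; first exact: (@measurable_fun_fubini_tonelli_F _ _ _ _ _ (haar R d.+1) g mg g0).
rewrite [leLHS](_ : _ = \int[haar R d.+1]_y \int[haar R d.+1]_x g (x, y))%E; last first.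
  exact: (@fubini_tonelli _ _ _ _ _ (haar R d.+1) (haar R d.+1) g mg g0).
have mu' : measurable_fun setT (fun y => (`|u y|)%:E).
  by apply/measurable_EFinP; exact: measurableT_comp.
have eta0' : (0 <= eta%:E)%E by rewrite lee_fin ltW.
rewrite -(ge0_integralZl _ measurableT mu' _ eta0'); last by move=> y _; rewrite lee_fin.
apply: ge0_le_integral => //.
- by move=> y _; apply: integral_ge0.
- exact: (@measurable_fun_fubini_tonelli_G _ _ _ _ _ (haar R d.+1) g mg g0).
- by apply: emeasurable_funM.
move=> y _.
have -> : (\int[haar R d.+1]_x g (x, y) =
  `|u y|%:E * \int[haar R d.+1]_x (`|tkernel_lim r x y - tkernel M r x y|)%:E)%E.
  rewrite -ge0_integralZl//.
  - by apply: eq_integral => x _; rewrite /g/= EFinM muleC.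
  - apply/measurable_EFinP; apply: measurableT_comp => //.
    apply: measurable_funB; last exact: (bm_tkernel M r y).1.
    exact: (measurableT_comp (@measurable_tkernel_lim r d.+1 r0) (pair2_measurable y)).
rewrite muleC lee_wpmul2r ?lee_fin//.
exact: int_tkernel_lim_abs.
Qed.

End kernel_error.

(** * The l^1 norm of the coefficients outside the hyperbolic cross *)

Section estimates.
Variable R : realType.

Lemma finite_hoelder (K : finType) (a b : K -> R) (p q A B : R) :
  (forall k, 0 <= a k) -> (forall k, 0 <= b k) -> 0 < p -> 0 < q ->
  p^-1 + q^-1 = 1 -> 0 < A -> 0 < B ->
  \sum_k a k `^ p <= A -> \sum_k b k `^ q <= B ->
  \sum_k a k * b k <= A `^ p^-1 * B `^ q^-1.
Proof.
move=> a0 b0 p0 q0 pq A0 B0 hA hB.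
set x := A `^ p^-1; set y := B `^ q^-1.
have x0 : 0 < x by exact: powR_gt0.
have y0 : 0 < y by exact: powR_gt0.
have xp : x `^ p = A by rewrite /x -powRrM mulVf ?gt_eqF// powRr1// ltW.
have yq : y `^ q = B by rewrite /y -powRrM mulVf ?gt_eqF// powRr1// ltW.
have hk k : a k * b k <= x * y * (a k `^ p / A / p + b k `^ q / B / q).
  have := @conjugate_powR R (a k / x) (b k / y) p q
    (divr_ge0 (a0 k) (ltW x0)) (divr_ge0 (b0 k) (ltW y0)) p0 q0 pq.
  rewrite !powRM ?invr_ge0 ?(ltW x0) ?(ltW y0)//.
  have pV z s : 0 < z -> z^-1 `^ s = (z `^ s)^-1.
    by move=> z0; rewrite -[z^-1]powR_inv1 ?(ltW z0)// -powRrM mulN1r powRN.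
  rewrite !pV// xp yq; rewrite -(ler_pM2l (mulr_gt0 x0 y0)) => h.
  by apply: le_trans h; rewrite le_eqVlt; apply/orP; left; apply/eqP; field; rewrite !gt_eqF.
apply: (le_trans (ler_sum _ (fun k _ => hk k))).
rewrite -mulr_sumr -[leRHS]mulr1 ler_wpM2l ?mulr_ge0 ?(ltW x0) ?(ltW y0)//.
rewrite big_split/= -pq; apply: lerD.
  rewrite -!mulr_suml -[leRHS]mul1r ler_wpM2r ?invr_ge0 ?(ltW p0)//.
  by rewrite ler_pdivrMr// mul1r.
rewrite -!mulr_suml -[leRHS]mul1r ler_wpM2r ?invr_ge0 ?(ltW q0)//.
by rewrite ler_pdivrMr// mul1r.
Qed.

Lemma polylog_le_powR n (g : R) : 0 < g ->
  exists2 C : R, 0 < C & forall t, 1 <= t -> (1 + ln t) ^+ n <= C * t `^ g.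
Proof.
move=> g0; pose k := g / n.+1%:R.
have k0 : 0 < k by rewrite divr_gt0 ?ltr0n.
exists ((1 + k^-1) ^+ n); first by rewrite exprn_gt0// addr_gt0 ?invr_gt0.
move=> t t1; have t0 : 0 < t by lra.
have tk1 : 1 <= t `^ k by rewrite -(powRr0 t) ler_powR// ltW.
have h1 : 1 + ln t <= (1 + k^-1) * t `^ k.
  rewrite mulrDl mul1r lerD//.
  have := @ln_sublinear R (t `^ k) (powR_gt0 _ t0).
  rewrite ln_powR => /ltW h; rewrite mulrC ler_pdivlMr// mulrC//.
apply: (@le_trans _ _ (((1 + k^-1) * t `^ k) ^+ n)).
  by rewrite lerXn2r ?nnegrE ?addr_ge0 ?ln_ge0// (le_trans _ h1)// addr_ge0 ?ln_ge0.
rewrite exprMn ler_wpM2l ?exprn_ge0 ?addr_ge0 ?invr_ge0 ?(ltW k0)//.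
rewrite -powR_mulrn ?powR_ge0// -powRrM ler_powR//.
by rewrite /k mulrAC ler_pdivrMr ?ltr0n// ler_pM2l// ler_nat.
Qed.

Lemma tail_const_gt0 (C S : R) n : 0 < C -> 0 <= S -> 0 < tail_const C S n.
Proof.
move=> C0 S0; elim: n => //= n IH.
by rewrite ltr_pwDl ?mulr_gt0// mulr_ge0 ?exprn_ge0// ltW.
Qed.

Definition cross_const (g : R) n : R :=
  tail_const (1 + 2 * (2 `^ (g + 1) / g)) ((1 + 2 * (2 `^ (g + 1) / g)) * 2 `^ g) n.

Lemma cross_const_gt0 g n : 0 < g -> 0 < cross_const g n.
Proof.
move=> g0; have h : 0 < 1 + 2 * (2 `^ (g + 1) / g).
  by rewrite ltr_pwDl// mulr_ge0// divr_ge0 ?powR_ge0 ?ltW.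
by apply: tail_const_gt0 => //; rewrite mulr_ge0 ?powR_ge0 ?ltW.
Qed.

Lemma box_tail_small (r : R) d (e : R) : 2^-1 < r -> 0 < e ->
  exists2 M, (0 < M)%N & forall m, (M <= m)%N -> box_tail r d.+1 m <= e.
Proof.
move=> r2 e0; pose g := 2 * r - 1; have g0 : 0 < g by rewrite /g; lra.
have [C C0 hC] := @polylog_le_powR d (g / 2) (divr_gt0 g0 (ltr0Sn R 1)).
pose B := 4 ^+ d.+1 * (cross_const g d * C).
have B0 : 0 < B by rewrite !mulr_gt0 ?exprn_gt0 ?cross_const_gt0.
(* Half of the decay exponent g has absorbed the logarithms, and B m^(-g/2) <= e holds for m >=
   t. *)
pose t := (B / e) `^ (2 / g).
exists (Num.truncn t).+1 => // m hm.
have tm : t < m%:R.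
  by apply: (lt_le_trans (truncnS_gt t)); rewrite ler_nat.
have m0 : 0 < (m%:R : R) by rewrite ltr0n (leq_trans _ hm).
have m1 : 1 <= (m%:R : R) by rewrite ler1n (leq_trans _ hm).
rewrite /box_tail -/g/= -/(cross_const g d).
apply: (@le_trans _ _ (B * m%:R `^ (- (g / 2)))).
  rewrite /B -!mulrA ler_wpM2l ?exprn_ge0// ler_wpM2l ?(ltW (cross_const_gt0 _ g0))//.
  apply: (le_trans (ler_wpM2l (powR_ge0 _ _) (hC _ m1))).
  rewrite mulrCA ler_wpM2l ?(ltW C0)// -powR_addr//.
  by rewrite le_eqVlt; apply/orP; left; apply/eqP; congr (_ `^ _); field.
rewrite powRN ler_pdivrMr ?powR_gt0// mulrC -ler_pdivrMr//.
have -> : B / e = t `^ (g / 2).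
  rewrite /t -powRrM (_ : 2 / g * (g / 2) = 1) ?powRr1//; last by field; rewrite gt_eqF.
  by rewrite divr_ge0 ?ltW.
by rewrite ge0_ler_powR ?nnegrE ?powR_ge0 ?(ltW m0) ?(ltW tm)// divr_ge0// ltW.
Qed.

(** The Hoelder bound of [coef_tail]. With q = p / (p - 1), the number q (r - 1/p) is the decay
    exponent of the q-th powers, and the outer exponent 1 - 1/p is 1/q. *)
Definition cross_eps (A p r : R) n (t : R) : R :=
  A `^ p^-1 * (cross_const (p / (p - 1) * (r - p^-1)) n) `^ (1 - p^-1) *
  (t `^ (- (r - p^-1)) * (1 + ln t) `^ (n%:R * (1 - p^-1))).

(** Hoelder applied to w^(-r) |c| = (w^((p-2)/p) |c|) w^(-(r+(p-2)/p)). The p-th power of the first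
    factor is the Hardy-Littlewood summand; the q-th power of the second is w^(-(g+1)) with g = q (r
    - 1/p), a summable tail. *)
Lemma coef_tail N n (c : n.+1.-tuple 'I_(N + N).+1 -> R) (A p r t : R) :
  1 < p -> p^-1 < r -> 0 < A -> 1 <= t ->
  \sum_k tensor_weight (@freq_weight R N) k `^ (p - 2) * `|c k| `^ p <= A ->
  \sum_k (t < tensor_weight (@freq_weight R N) k)%R%:R *
     (tensor_weight (@freq_weight R N) k `^ (- r) * `|c k|) <= cross_eps A p r n t.
Proof.
move=> p1 pr A0 t1 hA; set W := @tensor_weight _ _ (@freq_weight R N) n.+1.
have W0 (k : n.+1.-tuple 'I_(N + N).+1) : 0 < W k.
  by rewrite (lt_le_trans ltr01)// tensor_weight_ge1//; exact: freq_weight_ge1.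
have p0 : 0 < p by lra.
pose q := p / (p - 1); have q0 : 0 < q by rewrite divr_gt0//; lra.
have qE : q^-1 = 1 - p^-1 by rewrite /q; field; lra.
pose g := q * (r - p^-1); have g0 : 0 < g by rewrite mulr_gt0//; lra.
have t0 : 0 < t by lra.
pose S := cross_const g n * (t `^ (- g) * (1 + ln t) ^+ n).
have l1 : 0 < 1 + ln t by have := ln_ge0 t1; lra.
have S0 : 0 < S by rewrite !mulr_gt0 ?cross_const_gt0 ?powR_gt0 ?exprn_gt0.
have pq : p^-1 + q^-1 = 1 by rewrite qE; ring.
have := @finite_hoelder _ (fun k => W k `^ ((p - 2) / p) * `|c k|)
  (fun k => (t < W k)%R%:R * W k `^ (- (r + (p - 2) / p))) p q A S.
have -> : A `^ p^-1 * S `^ q^-1 = cross_eps A p r n t.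
  rewrite /cross_eps -/q -/g /S !powRM ?mulr_ge0 ?powR_ge0 ?exprn_ge0 ?(ltW l1)//;
    last by rewrite ltW// cross_const_gt0.
  rewrite qE -!mulrA; congr (_ * (_ * (_ * _))).
    by rewrite -powRrM -qE; congr (_ `^ _); rewrite /g mulNr mulrC mulKf ?gt_eqF.
  by rewrite -powR_mulrn ?(ltW l1)// -powRrM.
have -> : \sum_k W k `^ ((p - 2) / p) * `|c k| * ((t < W k)%R%:R * W k `^ (- (r + (p - 2) / p)))
   = \sum_k (t < W k)%R%:R * (W k `^ (- r) * `|c k|).
  apply: eq_bigr => k _.
  have -> : W k `^ (- r) = W k `^ ((p - 2) / p) * W k `^ (- (r + (p - 2) / p)).
    by rewrite -powR_addr//; congr (_ `^ _); ring.
  ring.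
apply => //.
- by move=> k; rewrite mulr_ge0 ?powR_ge0.
- by move=> k; rewrite mulr_ge0 ?powR_ge0.
- apply: le_trans hA; rewrite le_eqVlt; apply/orP; left; apply/eqP.
  apply: eq_bigr => k _; rewrite powRM ?powR_ge0// -powRrM; congr (_ `^ _ * _).
  by field; rewrite gt_eqF.
apply: le_trans (@cross_tail R N n g t g0 t1).
rewrite le_eqVlt; apply/orP; left; apply/eqP; apply: eq_bigr => k _.
rewrite mulrC; case: (t < _); last by rewrite !mulr0 powR0 ?gt_eqF.
rewrite !mulr1 -powRrM; congr (_ `^ _); rewrite /g /q; field; lra.
Qed.

End estimates.

(** * Approximation of functions in the Sobolev ball *)

Section everywhere_approximation.
Variable R : realType.

Local Notation unif := (uniform_prob (@ltr01 R) : probability (measurableTypeR R) R).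
Local Notation W N := (tensor_weight (@freq_weight R N)).
Local Notation E N := (tensor_fun (@cas R N)).

Lemma bm_itv (a b : R) : @bounded_measurable _ (measurableTypeR R) R
  (fun t => (a <= t <= b)%R%:R).
Proof.
rewrite (_ : (fun t => _) = (fun t : measurableTypeR R =>
   if (a <= (t : R)) && ((t : R) <= b) then 1 else 0)).
  apply: bm_if; [|exact: bmC|exact: bmC].
  by apply: measurable_and; apply: measurable_fun_ler.
by apply/funext => t; case: ifP.
Qed.

Lemma uniform_int_itv (a b : R) : 0 <= a -> a < b -> b <= 1 ->
  \int[unif]_t (a <= t <= b)%R%:R = b - a.
Proof.
move=> a0 ab b1; apply: EFin_inj; rewrite (EFin_bm_int unif (bm_itv a b)).
rewrite integral_uniform; last 2 first.
- by apply/measurable_EFinP; exact: (bm_itv a b).1.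
- by move=> t; rewrite lee_fin.
rewrite subr0 invr1 mul1e.
transitivity (\int[lebesgue_measure]_(t in `[(0:R)%R, 1%R]) (\1_`[a, b] t)%:E)%E.
  by apply: eq_integral => t _; rewrite indicE mem_setE in_itv.
rewrite integral_indic//= setIidl; last first.
  by move=> t /=; rewrite !in_itv/=; lra.
by rewrite lebesgue_measure_itv/= lte_fin ab.
Qed.

(** A point where G is positive is moved into [0,1)^d by periodicity. Continuity keeps G above half
    its value on a box extending to the right of that point, and cutting the box at 1 keeps it in
    the fundamental domain that carries the measure. *)
Lemma periodic_continuous_eq0 d (G : Rd R d -> R) :
  (forall (x : Rd R d) (z : 'I_d -> int),
     G [tuple (tnth x i : R) + (z i)%:~R | i < d] = G x) ->
  continuous (fun v : 'rV[R]_d => G [tuple v ord0 i | i < d]) ->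
  measurable_fun setT G -> (forall x, 0 <= G x) ->
  (\int[haar R d]_x (G x)%:E <= 0)%E -> forall x, G x = 0.
Proof.
move=> perG cG mG G0 intG x0; apply/eqP/negPn/negP => Gx0.
pose z (i : 'I_d) := - Num.floor (tnth x0 i : R).
pose x1 : Rd R d := [tuple (tnth x0 i : R) + (z i)%:~R | i < d].
have x1E i : tnth x1 i = (tnth x0 i : R) - (Num.floor (tnth x0 i : R))%:~R.
  by rewrite tnth_mktuple /z mulrNz.
have x10 i : 0 <= (tnth x1 i : R) by rewrite x1E subr_ge0 floor_le.
have x11 i : (tnth x1 i : R) < 1.
  by rewrite x1E ltrBlDl; have := lt_succ_floor (tnth x0 i : R); rewrite intrD.
have a0 : 0 < G x1 by rewrite perG lt0r Gx0 G0.
set a := G x1 in a0.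
pose v1 : 'rV[R]_d := \row_i (tnth x1 i : R).
have v1E : [tuple v1 ord0 i | i < d] = x1.
  by apply: eq_from_tnth => i; rewrite tnth_mktuple mxE.
have a2 : 0 < a / 2 by rewrite divr_gt0.
have /cvgrPdist_lt /(_ _ a2) /nbhs_ballP [e /= e0 he] := cG v1.
have {}he (x : Rd R d) : (forall i, `|(tnth x1 i : R) - tnth x i| < e) -> a / 2 < G x.
  move=> hx; have := he (\row_i (tnth x i : R)).
  rewrite v1E; have -> : [tuple (\row_i (tnth x i : R)) ord0 i | i < d] = x.
    by apply: eq_from_tnth => i; rewrite tnth_mktuple mxE.
  have -> : G x1 = a by [].
  move=> h; have : `|a - G x| < a / 2.
    by apply: h; split => // i j; rewrite /ball/= !mxE; exact: hx.
  by rewrite ltr_distlC; lra.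
pose b i := Num.min ((tnth x1 i : R) + e / 2) 1.
have b1 i : (tnth x1 i : R) < b i by rewrite lt_min x11 andbT ltrDl divr_gt0.
have bl i : b i <= 1 by rewrite ge_min lexx orbT.
pose h (i : 'I_d) (t : measurableTypeR R) : R := ((tnth x1 i : R) <= t <= b i)%R%:R.
have bh i : bounded_measurable (h i) by exact: bm_itv.
have [bH intH] := int_prod unif bh.
have : 0 < a / 2 * \int[haar R d]_x \prod_(i < d) h i (tnth x i).
  rewrite intH mulr_gt0 ?divr_gt0// prodr_gt0// => i _.
  by rewrite uniform_int_itv// subr_gt0.
rewrite ltNge -bm_intZ// -lee_fin (EFin_bm_int (haar R d) (bmZ (a / 2) bH)) => /negP; apply.
apply: le_trans intG; apply: ge0_le_integral => //.
- by move=> x _; rewrite lee_fin mulr_ge0 ?divr_ge0 ?(ltW a0)// prodr_ge0.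
- by apply/measurable_EFinP; exact: (bmZ (a / 2) bH).1.
- exact/measurable_EFinP.
move=> x _; rewrite lee_fin /h.
rewrite (_ : \prod_(i < d) _ = [forall i, (tnth x1 i : R) <= tnth x i <= b i]%:R); last first.
  exact: prod_bool_forall.
have [/forallP hx|_] := boolP [forall i, (tnth x1 i : R) <= tnth x i <= b i].
  2: by rewrite mulr0.
rewrite mulr1 ltW// he// => i.
have /andP[h1 h2] := hx i.
rewrite distrC ger0_norm ?subr_ge0// ltrBlDl (le_lt_trans h2)//.
by rewrite gt_min ltrD2l; apply/orP; left; lra.
Qed.

Variables (d : nat) (u : Rd R d.+1 -> R) (p r A : R).
Hypothesis p1 : 1 < p.
Hypothesis p2 : p < 2.
Hypothesis pr : p^-1 < r.
Hypothesis A0 : 0 < A.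
Hypothesis mu : measurable_fun setT u.
Hypothesis iu : (haar R d.+1).-integrable setT (EFin \o u).

Definition coef N (k : d.+1.-tuple 'I_(N + N).+1) : R :=
  \int[haar R d.+1]_y (u y * E N k y).

Definition partial_sum N (x : Rd R d.+1) : R :=
  \sum_(k : d.+1.-tuple 'I_(N + N).+1) W N k `^ (- r) * (coef k * E N k x).

Hypothesis hardy_littlewood : forall N,
  \sum_(k : d.+1.-tuple 'I_(N + N).+1) W N k `^ (p - 2) * `|coef k| `^ p <= A.

Let r2 : 2^-1 < r.
Proof.
by apply: lt_trans pr; rewrite ltf_pV2 ?posrE ?(lt_trans ltr01 p1).
Qed.

Lemma bm_mul_integrable (f : Rd R d.+1 -> R) :
  @bounded_measurable _ (d.+1.-tuple (measurableTypeR R)) R f ->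
  (haar R d.+1).-integrable setT (EFin \o (fun y => f y * u y)).
Proof.
move=> [mf [B hB]].
have i2 := integrableZl measurableT B iu.
apply: (le_integrable measurableT _ _ i2).
  by apply/measurable_EFinP; exact: measurable_funM.
move=> x _ /=; rewrite lee_fin !normrM ler_wpM2r//.
by rewrite (le_trans (hB x))// ler_norm.
Qed.

Lemma Rintegral_sum_bm (K : finType) (a : K -> R) (f : K -> Rd R d.+1 -> R) :
  (forall k, @bounded_measurable _ (d.+1.-tuple (measurableTypeR R)) R (f k)) ->
  \int[haar R d.+1]_y ((\sum_k a k * f k y) * u y) =
  \sum_k a k * \int[haar R d.+1]_y (u y * f k y).
Proof.
move=> bf; elim: (index_enum K) => [|k s IH].
  under eq_Rintegral do rewrite big_nil mul0r.
  by rewrite big_nil prob_int_cst.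
under eq_Rintegral do rewrite big_cons mulrDl.
rewrite big_cons RintegralD//; last 2 first.
- by apply: bm_mul_integrable; exact: bmZ.
- by apply: bm_mul_integrable; apply: bm_sum => l; exact: bmZ.
rewrite IH; congr (_ + _).
rewrite -RintegralZl//.
  by apply: eq_Rintegral => y _; rewrite -mulrA [f k y * _]mulrC.
rewrite (_ : (fun y => _) = (fun y => f k y * u y)); last by apply/funext => y; rewrite mulrC.
exact: bm_mul_integrable.
Qed.

Lemma bm_tkernel2 M (x : Rd R d.+1) :
  @bounded_measurable _ (d.+1.-tuple (measurableTypeR R)) R (fun y => tkernel M r x y).
Proof.
under eq_fun do rewrite tkernel_selfE.
by apply: bm_sum => k; apply: bmZ; apply: bmM; [exact: bmC|exact: bmE].
Qed.

Lemma partial_sum_int M (x : Rd R d.+1) :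
  partial_sum M x = \int[haar R d.+1]_y (tkernel M r x y * u y).
Proof.
transitivity (\int[haar R d.+1]_y
    ((\sum_k (W M k `^ (- r) * E M k x) * E M k y) * u y)).
  rewrite Rintegral_sum_bm; last by move=> k; exact: bmE.
  by apply: eq_bigr => k _; rewrite /coef; ring.
apply: eq_Rintegral => y _; rewrite tkernel_selfE; congr (_ * _).
by apply: eq_bigr => k _; rewrite mulrA.
Qed.

Lemma partial_sum_box M N (x : Rd R d.+1) : (M <= N)%N ->
  partial_sum M x = \sum_(k : d.+1.-tuple 'I_(N + N).+1)
    (in_box M k)%:R * (W N k `^ (- r) * (coef k * E N k x)).
Proof.
move=> MN; rewrite partial_sum_int.
transitivity (\int[haar R d.+1]_y
    ((\sum_k ((in_box M k)%:R * W N k `^ (- r) * E N k x) * E N k y) * u y)).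
  apply: eq_Rintegral => y _; rewrite (tkernelE _ _ _ MN); congr (_ * _).
  by apply: eq_bigr => k _; rewrite !mulrA.
rewrite Rintegral_sum_bm; last by move=> k; exact: bmE.
by apply: eq_bigr => k _; rewrite /coef; ring.
Qed.

(** The two sums differ only in frequencies outside the box, whose weights exceed M, so the l^1 tail
    of the coefficients bounds the difference uniformly in x and N. *)
Lemma partial_sum_cauchy M N (x : Rd R d.+1) : (0 < M)%N -> (M <= N)%N ->
  `|partial_sum N x - partial_sum M x| <= 2 ^+ d.+1 * cross_eps A p r d M%:R.
Proof.
move=> M0 MN; rewrite (partial_sum_box _ MN) /partial_sum -sumrB.
have W0 (k : d.+1.-tuple 'I_(N + N).+1) : 0 <= W N k `^ (- r) by exact: powR_ge0.
have M1 : 1 <= (M%:R : R) by rewrite ler1n.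
apply: (le_trans (ler_norm_sum _ _ _)).
apply: le_trans (ler_wpM2l (exprn_ge0 _ _) (coef_tail p1 pr A0 M1 (hardy_littlewood N))) => //.
rewrite mulr_sumr; apply: ler_sum => k _.
have [hk|hk] := boolP (in_box M k).
  by rewrite mul1r subrr normr0 !mulr_ge0.
rewrite mul0r subr0 (tensor_weight_gt_box R hk) mul1r !normrM (ger0_norm (W0 k)).
by rewrite [leRHS]mulrCA ler_wpM2l// mulrC ler_wpM2r// E_bound.
Qed.

Lemma continuous_partial_sum N :
  continuous (fun v : 'rV[R]_d.+1 => partial_sum N [tuple v ord0 i | i < d.+1]).
Proof.
rewrite /partial_sum; apply: continuous_bigsum => k.
have cE : continuous (fun v : 'rV[R]_d.+1 => E N k [tuple v ord0 i | i < d.+1]).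
  rewrite /tensor_fun.
  apply: (@continuous_bigprod R _ _ _
    (fun i (v : 'rV[R]_d.+1) => cas (tnth k i) (tnth [tuple v ord0 i | i < d.+1] i))) => i w.
  under eq_fun do rewrite tnth_mktuple.
  apply: (@continuous_comp _ _ _ (fun v : 'rV[R]_d.+1 => v ord0 i) (cas (tnth k i))).
    exact: coord_continuous.
  exact: continuous_cas.
by move=> v; exact: (cvgM (cvg_cst _) (cvgM (cvg_cst _) (cE v))).
Qed.

Lemma measurable_partial_sum N : measurable_fun setT (partial_sum N).
Proof.
have : @bounded_measurable _ (d.+1.-tuple (measurableTypeR R)) R (partial_sum N).
  by apply: bm_sum => k; apply: bmZ; apply: bmZ; exact: bmE.
by case.
Qed.

Lemma partial_sum_periodic N (x : Rd R d.+1) (z : 'I_d.+1 -> int) :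
  partial_sum N [tuple (tnth x i : R) + (z i)%:~R | i < d.+1] = partial_sum N x.
Proof.
apply: eq_bigr => k _; congr (_ * (_ * _)); apply: eq_bigr => i _.
by rewrite tnth_mktuple cas_addint.
Qed.

Lemma kernel_int_error M (x : Rd R d.+1) :
  (`|\int[haar R d.+1]_y (tkernel_lim r x y * u y) - partial_sum M x|%:E <=
   \int[haar R d.+1]_y (`|tkernel_lim r x y - tkernel M r x y| * `|u y|)%:E)%E.
Proof.
set D := (X in (_ <= X)%E).
(* When the right-hand side is finite, (K - K_M) u is integrable at this x, and the integral of K u
   may be split. *)
have [->|Dy] := eqVneq D +oo%E; first by rewrite leey.
have r0 : 0 < r by apply: lt_trans r2; rewrite invr_gt0.
have mlim : measurable_fun setT (fun y : Rd R d.+1 => tkernel_lim r x y).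
  exact: (measurableT_comp (@measurable_tkernel_lim R r d.+1 r0) (pair1_measurable x)).
have mT := (bm_tkernel2 M x).1.
have id : (haar R d.+1).-integrable setT
    (EFin \o (fun y => (tkernel_lim r x y - tkernel M r x y) * u y)).
  apply/integrableP; split.
    apply/measurable_EFinP; apply: measurable_funM => //.
    exact: measurable_funB.
  rewrite (_ : (\int[_]_(_ in _) _)%E = D) ?ltey//.
  by apply: eq_integral => y _; rewrite /= normrM.
have iT : (haar R d.+1).-integrable setT (EFin \o (fun y => tkernel M r x y * u y)).
  exact: (bm_mul_integrable (bm_tkernel2 M x)).
have -> : \int[haar R d.+1]_y (tkernel_lim r x y * u y) - partial_sum M x =
  \int[haar R d.+1]_y ((tkernel_lim r x y - tkernel M r x y) * u y).
  rewrite partial_sum_int; apply/eqP; rewrite subr_eq; apply/eqP.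
  rewrite -RintegralD//; apply: eq_Rintegral => y _; ring.
rewrite EFin_normr_Rintegral//; apply: (le_trans (le_abse_integral _ _ _)) => //.
  exact: (measurable_int _ id).
rewrite le_eqVlt; apply/orP; left; apply/eqP.
by apply: eq_integral => y _; rewrite /= normrM.
Qed.

(** Passes from almost everywhere to everywhere. The excess G of |g - S_N| over the claimed bound is
    at most |g - S_M| for every M >= N, since S_M and S_N are uniformly close. The integral of |g -
    S_M| tends to 0, so G has integral 0; being continuous and periodic, G vanishes. *)
Lemma partial_sum_approx (g : Rd R d.+1 -> R) N :
  (forall (x : Rd R d.+1) (z : 'I_d.+1 -> int),
     g [tuple (tnth x i : R) + (z i)%:~R | i < d.+1] = g x) ->
  continuous (fun v : 'rV[R]_d.+1 => g [tuple v ord0 i | i < d.+1]) ->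
  measurable_fun setT g ->
  {ae haar R d.+1, forall x, g x = \int[haar R d.+1]_y (tkernel_lim r x y * u y)} ->
  (0 < N)%N ->
  forall x, `|g x - partial_sum N x| <= 2 ^+ d.+1 * cross_eps A p r d N%:R.
Proof.
move=> perg cg mg hg N0 x.
set e := 2 ^+ d.+1 * _.
pose G x := Num.max 0 (`|g x - partial_sum N x| - e).
have mG : measurable_fun setT G.
  apply: measurable_maxr => //; apply: measurable_funB => //.
  by apply: measurableT_comp => //; apply: measurable_funB => //; exact: measurable_partial_sum.
have G0 y : 0 <= G y by rewrite le_max lexx.
suff : G x = 0 by move=> h; rewrite -subr_le0 -h le_max lexx orbT.
apply: (periodic_continuous_eq0 _ _ mG G0).
- by move=> y z; rewrite /G perg partial_sum_periodic.
- move=> v.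
  have cgv : (fun v : 'rV[R]_d.+1 => g [tuple v ord0 i | i < d.+1]) w @[w --> v] -->
    g [tuple v ord0 i | i < d.+1] := cg v.
  have FF := nbhs_filter v.
  have c1 := @cvgB _ _ _ _ FF _ _ _ _ cgv (@continuous_partial_sum N v).
  have c2 := @cvgB _ _ _ _ FF _ _ _ _ (@cvg_norm _ _ _ _ FF _ _ c1) (@cvg_cst _ e _ _ FF).
  exact: (@continuous_max R _ (fun=> 0) _ v (@cvg_cst _ 0 _ _ FF) c2).
set U := (\int[haar R d.+1]_y (`|u y|)%:E)%E.
have U0 : (0 <= U)%E by apply: integral_ge0.
have Uf : U \is a fin_num.
  rewrite ge0_fin_numE//; have /integrableP[_] := iu.
  by congr (_ < _)%E.
have [c0 Uc] : 0 <= fine U /\ U = (fine U)%:E by rewrite fine_ge0// fineK.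
have bnd eta : 0 < eta -> (\int[haar R d.+1]_x (G x)%:E <= (eta * fine U)%:E)%E.
  move=> eta0; have [M0 M00 hM] := @box_tail_small R r d (eta ^+ 2) r2 (exprn_gt0 2 eta0).
  pose M := maxn M0 N.
  have M1 : (0 < M)%N by rewrite leq_max M00.
  have hM1 : box_tail r d.+1 M <= eta ^+ 2 by apply: hM; rewrite leq_maxl.
  have [mD hD] := int_kernel_error r2 M1 eta0 hM1 mu.
  apply: (@le_trans _ _ (\int[haar R d.+1]_x \int[haar R d.+1]_y
     (`|tkernel_lim r x y - tkernel M r x y| * `|u y|)%:E)%E); last first.
    by apply: (le_trans hD); rewrite -/U Uc -EFinM.
  apply: ae_ge0_le_integral => //.
  - by move=> y _; rewrite lee_fin.
  - exact/measurable_EFinP.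
  - by move=> y _; apply: integral_ge0.
  apply: filterS hg => y hy _.
  apply: le_trans (kernel_int_error M y); rewrite -hy lee_fin /G ge_max normr_ge0/=.
  rewrite lerBlDr.
  have -> : g y - partial_sum N y = (g y - partial_sum M y) + (partial_sum M y - partial_sum N y).
    by ring.
  rewrite (le_trans (ler_normD _ _))// lerD2l partial_sum_cauchy//.
  by rewrite leq_max leqnn orbT.
apply/lee_addgt0Pr => e0 e00; rewrite add0e.
have := bnd (e0 / (fine U + 1)) _.
rewrite divr_gt0 ?ltr_pwDr// => /(_ isT)/le_trans; apply; rewrite lee_fin.
rewrite mulrAC ler_pdivrMr ?ltr_pwDr// ler_wpM2l ?(ltW e00)// lerDl//.
Qed.

End everywhere_approximation.

(** * Reduction to real and imaginary parts *)

Section complex_reduction.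
Variable R : realType.
Local Notation W N := (tensor_weight (@freq_weight R N)).
Local Notation E N := (tensor_fun (@cas R N)).

Lemma cmodE (z : Cx R) : cmod z = Num.sqrt (complex.Re z ^+ 2 + complex.Im z ^+ 2).
Proof. by rewrite /cmod normc_def. Qed.

Lemma cmod_ge0 (z : Cx R) : 0 <= cmod z.
Proof. by rewrite cmodE sqrtr_ge0. Qed.

Lemma sqr_cmod (z : Cx R) : cmod z ^+ 2 = complex.Re z ^+ 2 + complex.Im z ^+ 2.
Proof. by rewrite cmodE sqr_sqrtr// addr_ge0 ?sqr_ge0. Qed.

Lemma Re_le_cmod (z : Cx R) : `|complex.Re z| <= cmod z.
Proof. by rewrite cmodE -sqrtr_sqr ler_wsqrtr// lerDl sqr_ge0. Qed.

Lemma Im_le_cmod (z : Cx R) : `|complex.Im z| <= cmod z.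
Proof. by rewrite cmodE -sqrtr_sqr ler_wsqrtr// lerDr sqr_ge0. Qed.

Lemma measurable_cmod {dd : measure_display} {T : measurableType dd} (f : T -> Cx R) :
  measurable_fun setT (fun x => complex.Re (f x)) ->
  measurable_fun setT (fun x => complex.Im (f x)) ->
  measurable_fun setT (fun x => cmod (f x)).
Proof.
move=> mr mi; under eq_fun do rewrite cmodE.
apply: (@measurableT_comp _ _ _ _ _ _ (@Num.sqrt R)).
  by apply: continuous_measurable_fun; exact: sqrt_continuous.
by apply: measurable_funD; exact: measurable_funX.
Qed.

Lemma torus_Lnorm_le d (q B : R) (f : Rd R d -> Cx R) : 0 < q -> 0 <= B ->
  (torus_Lnorm q f <= B%:E)%E <->
  (\int[haar R d]_x ((cmod (f x)) `^ q)%:E <= (B `^ q)%:E)%E.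
Proof.
move=> q0 B0; rewrite /torus_Lnorm unlock.
have -> : (\int[haar R d]_x (`|(cmod (f x))%:E| `^ q) =
           \int[haar R d]_x ((cmod (f x)) `^ q)%:E)%E.
  by apply: eq_integral => x _; rewrite gee0_abs ?lee_fin ?cmod_ge0.
set I := (\int[_]_x _)%E.
have I0 : (0 <= I)%E by apply: integral_ge0 => x _; rewrite lee_fin powR_ge0.
have BE : (B%:E = (B `^ q)%:E `^ q^-1)%E.
  by rewrite poweR_EFin -powRrM divff ?gt_eqF// powRr1.
have IE : (I = (I `^ q^-1) `^ q)%E.
  by rewrite -poweRrM mulVf ?gt_eqF// poweRe1.
split => h.
  rewrite IE -poweR_EFin; apply: gt0_ler_poweR; rewrite ?(ltW q0)//.
  - by rewrite in_itv/= poweR_ge0 leey.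
  - by rewrite in_itv/= lee_fin B0 leey.
rewrite BE; apply: gt0_ler_poweR; rewrite ?invr_ge0 ?(ltW q0)//.
- by rewrite in_itv/= I0 leey.
- by rewrite in_itv/= lee_fin powR_ge0 leey.
Qed.

Lemma continuous_Re_Im (T : topologicalType) (f : T -> Cx R) : continuous f ->
  continuous (fun x => complex.Re (f x)) /\ continuous (fun x => complex.Im (f x)).
Proof.
move=> cf; have key x (e : R) : 0 < e -> \forall y \near x, cmod (f x - f y) < e.
  move=> e0; have e0' : 0 < (Complex e 0 : Cx R) by rewrite ltcE/= eqxx.
  move/cvgrPdist_lt: (cf x) => /(_ _ e0'); apply: filterS => y.
  by rewrite /cmod ltcE/= => /andP[].
split=> x; apply/cvgrPdist_lt => e e0; apply: filterS (key x e e0) => y hy;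
  apply: le_lt_trans hy.
  by apply: le_trans (Re_le_cmod _); rewrite raddfB.
by apply: le_trans (Im_le_cmod _); rewrite raddfB.
Qed.

Lemma measurable_complex_prod {dd : measure_display} {T : measurableType dd}
    (I : Type) (s : seq I) (F : I -> T -> Cx R) :
  (forall i, measurable_fun setT (fun x => complex.Re (F i x)) /\
             measurable_fun setT (fun x => complex.Im (F i x))) ->
  measurable_fun setT (fun x => complex.Re (\prod_(i <- s) F i x)) /\
  measurable_fun setT (fun x => complex.Im (\prod_(i <- s) F i x)).
Proof.
move=> mF; elim: s => [|i s [IH1 IH2]].
  by split; under eq_fun do rewrite big_nil; exact: measurable_cst.
have [m1 m2] := mF i.
have ReM (a b : Cx R) : complex.Re (a * b) =
    complex.Re a * complex.Re b - complex.Im a * complex.Im b by case: a b => ? ? [].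
have ImM (a b : Cx R) : complex.Im (a * b) =
    complex.Re a * complex.Im b + complex.Im a * complex.Re b by case: a b => ? ? [].
split.
  under eq_fun do rewrite big_cons ReM.
  by apply: measurable_funB; exact: measurable_funM.
under eq_fun do rewrite big_cons ImM.
by apply: measurable_funD; exact: measurable_funM.
Qed.

Lemma measurable_sobolev_kernel1 (r : R) : 0 < r ->
  measurable_fun [set: measurableTypeR R] (fun t => complex.Re (sobolev_kernel1 r t)) /\
  measurable_fun [set: measurableTypeR R] (fun t => complex.Im (sobolev_kernel1 r t)).
Proof.
move=> r0.
have E1 t : sobolev_kernel1 r t = if sin (pi * t) == 0 then sobolev_kernel1 r 0
    else Complex (kernel_lim r t) 0.
  have [s0|s0] := eqVneq (sin (pi * t)) 0; first exact: sobolev_kernel1_eq0.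
  exact: sobolev_kernel1E.
split.
  under eq_fun do rewrite E1 (fun_if (@complex.Re R)).
  apply: measurable_fun_ifT; [exact: measurable_sin_pi_eq0|exact: measurable_cst|].
  exact: measurable_kernel_lim.
under eq_fun do rewrite E1 (fun_if (@complex.Im R)).
by apply: measurable_fun_ifT; [exact: measurable_sin_pi_eq0|exact: measurable_cst|].
Qed.

(** Off the null set where some coordinate of x - y is an integer, the kernel is the real number
    [tkernel_lim], so the parts of phi are convolved separately. *)
Lemma torus_convE (r : R) d (phi : Rd R d -> Cx R) (x : Rd R d) : 0 < r ->
  measurable_fun setT (fun y => complex.Re (phi y)) ->
  measurable_fun setT (fun y => complex.Im (phi y)) ->
  torus_conv (@sobolev_kernel R r d) phi x =
  Complex (\int[haar R d]_y (tkernel_lim r x y * complex.Re (phi y)))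
          (\int[haar R d]_y (tkernel_lim r x y * complex.Im (phi y))).
Proof.
move=> r0 mr mi; rewrite /torus_conv /torus_integral.
pose F (y : Rd R d) : Cx R := sobolev_kernel r [tuple (tnth x i : R) - (tnth y i : R) | i < d].
have [mF1 mF2] : measurable_fun setT (fun y => complex.Re (F y)) /\
    measurable_fun setT (fun y => complex.Im (F y)).
  rewrite /F /sobolev_kernel; apply: measurable_complex_prod => i.
  have [m1 m2] := measurable_sobolev_kernel1 r0.
  have mi' : measurable_fun setT (fun y : Rd R d => tnth
      ([tuple (tnth x i : R) - (tnth y i : R) | i < d] : Rd R d) i : measurableTypeR R).
    under eq_fun do rewrite tnth_mktuple.
    exact: (measurableT_comp (measurable_sub_tnth i) (pair1_measurable x)).
  by split; [exact: (measurableT_comp m1 mi')|exact: (measurableT_comp m2 mi')].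
have mlim : measurable_fun setT (fun y : Rd R d => tkernel_lim r x y).
  exact: (measurableT_comp (@measurable_tkernel_lim R r d r0) (pair1_measurable x)).
have aeF : {ae haar R d, forall y, F y = Complex (tkernel_lim r x y) 0}.
  apply: filterS (haar_null x) => y hy.
  rewrite /F /sobolev_kernel /tkernel_lim.
  rewrite (eq_bigr (fun i => Complex (kernel_lim r (tnth x i - tnth y i)) 0)) => [|i _].
    by elim/big_rec2: _ => // i a b _ ->; apply/eqP;
      rewrite eq_complex/= !mul0r subr0 mulr0 addr0 !eqxx.
  rewrite tnth_mktuple sobolev_kernel1E//.
  by have := hy i; rewrite -opprB mulrN sinN oppr_eq0.
have fine_ae (f g : Rd R d -> R) : measurable_fun setT f -> measurable_fun setT g ->
    {ae haar R d, forall y, f y = g y} ->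
    \int[haar R d]_y f y = \int[haar R d]_y g y.
  move=> mf mg fg; congr fine; apply: ae_eq_integral => //; try exact/measurable_EFinP.
  by move: fg; apply: filterS => y -> _.
have ReM (a b : Cx R) : complex.Re (a * b) =
    complex.Re a * complex.Re b - complex.Im a * complex.Im b by case: a b => ? ? [].
have ImM (a b : Cx R) : complex.Im (a * b) =
    complex.Re a * complex.Im b + complex.Im a * complex.Re b by case: a b => ? ? [].
congr Complex; apply: fine_ae; try exact: measurable_funM.
- under eq_fun do rewrite ReM; by apply: measurable_funB; exact: measurable_funM.
- by move: aeF; apply: filterS => y hy; rewrite -/(F y) hy ReM/= mul0r subr0.
- under eq_fun do rewrite ImM; by apply: measurable_funD; exact: measurable_funM.
- by move: aeF; apply: filterS => y hy; rewrite -/(F y) hy ImM/= mul0r addr0.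
Qed.

(** The constant of [hardy_littlewood_finite] for Cw = 9. *)
Definition hl_const (p : R) : R :=
  2 `^ p * (4 * 9 * (2 `^ (p - 1) / (2 `^ (p - 1) - 1)) +
            4 * (2 `^ (2 - p) / (2 `^ (2 - p) - 1))).

Lemma hl_const_gt0 p : 1 < p -> p < 2 -> 0 < hl_const p.
Proof.
move=> p1 p2; have h1 := @powR2_gt1 R (p - 1) ltac:(lra).
have h2 := @powR2_gt1 R (2 - p) ltac:(lra).
by rewrite mulr_gt0 ?powR_gt0// addr_gt0// mulr_gt0// divr_gt0 ?powR_gt0//; lra.
Qed.

Lemma coef_hardy_littlewood d (u : Rd R d.+1 -> R) (p A : R) : 1 < p -> p < 2 ->
  measurable_fun setT u ->
  (\int[haar R d.+1]_x (`|u x| `^ p)%:E <= A%:E)%E -> forall N,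
  \sum_(k : d.+1.-tuple 'I_(N + N).+1) W N k `^ (p - 2) * `|coef u k| `^ p <=
  2 `^ p * (hl_const p ^+ d.+1 * A).
Proof.
move=> p1 p2 mu hA N; apply: hardy_littlewood_Lp => //.
- exact: bm_cas.
- exact: ltW.
- by rewrite ltW// hl_const_gt0.
- by move=> k; rewrite (lt_le_trans ltr01)// freq_weight_ge1.
move=> v bv; apply: hardy_littlewood_finite => //.
- by rewrite p1.
- exact: bm_cas.
- exact: cas_le2.
- exact: cas_orthonormal.
- by move=> k; rewrite (lt_le_trans ltr01)// freq_weight_ge1.
- by move=> t t0; exact: freq_weight_sqr_tail.
Qed.

(** The first 2^p comes from truncating phi, the power of [hl_const] from the d+1 coordinates, and
    the last 2^p from choosing phi of norm below 2: the norm of f is an infimum. *)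
Definition ball_const (p : R) d : R := 2 `^ p * (hl_const p ^+ d.+1 * 2 `^ p).

(** The consequence of smoothness on which the sampling argument rests. The error bound holds at
    every point because it is evaluated at the samples. *)
Definition sparse_approx d (p r : R) (g : Rd R d.+1 -> R) : Prop :=
  forall N, (0 < N)%N -> exists c : d.+1.-tuple 'I_(N + N).+1 -> R,
    \sum_k W N k `^ (p - 2) * `|c k| `^ p <= ball_const p d /\
    forall x, `|g x - \sum_k W N k `^ (- r) * (c k * E N k x)| <=
      2 ^+ d.+1 * cross_eps (ball_const p d) p r d N%:R.

Lemma sobolev_sparse_approx d (p r : R) (f : Rd R d.+1 -> Cx R) :
  1 < p -> p < 2 -> p^-1 < r ->
  sobolevW r p f -> (sobolevW_norm r p f <= 1)%E ->
  sparse_approx p r (fun x => complex.Re (f x)) /\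
  sparse_approx p r (fun x => complex.Im (f x)).
Proof.
move=> p1 p2 pr [[perf cf] [[_ mfr mfi] _] _] hn.
have p0 : 0 < p by lra.
have r0 : 0 < r by apply: lt_trans pr; rewrite invr_gt0.
have [_ [phi [[[_ mr mi] _] hphi] <-] hlt] : exists2 z,
    [set torus_Lnorm p phi | phi in sobolev_repr r p f] z & (z < 2%:E)%E.
  by apply: ereal_inf_lt; apply: le_lt_trans hn _; rewrite lte_fin ltr1n.
have hA : (\int[haar R d.+1]_x ((cmod (phi x)) `^ p)%:E <= (2 `^ p)%:E)%E.
  by apply/torus_Lnorm_le => //; exact: ltW.
have mc := measurable_cmod mr mi.
have part (u g : Rd R d.+1 -> R) :
    measurable_fun setT u -> (forall y, `|u y| <= cmod (phi y)) ->
    (forall (x : Rd R d.+1) (z : 'I_d.+1 -> int),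
       g [tuple (tnth x i : R) + (z i)%:~R | i < d.+1] = g x) ->
    continuous (fun v : 'rV[R]_d.+1 => g [tuple v ord0 i | i < d.+1]) ->
    measurable_fun setT g ->
    {ae haar R d.+1, forall x, g x = \int[haar R d.+1]_y (tkernel_lim r x y * u y)} ->
    sparse_approx p r g.
  move=> mu hu perg cg mg hg N N0.
  have hAu : (\int[haar R d.+1]_x (`|u x| `^ p)%:E <= (2 `^ p)%:E)%E.
    apply: le_trans hA; apply: ge0_le_integral => //.
    - apply/measurable_EFinP; apply: (measurableT_comp (measurable_powR p)).
      exact: measurableT_comp.
    - by apply/measurable_EFinP; exact: (measurableT_comp (measurable_powR p)).
    - by move=> x _; rewrite lee_fin ge0_ler_powR ?nnegrE ?cmod_ge0 ?(ltW p0).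
  have hc := coef_hardy_littlewood p1 p2 mu hAu.
  exists (coef u (N := N)); split; first exact: hc.
  apply: (partial_sum_approx p1 p2 pr _ mu _ hc) => //.
    by rewrite !mulr_gt0 ?powR_gt0 ?exprn_gt0 ?hl_const_gt0.
  exact: (integrable_of_Lp (ltW p1) mu hAu).
have [cr ci] := continuous_Re_Im cf.
split; [apply: (part (fun y => complex.Re (phi y)))|
        apply: (part (fun y => complex.Im (phi y)))] => //.
- by move=> y; exact: Re_le_cmod.
- by move=> x z; rewrite perf.
- by move: hphi; apply: filterS => x ->; rewrite torus_convE.
- by move=> y; exact: Im_le_cmod.
- by move=> x z; rewrite perf.
- by move: hphi; apply: filterS => x ->; rewrite torus_convE.
Qed.

End complex_reduction.

(** * Distance of functions with equal samples *)

Section gelfand_estimate.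
Variable R : realType.
Local Notation W N := (tensor_weight (@freq_weight R N)).
Local Notation E N := (tensor_fun (@cas R N)).

Lemma powR_norm_sub_le (p a b : R) : 0 <= p ->
  `|a - b| `^ p <= 2 `^ p * (`|a| `^ p + `|b| `^ p).
Proof.
move=> p0; have mono (x y : R) : `|x| <= `|y| -> `|x - y| `^ p <= 2 `^ p * `|y| `^ p.
  move=> xy; rewrite -powRM// ge0_ler_powR ?nnegrE ?mulr_ge0//.
  by rewrite (le_trans (ler_normB _ _))// (_ : 2 * _ = `|y| + `|y|) ?lerD2r//; ring.
rewrite mulrDr; have [h|h] := leP `|a| `|b|.
  by rewrite (le_trans (mono _ _ h))// lerDr mulr_ge0 ?powR_ge0.
by rewrite distrC (le_trans (mono _ _ (ltW h)))// lerDl mulr_ge0 ?powR_ge0.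
Qed.

Lemma sum_norm_low_le (K : finType) (b : K -> bool) (v : K -> R) (V s : R) :
  0 < V -> 0 < s -> \sum_k v k ^+ 2 <= V ^+ 2 -> \sum_k (b k)%:R <= s ^+ 2 ->
  \sum_k (b k)%:R * `|v k| <= s * V.
Proof.
move=> V0 s0 hV hs.
have hk k : (b k)%:R * `|v k| <= V / (2 * s) * (b k)%:R + s / (2 * V) * v k ^+ 2.
  (* AM-GM: [2 s V |v| <= V^2 + s^2 v^2] *)
  have c0 : 0 <= s / (2 * V) * v k ^+ 2 by rewrite mulr_ge0 ?sqr_ge0// divr_ge0//; lra.
  case: (b k); last by rewrite mul0r mulr0 add0r.
  rewrite mul1r mulr1 -[v k ^+ 2]real_normK ?num_real// -subr_ge0.
  rewrite (_ : _ - _ = (V - s * `|v k|) ^+ 2 / (2 * s * V)); last by field; lra.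
  by rewrite divr_ge0 ?sqr_ge0// !mulr_ge0//; lra.
apply: (le_trans (ler_sum _ (fun k _ => hk k))).
rewrite big_split/= -!mulr_sumr.
apply: (@le_trans _ _ (V / (2 * s) * s ^+ 2 + s / (2 * V) * V ^+ 2)).
  by rewrite lerD// ler_wpM2l// divr_ge0//; lra.
by rewrite le_eqVlt; apply/orP; left; apply/eqP; field; lra.
Qed.

(** The conclusion of [sparse_hitting] on the grid. Division by 2^d makes the atoms bounded by 1. *)
Definition hits m N d (B : R) (T : 'I_m -> d.-tuple 'I_(N + N).+1) : Prop :=
  forall v : d.-tuple 'I_(N + N).+1 -> R, \sum_k `|v k| <= B ->
    (#|{: d.-tuple 'I_(N + N).+1}|)%:R <=
      \sum_x (\sum_k v k * (E N k (@grid_point R N d x) / 2 ^+ d)) ^+ 2 ->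
    exists i, 4^-1 <= `|\sum_k v k * (E N k (@grid_point R N d (T i)) / 2 ^+ d)|.

(** By Cauchy-Schwarz on the low part, the l^1 norm of v is at most s V + eps. If it exceeds 2 s V,
    then s V < eps. Otherwise v 2^d / V lies in the l^1 ball of radius 2^(d+1) s, and its
    combination has mean square exactly 1 on the grid, so some sample of the original one is at
    least V / 4; hence V <= 4 tau. *)
Lemma hits_estimate m N d (s : R) (T : 'I_m -> d.-tuple 'I_(N + N).+1)
    (v : d.-tuple 'I_(N + N).+1 -> R) (b : d.-tuple 'I_(N + N).+1 -> bool) (tau eps V : R) :
  hits (2 ^+ d.+1 * s) T -> 0 < s -> 0 <= tau -> 0 <= eps ->
  0 <= V -> \sum_k v k ^+ 2 = V ^+ 2 ->
  \sum_k (b k)%:R <= s ^+ 2 ->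
  \sum_k (~~ b k)%:R * `|v k| <= eps ->
  (forall i, `|\sum_k v k * E N k (@grid_point R N d (T i))| <= tau) ->
  V <= 4 * tau + eps / s.
Proof.
move=> hT s0 tau0 eps0 V0 hV hb heps htau.
have es0 : 0 <= eps / s by rewrite divr_ge0// ltW.
have [->|Vn0] := eqVneq V 0; first lra.
have {Vn0}V0 : 0 < V by rewrite lt0r Vn0.
have d0 : 0 < (2 ^+ d : R) by rewrite exprn_gt0.
have v1 : \sum_k `|v k| <= s * V + eps.
  have hV' : \sum_k v k ^+ 2 <= V ^+ 2 by rewrite hV.
  have h1 := sum_norm_low_le V0 s0 hV' hb.
  apply: le_trans (lerD h1 heps); rewrite -big_split/=; apply: ler_sum => k _.
  by case: (b k); rewrite /= mul1r mul0r ?addr0 ?add0r.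
have [h|h] := leP (\sum_k `|v k|) (2 * s * V); last first.
  have : s * V < eps by lra.
  rewrite mulrC -ltr_pdivlMr// => h2; lra.
have [i hi] : exists i, 4^-1 <=
    `|\sum_k (v k * 2 ^+ d / V) * (E N k (@grid_point R N d (T i)) / 2 ^+ d)|.
  apply: hT.
    under eq_bigr do rewrite 2!normrM normfV (gtr0_norm d0) (gtr0_norm V0) -mulrA.
    rewrite -mulr_suml mulrA ler_pdivrMr// exprS.
    by rewrite (_ : 2 * 2 ^+ d * s * V = 2 * s * V * 2 ^+ d) ?ler_pM2r//; ring.
  have -> : \sum_x (\sum_k v k * 2 ^+ d / V * (E N k (@grid_point R N d x) / 2 ^+ d)) ^+ 2 =
     V ^- 2 * \sum_x (\sum_k v k * E N k (@grid_point R N d x)) ^+ 2.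
    rewrite mulr_sumr; apply: eq_bigr => x _.
    transitivity ((V^-1 * \sum_k v k * E N k (@grid_point R N d x)) ^+ 2);
      last by rewrite exprMn exprVn.
    congr (_ ^+ 2); rewrite mulr_sumr; apply: eq_bigr => k _; field; rewrite !gt_eqF//.
  have -> : \sum_x (\sum_k v k * E N k (@grid_point R N d x)) ^+ 2 =
     (N + N).+1%:R ^+ d * V ^+ 2.
    rewrite -hV mulr_sumr.
    transitivity (\sum_k \sum_l (v k * v l) * \sum_x (E N k (@grid_point R N d x) *
                    E N l (@grid_point R N d x))).
      under [RHS]eq_bigr => k _.
        under eq_bigr do rewrite mulr_sumr.
        rewrite exchange_big/=; over.
      rewrite exchange_big/=; apply: eq_bigr => x _; rewrite expr2 mulr_suml.
      apply: eq_bigr => k _; rewrite mulr_sumr; apply: eq_bigr => l _; ring.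
    apply: eq_bigr => k _; rewrite (bigD1 k)//= tensor_grid_orthogonal eqxx mulr1.
    rewrite [X in _ + X]big1 ?addr0 => [|l lk]; first by ring.
    by rewrite tensor_grid_orthogonal eq_sym (negbTE lk) !mulr0.
  rewrite card_tuple card_ord natrX mulrCA mulVf ?mulr1//.
  by rewrite expf_neq0// gt_eqF.
have {}hi : 4^-1 <= `|\sum_k v k * E N k (@grid_point R N d (T i))| / V.
  apply: (le_trans hi); rewrite -[X in _ / X](gtr0_norm V0) -normfV -normrM le_eqVlt.
  apply/orP; left; apply/eqP; congr `|_|; rewrite mulr_suml; apply: eq_bigr => k _.
  by field; rewrite !gt_eqF.
have := htau i; move: hi; rewrite ler_pdivlMr//; lra.
Qed.

(** The difference g - g' is within 2 tau of a polynomial h, whose samples are therefore at most 2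
    tau, and [hits_estimate] bounds its norm by V <= 8 tau + eps / s. The constants 19 and 2 leave
    room for the final 2 V^2 + 2 (2 tau)^2. *)
Lemma sparse_approx_distance m N d (p r s t : R) (g g' : Rd R d.+1 -> R)
    (T : 'I_m -> d.+1.-tuple 'I_(N + N).+1) :
  1 < p -> p < 2 -> p^-1 < r -> (0 < N)%N -> 0 < s -> 1 <= t ->
  hits (2 ^+ d.+2 * s) T ->
  \sum_(k : d.+1.-tuple 'I_(N + N).+1) (W N k <= t)%R%:R <= s ^+ 2 ->
  sparse_approx p r g -> sparse_approx p r g' ->
  (forall i, g (@grid_point R N d.+1 (T i)) = g' (@grid_point R N d.+1 (T i))) ->
  measurable_fun setT g -> measurable_fun setT g' ->
  (\int[haar R d.+1]_x ((g x - g' x) ^+ 2)%:E <=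
   ((19 * (2 ^+ d.+1 * cross_eps (ball_const p d) p r d N%:R) +
     2 * (cross_eps (2 `^ p * (2 * ball_const p d)) p r d t / s)) ^+ 2)%:E)%E.
Proof.
move=> p1 p2 pr N0 s0 t1 hT hcount ag ag' eqs mg mg'.
have bc0 : 0 < ball_const p d by rewrite !mulr_gt0 ?powR_gt0 ?exprn_gt0 ?hl_const_gt0.
have [c [hc gc]] := ag N N0; have [c' [hc' gc']] := ag' N N0.
set tau := 2 ^+ d.+1 * _ in gc gc' *.
have tau0 : 0 <= tau by apply: le_trans (gc (@grid_point R N d.+1 [tuple ord0 | _ < _])).
set eps := cross_eps _ _ _ _ t.
pose v k := W N k `^ (- r) * (c k - c' k).
have heps : \sum_k (~~ (W N k <= t))%R%:R * `|v k| <= eps.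
  have A0 : 0 < 2 `^ p * (2 * ball_const p d) by exact: mulr_gt0 (powR_gt0 _ _) (mulr_gt0 _ bc0).
  have hA : \sum_k W N k `^ (p - 2) * `|c k - c' k| `^ p <= 2 `^ p * (2 * ball_const p d).
    rewrite (_ : 2 * ball_const p d = ball_const p d + ball_const p d); last by ring.
    apply: le_trans (ler_wpM2l (powR_ge0 _ _) (lerD hc hc')).
    rewrite -big_split/= mulr_sumr; apply: ler_sum => k _.
    rewrite -mulrDr mulrCA ler_wpM2l ?powR_ge0//.
    by apply: powR_norm_sub_le; lra.
  apply: le_trans (coef_tail p1 pr A0 t1 hA).
  rewrite le_eqVlt; apply/orP; left; apply/eqP; apply: eq_bigr => k _.
  by rewrite -ltNge /v normrM (ger0_norm (powR_ge0 _ _)).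
have eps0 : 0 <= eps.
  by apply: le_trans heps; apply: sumr_ge0 => k _; rewrite mulr_ge0.
pose h x := \sum_k v k * E N k x.
have gh x : `|g x - g' x - h x| <= 2 * tau.
  have -> : g x - g' x - h x = (g x - \sum_k W N k `^ (- r) * (c k * E N k x)) -
      (g' x - \sum_k W N k `^ (- r) * (c' k * E N k x)).
    have -> : h x = \sum_k W N k `^ (- r) * (c k * E N k x) -
                   \sum_k W N k `^ (- r) * (c' k * E N k x).
      by rewrite -sumrB; apply: eq_bigr => k _; rewrite /v; ring.
    ring.
  by rewrite (le_trans (ler_normB _ _))// (_ : 2 * tau = tau + tau) ?lerD//; ring.
pose V := Num.sqrt (\sum_k v k ^+ 2).
have VE : \sum_k v k ^+ 2 = V ^+ 2.
  by rewrite sqr_sqrtr// sumr_ge0// => k _; exact: sqr_ge0.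
have hV : V <= 4 * (2 * tau) + eps / s.
  apply: (hits_estimate hT s0 _ eps0 (sqrtr_ge0 _) VE hcount heps); first by lra.
  by move=> i; have := gh (@grid_point R N d.+1 (T i)); rewrite eqs subrr sub0r normrN.
have bmh : @bounded_measurable _ (d.+1.-tuple (measurableTypeR R)) R h.
  by apply: bm_sum => k; apply: bmZ; exact: bmE.
have ih : \int[haar R d.+1]_x (h x ^+ 2) = V ^+ 2.
  by rewrite -VE; apply: parseval; [exact: bmE|exact: E_orthonormal].
have es0 : 0 <= eps / s by rewrite divr_ge0// ltW.
have V0 : 0 <= V by exact: sqrtr_ge0.
have bq : @bounded_measurable _ (d.+1.-tuple (measurableTypeR R)) R
    (fun x => 2 * h x ^+ 2 + 2 * (2 * tau) ^+ 2).
  by apply: bmD; [apply: bmZ; exact: bmX|exact: bmC].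
apply: (@le_trans _ _ (\int[haar R d.+1]_x (2 * h x ^+ 2 + 2 * (2 * tau) ^+ 2)%:E)%E).
  apply: ge0_le_integral => //.
  - by move=> x _; rewrite lee_fin sqr_ge0.
  - apply/measurable_EFinP; apply: measurable_funX; exact: measurable_funB.
  - by apply/measurable_EFinP; exact: bq.1.
  move=> x _; rewrite lee_fin.
  have : (g x - g' x - h x) ^+ 2 <= (2 * tau) ^+ 2.
    rewrite -real_normK ?num_real// lerXn2r ?nnegrE//; lra.
  have : 0 <= (g x - g' x - h x - h x) ^+ 2 by exact: sqr_ge0.
  set D := g x - g' x; set H := h x; nra.
rewrite -(EFin_bm_int (haar R d.+1) bq) lee_fin bm_intD; [|by apply: bmZ; exact: bmX|exact: bmC].
rewrite bm_intZ; last exact: bmX.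
rewrite ih prob_int_cst.
have : V ^+ 2 <= (4 * (2 * tau) + eps / s) ^+ 2 by rewrite lerXn2r ?nnegrE//; lra.
nra.
Qed.

End gelfand_estimate.

(** * Choice of the parameters *)

Section parameters.
Variable R : realType.
Local Notation W N := (tensor_weight (@freq_weight R N)).
Local Notation E N := (tensor_fun (@cas R N)).

Lemma ln_succ_bounds n : (0 < n)%N -> 2^-1 <= ln (n.+1%:R : R) <= n%:R.
Proof.
move=> n0; apply/andP; split.
  have : ln (1 + (- 2^-1)) <= - 2^-1 :> R by apply: le_ln1Dx; lra.
  rewrite (_ : 1 + - 2^-1 = 2^-1 :> R); last by lra.
  rewrite lnV ?posrE// lerN2 => h; apply: (le_trans h).
  by rewrite ler_ln ?posrE// ler_nat.
rewrite -natr1 addrC; apply: le_ln1Dx.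
by rewrite (@lt_le_trans _ _ 0)// ltrN10.
Qed.

Lemma exists_dyadic (B : R) : 1 <= B -> exists I, B <= 2 ^+ I /\ 2 ^+ I <= 2 * B.
Proof.
move=> B1; have ex : exists I : nat, B <= 2 ^+ I.
  exists (Num.truncn B).+1; apply: ltW; apply: (lt_le_trans (truncnS_gt B)).
  by rewrite -natrX ler_nat ltnW// ltn_expl.
exists (ex_minn ex); case: ex_minnP => -[|I] hI hmin; split=> //.
  by rewrite expr0; lra.
rewrite exprS ler_pM2l// leNgt; apply/negP => /ltW/hmin.
by rewrite ltnn.
Qed.

Lemma exists_hits m N d (B D : R) I :
  1 <= B -> B <= 2 ^+ I -> 2 ^+ I <= 2 * B ->
  1 <= D -> 2 * (N + N).+1%:R ^+ d <= expR D ->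
  2 * I.+1%:R * B ^+ 2 * (64 * 64 * D * D + 4 * I.+1%:R) <= m%:R ->
  exists T : 'I_m -> d.-tuple 'I_(N + N).+1, hits B T.
Proof.
move=> B1 BI IB D1 hD hm.
have card : #|{: d.-tuple 'I_(N + N).+1}|%:R = (N + N).+1%:R ^+ d :> R.
  by rewrite card_tuple card_ord natrX.
have card0 : (0 < #|{: d.-tuple 'I_(N + N).+1}|)%N.
  by rewrite card_tuple card_ord expn_gt0.
have he (k x : d.-tuple 'I_(N + N).+1) : `|E N k (@grid_point R N d x) / 2 ^+ d| <= 1.
  rewrite normrM normfV (ger0_norm (exprn_ge0 _ _))//.
  by rewrite ler_pdivrMr ?exprn_gt0// mul1r E_bound.
have hD' : 2 * #|{: d.-tuple 'I_(N + N).+1}|%:R <= expR D by rewrite card.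
have [T hT] := sparse_hitting card0 card0 he B1 BI IB D1 hD' hD' hm.
by exists T.
Qed.

(** The level t = K n / L^d is chosen so that t (1 + ln t)^d is of order n. The factor K secures t
    >= 1, through L^d <= (1 + L)^d <= C (n+1) <= 2 C n; in M, the additive constants are absorbed
    using L >= 1/2. *)
Lemma frequency_count_bound d : exists K S M : R, [/\ 1 <= K, 1 <= S, 1 <= M &
  forall n, (0 < n)%N -> let L := ln (n.+1%:R : R) in let t := K * n%:R / L ^+ d in
    [/\ 1 <= t, 1 + ln t <= M * L & forall N,
      \sum_(k : d.+1.-tuple 'I_(N + N).+1) (W N k <= t)%R%:R <= S * n%:R]].
Proof.
have [C C0 hC] := @polylog_le_powR R d 1 ltr01.
pose K := 1 + 2 * C; have K1 : 1 <= K by rewrite /K; lra.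
have lnK : 0 <= ln K by exact: ln_ge0.
pose M := 2 + d.+1%:R + 2 * ln K.
have M1 : 1 <= M by have := ler0n R d.+1; rewrite /M; lra.
exists K, (3 ^+ d.+1 * K * M ^+ d), M; split=> //.
  have h3 : 1 <= 3 ^+ d.+1 :> R by rewrite exprn_ege1//; lra.
  have hM : 1 <= M ^+ d by rewrite exprn_ege1.
  by rewrite !mulr_ege1// mulr_ege1.
move=> n n0 L t.
have [L2 Ln] := andP (ln_succ_bounds n0); rewrite -/L in L2 Ln.
have L0 : 0 < L by lra.
have Ld0 : 0 < L ^+ d by rewrite exprn_gt0.
have n1 : 1 <= (n%:R : R) by rewrite ler1n.
have n1n : (n.+1%:R : R) = n%:R + 1 by rewrite natr1.
have n2 : 2 <= (n.+1%:R : R) by rewrite n1n; lra.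
have t1 : 1 <= t.
  rewrite /t ler_pdivlMr// mul1r.
  apply: (@le_trans _ _ ((1 + L) ^+ d)); first by rewrite lerXn2r ?nnegrE//; lra.
  have := hC n.+1%:R; rewrite powRr1 ?ler0n// => /(_ ltac:(lra)) h.
  apply: (le_trans h); rewrite n1n /K; nra.
have lnt : 1 + ln t <= M * L.
  have : ln t <= ln (K * n.+1%:R ^+ d.+1).
    rewrite ler_ln ?posrE; [|lra|by rewrite mulr_gt0 ?exprn_gt0 ?ltr0n//; lra].
    rewrite /t ler_pdivrMr// -mulrA ler_wpM2l//; first lra.
    rewrite exprS -mulrA (@le_trans _ _ n.+1%:R)//; first by rewrite ler_nat.
    rewrite ler_peMr ?ler0n// -exprMn exprn_ege1//; nra.
  rewrite lnM ?posrE ?exprn_gt0 ?ltr0n//; last lra.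
  rewrite lnXn ?ltr0n// -/L -mulr_natl => h.
  rewrite /M; nra.
split=> // N.
apply: (le_trans (@hyperbolic_cross_count R _ _ (@freq_weight_ge1 R N)
  (@freq_weight_harmonic R N) d t (@freq_weight_count R N) t1)).
have lnt0 : 0 <= 1 + ln t by rewrite addr_ge0// ln_ge0.
apply: (@le_trans _ _ (3 ^+ d.+1 * t * (M * L) ^+ d)).
  have t0 : 0 <= 3 ^+ d.+1 * t by apply: mulr_ge0; [exact: exprn_ge0|lra].
  apply: ler_wpM2l t0 _ _ _.
  by rewrite lerXn2r ?nnegrE// (le_trans lnt0).
rewrite /t exprMn le_eqVlt; apply/orP; left; apply/eqP; field; rewrite gt_eqF//.
Qed.

End parameters.

(** * The number of sampling points *)

Section budget.
Variable R : realType.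

Lemma succ_double_le n a : (0 < n -> 0 < a -> (a + a).+1 <= n.+1 * n.+1 * a)%N.
Proof.
move=> n0 a0; apply: leq_trans (leq_mul (@leq_mul 2 2 n.+1 n.+1 n0 n0) (leqnn a)).
by lia.
Qed.

(** One factor L comes from the number of dyadic layers, one from the logarithm of the grid size and
    one from that of the dictionary size; B^2 is a multiple of n. *)
Lemma hits_at_budget d kappa (S : R) : 1 <= S -> exists2 C : R, 0 < C &
  forall n m, (0 < n)%N -> C * n%:R * ln n.+1%:R ^+ 3 <= m%:R ->
    exists T : 'I_m -> d.+1.-tuple 'I_(n.+1 ^ kappa + n.+1 ^ kappa).+1,
      hits (2 ^+ d.+2 * Num.sqrt (S * n%:R)) T.
Proof.
(* With N = (n+1)^kappa one has 2 N + 1 <= (n+1)^(kappa+2), and the extra 1 in k covers the factor 2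
   <= n + 1. The 2 in [cD] makes D = 2 k L at least 1, as L >= 1/2. *)
move=> S1; pose k := (kappa.+2 * d.+1).+1.
pose cD : R := 2 * k%:R; pose Q : R := 2 ^+ d.+2 ^+ 2 * S.
have Q1 : 1 <= Q by rewrite mulr_ege1 ?exprn_ege1//; lra.
have Q0 : 0 < Q by lra.
have lnQ : 0 <= ln (2 * Q) by apply: ln_ge0; lra.
pose CI : R := 4 * ln (2 * Q) + 4.
have CI0 : 0 < CI by rewrite /CI; lra.
have cD0 : 2 <= cD by rewrite /cD ler_peMr// ler1n.
exists (2 * CI * Q * (64 * 64 * cD * cD + 8 * CI)).
  apply: mulr_gt0; [apply: mulr_gt0 => //; exact: mulr_gt0|].
  by apply: addr_gt0; apply: mulr_gt0; lra.
move=> n m n0; set L := ln _ => hm.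
have [L2 Ln] := andP (@ln_succ_bounds R n n0); rewrite -/L in L2 Ln.
have n1 : 1 <= (n%:R : R) by rewrite ler1n.
have Sn : 1 <= S * n%:R by rewrite mulr_ege1.
set s := Num.sqrt _; have s1 : 1 <= s by rewrite -[leLHS]sqrtr1 ler_sqrt//; lra.
have s2 : s ^+ 2 = S * n%:R by rewrite sqr_sqrtr//; lra.
set B := 2 ^+ d.+2 * s.
have B1 : 1 <= B by rewrite mulr_ege1 ?exprn_ege1//; lra.
have B2 : B ^+ 2 = Q * n%:R by rewrite exprMn s2 /Q mulrA.
have [I [BI IB]] := exists_dyadic B1.
have hI : I.+1%:R <= CI * L.
  have : ln (2 ^+ I : R) <= ln (2 * Q * n.+1%:R).
    rewrite ler_ln ?posrE ?exprn_gt0//; last by apply: mulr_gt0; rewrite ?ltr0n//; lra.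
    apply: (le_trans IB); rewrite -mulrA ler_wpM2l//.
    apply: (@le_trans _ _ (Q * n%:R)); first by rewrite -B2 expr2 ler_peMr//; lra.
    by rewrite ler_wpM2l ?ler_nat//; lra.
  rewrite lnM ?posrE ?ltr0n//; last lra.
  rewrite lnXn// -/L -(mulr_natl (ln 2) I) -[I.+1%:R]natr1 => h.
  have [h2 _] := andP (@ln_succ_bounds R 1 isT).
  have : I%:R * 2^-1 <= I%:R * ln (2 : R) by rewrite ler_wpM2l.
  have : ln (2 * Q) * 2^-1 <= ln (2 * Q) * L by rewrite ler_wpM2l.
  rewrite (_ : CI * L = 4 * (ln (2 * Q) * L) + 4 * L); last by rewrite /CI; ring.
  by move=> h3 h4; lra.
apply: (@exists_hits R m (n.+1 ^ kappa) d.+1 B (cD * L) I) => //; first nra.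
  apply: (@le_trans _ _ (n.+1%:R ^+ k)).
    rewrite -!natrX -natrM ler_nat /k [leqRHS]expnS leq_mul// expnM leq_exp2r//.
    rewrite !expnS mulnA; have : (0 < n.+1 ^ kappa)%N by rewrite expn_gt0.
    exact: succ_double_le.
  rewrite -[X in X ^+ _](@lnK R) ?posrE ?ltr0n// -/L -expRM_natl ler_expR /cD.
  by have : 0 <= (k%:R : R) by []; nra.
apply: le_trans hm; rewrite B2.
have I0 : 0 <= (I.+1%:R : R) by [].
apply: (@le_trans _ _ (2 * (CI * L) * (Q * n%:R) *
   (64 * 64 * (cD * L) * (cD * L) + 8 * CI * L ^+ 2))).
  have Qn0 : 0 <= Q * n%:R by apply: mulr_ge0; lra.
  apply: ler_pM.
  - by apply: mulr_ge0 => //; apply: mulr_ge0.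
  - have h : 0 <= cD * L * (cD * L) by apply: mulr_ge0; apply: mulr_ge0; lra.
    lra.
  - by apply: ler_wpM2r => //; lra.
  rewrite lerD2l; nra.
rewrite le_eqVlt; apply/orP; left; apply/eqP; ring.
Qed.

End budget.

(** * Comparison with the claimed rate *)

Section rate.
Variable R : realType.

Definition rate (d : nat) (p r : R) (n : nat) : R :=
  (ln n.+1%:R ^+ d / n%:R) `^ (r - p^-1 + 2^-1) * ln n.+1%:R `^ (2^-1 - d%:R * (p^-1 - 2^-1)).

(** Matches the rate with its sources: the first factor is the decay t^(-(r - 1/p)) at the level t,
    n^(-1/2) is the division by s, and the power d (1 - 1/p) of L is the logarithm from Hoelder. *)
Lemma rateE d p r n : (0 < n)%N -> let L := ln (n.+1%:R : R) in
  rate d p r n = (L ^+ d / n%:R) `^ (r - p^-1) *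
    (n%:R `^ (- 2^-1) * L `^ (d%:R * (1 - p^-1))) * L `^ 2^-1.
Proof.
move=> n0 L; have [L2 Ln] := andP (@ln_succ_bounds R n n0).
have L0 : 0 < L by rewrite (lt_le_trans _ L2)// invr_gt0.
have n1 : 0 < (n%:R : R) by rewrite ltr0n.
rewrite /rate -/L [X in X * _]powR_addr ?divr_gt0 ?exprn_gt0// -!mulrA; congr (_ * _).
have nE : n%:R^-1 `^ 2^-1 = n%:R `^ (- 2^-1) :> R.
  by rewrite -[n%:R^-1]powR_inv1 ?ltW// -powRrM mulN1r.
have LE : (L ^+ d) `^ 2^-1 = L `^ (d%:R * 2^-1) by rewrite -powR_mulrn ?ltW// -powRrM.
rewrite powRM ?invr_ge0 ?exprn_ge0 ?ltW// nE LE mulrAC mulrC; congr (_ * _).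
by rewrite -!powR_addr//; congr (_ `^ _); lra.
Qed.

(** The estimates produce the left-hand side; since L >= 1/2, inserting the factor L^(1/2) of the
    rate costs at most 2. *)
Lemma rate_ge d p r n : (0 < n)%N ->
  (ln n.+1%:R ^+ d / n%:R) `^ (r - p^-1) *
    (n%:R `^ (- 2^-1) * ln n.+1%:R `^ (d%:R * (1 - p^-1))) <= 2 * rate d p r n.
Proof.
move=> n0; have [L2 Ln] := andP (@ln_succ_bounds R n n0).
rewrite (@rateE d p r n n0); set L := ln _ in L2 Ln *.
set x := _ * _; have x0 : 0 <= x by rewrite !mulr_ge0 ?powR_ge0.
rewrite mulrCA ler_peMr//.
have : (2^-1 : R) `^ 1 <= 2^-1 `^ 2^-1 by rewrite ger_powR; lra.
rewrite powRr1; last lra.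
have : 2^-1 `^ 2^-1 <= L `^ 2^-1 by rewrite ge0_ler_powR ?nnegrE ?invr_ge0//; lra.
lra.
Qed.

Lemma cross_eps_hyperbolic_le d (A p r S K M : R) :
  1 < p -> p^-1 < r -> 1 <= S -> 1 <= K -> 1 <= M ->
  exists2 c : R, 0 <= c & forall n t, (0 < n)%N ->
    t = K * n%:R / ln n.+1%:R ^+ d -> 1 <= t -> 1 + ln t <= M * ln n.+1%:R ->
    cross_eps A p r d t / Num.sqrt (S * n%:R) <= c * rate d p r n.
Proof.
move=> p1 pr S1 K1 M1; rewrite /cross_eps; set A1 := A `^ _ * _; set a := d%:R * _.
have p0 : 0 < p by lra.
have a0 : 0 <= a by rewrite mulr_ge0// subr_ge0 invf_le1//; lra.
have A10 : 0 <= A1 by rewrite mulr_ge0 ?powR_ge0.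
exists (A1 * M `^ a * 2); first by rewrite !mulr_ge0 ?powR_ge0.
move=> n t n0; have [L2 Ln] := andP (@ln_succ_bounds R n n0).
have rg := @rate_ge d p r n n0; rewrite -/a in rg.
set L := ln n.+1%:R in L2 Ln rg * => tE t1 lnt.
have L0 : 0 < L by lra.
have n1 : 1 <= (n%:R : R) by rewrite ler1n.
have n0' : 0 < (n%:R : R) by lra.
have Ld0 : 0 < L ^+ d by rewrite exprn_gt0.
have h1 : t `^ (- (r - p^-1)) <= (L ^+ d / n%:R) `^ (r - p^-1).
  rewrite -mulN1r powRrM powR_inv1; last lra.
  rewrite ge0_ler_powR ?nnegrE ?invr_ge0 ?divr_ge0//; try lra.
  rewrite tE invfM invrK mulrC invfM mulrA mulrAC ler_piMr ?invf_le1//; try lra.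
  by rewrite ltW// divr_gt0.
have h2 : (1 + ln t) `^ a <= M `^ a * L `^ a.
  have l0 : 0 <= 1 + ln t by rewrite addr_ge0// ln_ge0.
  rewrite -powRM; try lra.
  by rewrite ge0_ler_powR// nnegrE// (le_trans l0).
have h3 : (Num.sqrt (S * n%:R))^-1 <= n%:R `^ (- 2^-1).
  rewrite powRN powR12_sqrt ?(ltW n0')// lef_pV2 ?posrE ?sqrtr_gt0//;
    last by rewrite mulr_gt0//; lra.
  by rewrite ler_sqrt ?ler_peMl ?mulr_ge0//; lra.
apply: (@le_trans _ _
  (A1 * ((L ^+ d / n%:R) `^ (r - p^-1) * (M `^ a * L `^ a)) * n%:R `^ (- 2^-1))).
  apply: ler_pM => //; first by rewrite !mulr_ge0 ?powR_ge0.
  by rewrite ler_wpM2l// ler_pM ?powR_ge0.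
have AM : 0 <= A1 * M `^ a by rewrite mulr_ge0 ?powR_ge0.
apply: le_trans (_ : A1 * M `^ a * (2 * rate d p r n) <= _); last by rewrite mulrA.
apply: le_trans (ler_wpM2l AM rg).
rewrite le_eqVlt; apply/orP; left; apply/eqP; ring.
Qed.

Lemma cross_eps_box_le d (A p r : R) : 1 < p -> p^-1 < r ->
  exists kappa : nat, exists2 c : R, 0 <= c & forall n, (0 < n)%N ->
    cross_eps A p r d (n.+1 ^ kappa)%:R <= c * rate d p r n.
Proof.
move=> p1 pr; pose g := r - p^-1; have g0 : 0 < g by rewrite /g; lra.
rewrite /cross_eps -/g; set A1 := A `^ _ * _; set a := d%:R * _.
have pi1 : p^-1 <= 1 by rewrite invf_le1//; lra.
have pi0 : 0 <= p^-1 by rewrite invr_ge0; lra.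
have a0 : 0 <= a by rewrite mulr_ge0// subr_ge0.
have ad : a <= d%:R by rewrite /a ler_piMr//; lra.
have A10 : 0 <= A1 by rewrite mulr_ge0 ?powR_ge0.
have [C C0 hC] := @polylog_le_powR R d (g / 2) (divr_gt0 g0 (ltr0Sn R 1)).
(* Half of the decay N^(-g) absorbs the logarithms, and [kappa] makes the rest at most (n+1)^(-y).
   This y puts it below the rate after the crude bounds L >= 1/(n+1) and 1/n >= 1/(n+1). *)
pose y : R := d.+1%:R * g + 2^-1 + a.
have dg : 0 <= d.+1%:R * g by rewrite mulr_ge0// ltW.
have y0 : 0 <= y by rewrite /y; lra.
pose kappa := (Num.truncn (2 * y / g)).+1.
have hk : y <= kappa%:R * (g / 2).
  rewrite -ler_pdivrMr ?divr_gt0//.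
  have := ltW (truncnS_gt (2 * y / g)); rewrite -/kappa.
  by rewrite (_ : 2 * y / g = y / (g / 2)) //; field; rewrite gt_eqF.
exists kappa, (A1 * (C * 2)); first by apply: mulr_ge0 => //; apply: mulr_ge0 => //; exact: ltW.
move=> n n0; have [L2 Ln] := andP (@ln_succ_bounds R n n0).
set L := ln _ in L2 Ln.
have n1 : 1 <= (n%:R : R) by rewrite ler1n.
pose u : R := n.+1%:R; have uE : u = n%:R + 1 by rewrite /u natr1.
have u1 : 1 <= u by lra.
have u2 : 2 <= u by lra.
pose N : R := (n.+1 ^ kappa)%:R; have NE : N = u `^ kappa%:R.
  by rewrite /N natrX powR_mulrn//; lra.
have N1 : 1 <= N by have := ler_powR u1 (ler0n R kappa); rewrite powRr0 NE.
have lnN : 1 <= 1 + ln N by rewrite lerDl ln_ge0.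
have h1 : (1 + ln N) `^ a <= C * N `^ (g / 2).
  apply: le_trans (hC _ N1); rewrite -powR_mulrn ?ler_powR//; lra.
have h2 : N `^ (- g) * (1 + ln N) `^ a <= C * u `^ (- y).
  apply: le_trans (ler_wpM2l (powR_ge0 _ _) h1) _.
  rewrite mulrCA ler_wpM2l ?(ltW C0)// -powR_addr; last lra.
  rewrite NE -powRrM ler_powR//; nra.
apply: le_trans (ler_wpM2l A10 h2) _.
rewrite -[leRHS]mulrA; apply: ler_wpM2l => //; rewrite -[leRHS]mulrA ler_wpM2l ?(ltW C0)//.
apply: le_trans (@rate_ge d p r n n0); rewrite -/L -/a -/g.
have uV : u^-1 <= L by rewrite (le_trans _ L2)// lef_pV2 ?posrE//; lra.
have ui0 : 0 < u^-1 by rewrite invr_gt0; lra.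
have ui0' : 0 <= u^-1 by exact: ltW.
have L0 : 0 <= L by lra.
have nn : 0 <= (n%:R : R) by [].
have uu : 0 <= u by lra.
have u0 : 0 < u by lra.
have -> : u `^ (- y) = (u^-1 ^+ d.+1) `^ g * (u `^ (- 2^-1) * u^-1 `^ a).
  have ui z : u^-1 `^ z = u `^ (- z) by rewrite -powR_inv1// -powRrM mulN1r.
  rewrite -powR_mulrn// -powRrM !ui -!powR_addr//.
  by congr (_ `^ _); rewrite /y; ring.
apply: ler_pM; rewrite ?mulr_ge0 ?powR_ge0//.
  apply: ge0_ler_powR; rewrite ?nnegrE ?divr_ge0 ?exprn_ge0//; first exact: ltW.
  rewrite exprSr ler_pM ?exprn_ge0//; first by rewrite lerXn2r ?nnegrE.
  by rewrite lef_pV2 ?posrE//; lra.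
apply: ler_pM; rewrite ?powR_ge0//; last exact: ge0_ler_powR.
rewrite !powRN lef_pV2 ?posrE ?powR_gt0//; last lra.
by rewrite ge0_ler_powR ?nnegrE//; lra.
Qed.

End rate.

(** * From equal samples to sampling numbers *)

Section recovery.
Variable R : realType.
Local Notation W N := (tensor_weight (@freq_weight R N)).
Local Notation E N := (tensor_fun (@cas R N)).

Lemma sampling_number_le m d (F : set (Rd R d -> Cx R)) (nF : (Rd R d -> Cx R) -> \bar R)
    (X : set (Rd R d -> Cx R)) (nX : (Rd R d -> Cx R) -> \bar R) (x0 : Rd R d -> Cx R)
    (t : 'I_m -> Rd R d) (b : \bar R) :
  X x0 -> (forall f, F f -> (nF f <= 1)%E -> X f) ->
  (forall f g, F f -> (nF f <= 1)%E -> F g -> (nF g <= 1)%E ->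
     (forall i, f (t i) = g (t i)) -> (nX (fun x => f x - g x)%R <= b)%E) ->
  (sampling_number m F nF X nX <= b)%E.
Proof.
move=> X0 FX dist.
pose P (y : 'rV[Cx R]_m) := [set f | [/\ F f, (nF f <= 1)%E & \row_i f (t i) = y]].
(* The default [x0] is returned only for data that no function of the ball produces; it keeps the
   values of [rec] in X. *)
pose rec y := xget x0 (P y).
apply: ge_ereal_inf; eexists; first by exists t.
apply: ge_ereal_inf; eexists.
  by exists rec => //= y; rewrite /rec; case: xgetP => // g _ [Fg ng _]; exact: FX.
apply: ge_ereal_sup => _ [f [Ff nf] <-].
have [Fg ng eqg] : P (\row_i f (t i)) (rec (\row_i f (t i))) by apply: xgetPex; exists f.
apply: dist => // i; move/rowP : eqg => /(_ i).
by rewrite !mxE.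
Qed.

Lemma sparse_approx_bounded d (p r : R) (g : Rd R d.+1 -> R) :
  sparse_approx p r g -> exists2 M : R, 0 <= M & forall x, `|g x| <= M.
Proof.
move=> /(_ 1%N isT)[c [_ hc]].
set tau := _ * _ in hc.
have tau0 : 0 <= tau by apply: le_trans (hc (@grid_point R 1 d.+1 [tuple ord0 | _ < _])).
exists (tau + \sum_k W 1 k `^ (- r) * (`|c k| * 2 ^+ d.+1)).
  by rewrite addr_ge0// sumr_ge0// => k _; rewrite !mulr_ge0 ?powR_ge0.
move=> x; rewrite -[g x](subrK (\sum_k W 1 k `^ (- r) * (c k * E 1 k x))).
apply: le_trans (ler_normD _ _) (lerD (hc x) _).
apply: le_trans (ler_norm_sum _ _ _) (ler_sum _ _) => k _.
rewrite 2!normrM (ger0_norm (powR_ge0 _ _)) ler_wpM2l ?powR_ge0// ler_wpM2l//.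
exact: E_bound.
Qed.

Lemma torus_Lp2_zero d : @torus_Lp R d 2 (fun=> 0).
Proof.
split; first by split=> //=; exact: measurable_cst.
apply: (@le_lt_trans _ _ 0%:E); last exact: ltry.
apply/torus_Lnorm_le => //; rewrite powR0 ?pnatr_eq0//.
by under eq_integral do rewrite cmodE /= expr0n addr0 sqrtr0 powR0 ?pnatr_eq0//; rewrite integral0.
Qed.

Lemma sobolev_ball_Lp2 d (p r : R) (f : Rd R d.+1 -> Cx R) :
  1 < p -> p < 2 -> p^-1 < r ->
  sobolevW r p f -> (sobolevW_norm r p f <= 1)%E -> torus_Lp 2 f.
Proof.
move=> p1 p2 pr Wf nf.
have [/sparse_approx_bounded[M M0 hM] /sparse_approx_bounded[M' M0' hM']] :=
  sobolev_sparse_approx p1 p2 pr Wf nf.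
have [_ [mf _] _] := Wf; have [_ mr mi] := mf.
split=> //; apply: (@le_lt_trans _ _ (M + M')%:E); last exact: ltry.
apply/torus_Lnorm_le; rewrite ?addr_ge0//.
apply: (@le_trans _ _ (\int[haar R d.+1]_x ((M + M') `^ 2)%:E)%E).
  apply: ge0_le_integral => //.
  - by move=> x _; rewrite lee_fin powR_ge0.
  - apply/measurable_EFinP; apply: (@measurableT_comp _ _ _ _ _ _ (@powR R ^~ 2)).
      exact: measurable_powR.
    exact: measurable_cmod.
  move=> x _; rewrite lee_fin ge0_ler_powR ?nnegrE ?cmod_ge0 ?addr_ge0//.
  rewrite -ler_sqr ?nnegrE ?cmod_ge0 ?addr_ge0// sqr_cmod.
  rewrite -[complex.Re _ ^+ 2]real_normK ?num_real// -[complex.Im _ ^+ 2]real_normK ?num_real//.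
  have h1 : `|complex.Re (f x)| ^+ 2 <= M ^+ 2 by rewrite lerXn2r ?nnegrE.
  have h2 : `|complex.Im (f x)| ^+ 2 <= M' ^+ 2 by rewrite lerXn2r ?nnegrE.
  by have := mulr_ge0 M0 M0'; lra.
rewrite integral_cst//.
by rewrite [X in (_ * X)%E](@probability_setT _ _ _ (haar R d.+1)) mule1.
Qed.

Lemma torus_L2_sub_le d (f g : Rd R d -> Cx R) (e : R) : 0 <= e ->
  torus_measurable f -> torus_measurable g ->
  (\int[haar R d]_x ((complex.Re (f x) - complex.Re (g x)) ^+ 2)%:E <= (e ^+ 2)%:E)%E ->
  (\int[haar R d]_x ((complex.Im (f x) - complex.Im (g x)) ^+ 2)%:E <= (e ^+ 2)%:E)%E ->
  (torus_Lnorm 2 (fun x => (f x - g x)%R) <= (2 * e)%:E)%E.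
Proof.
move=> e0 [_ mfr mfi] [_ mgr mgi] hr hi.
apply/torus_Lnorm_le; rewrite ?mulr_ge0//.
have -> : (\int[haar R d]_x ((cmod (f x - g x)) `^ 2)%:E =
  \int[haar R d]_x (((complex.Re (f x) - complex.Re (g x)) ^+ 2)%:E +
                    ((complex.Im (f x) - complex.Im (g x)) ^+ 2)%:E))%E.
  apply: eq_integral => x _; rewrite -EFinD powR_mulrn ?cmod_ge0// sqr_cmod.
  by case: (f x) (g x) => [a b] [a' b'].
rewrite ge0_integralD//=; first last.
- by apply/measurable_EFinP; apply: measurable_funX; exact: measurable_funB.
- by move=> x _; rewrite lee_fin sqr_ge0.
- by apply/measurable_EFinP; apply: measurable_funX; exact: measurable_funB.
- by move=> x _; rewrite lee_fin sqr_ge0.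
apply: (le_trans (leeD hr hi)).
by rewrite -EFinD lee_fin powR_mulrn ?mulr_ge0//; nra.
Qed.

Lemma sampling_number_sobolev_le d (p r : R) :
  1 < p -> p < 2 -> p^-1 < r ->
  exists2 C : R, 0 < C & exists2 c : R, 0 < c & forall n m, (0 < n)%N ->
    C * n%:R * ln n.+1%:R ^+ 3 <= m%:R ->
    (sampling_number m (@sobolevW R r p d.+1) (@sobolevW_norm R r p d.+1)
      (@torus_Lp R d.+1 2) (@torus_Lnorm R d.+1 2) <= (c * rate d p r n)%:E)%E.
Proof.
move=> p1 p2 pr.
have [K [S [M [K1 S1 M1 count]]]] := @frequency_count_bound R d.
have [kappa [c1 c10 hbox]] := @cross_eps_box_le R d (ball_const p d) p r p1 pr.
have [c2 c20 hhyp] := @cross_eps_hyperbolic_le R d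
  (2 `^ p * (2 * ball_const p d)) p r S K M p1 pr S1 K1 M1.
have [C C0 hC] := @hits_at_budget R d kappa S S1.
have c0 : 0 <= 2 * (19 * (2 ^+ d.+1 * c1) + 2 * c2).
  by rewrite mulr_ge0// addr_ge0// mulr_ge0// mulr_ge0// exprn_ge0.
exists C => //; exists (1 + 2 * (19 * (2 ^+ d.+1 * c1) + 2 * c2)); first by lra.
move=> n m n0 hm; have [T hT] := hC n m n0 hm.
have [t1 lnt cnt] := count n n0.
have rate0 : 0 <= rate d p r n by rewrite mulr_ge0 ?powR_ge0.
have n1 : 1 <= (n%:R : R) by rewrite ler1n.
have s0 : 0 < Num.sqrt (S * n%:R) by rewrite sqrtr_gt0 mulr_gt0//; lra.
have N0 : (0 < n.+1 ^ kappa)%N by rewrite expn_gt0.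
set t := K * n%:R / _ in t1 lnt cnt; set s := Num.sqrt _ in hT s0.
have cnt' : \sum_(k : d.+1.-tuple 'I_(n.+1 ^ kappa + n.+1 ^ kappa).+1)
    (W (n.+1 ^ kappa) k <= t)%R%:R <= s ^+ 2.
  rewrite sqr_sqrtr; first exact: cnt.
  by rewrite mulr_ge0//; lra.
set N := (n.+1 ^ kappa)%N in T hT N0 cnt'.
pose e := 19 * (2 ^+ d.+1 * cross_eps (ball_const p d) p r d N%:R) +
  2 * (cross_eps (2 `^ p * (2 * ball_const p d)) p r d t / s).
have eb : 2 * e <= (1 + 2 * (19 * (2 ^+ d.+1 * c1) + 2 * c2)) * rate d p r n.
  have h1 := hbox n n0; have h2 := hhyp n t n0 erefl t1 lnt.
  have h1' := ler_wpM2l (exprn_ge0 d.+1 (ler0n R 2)) h1.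
  rewrite -/N in h1'; rewrite /e -/s in h2 *.
  rewrite (_ : _ * rate d p r n = rate d p r n + 2 * (19 * (2 ^+ d.+1 * (c1 * rate d p r n)) +
     2 * (c2 * rate d p r n))); last by ring.
  lra.
have cross0 A x : 1 <= x -> 0 <= cross_eps A p r d x :> R.
  by move=> x1; rewrite /cross_eps !mulr_ge0 ?powR_ge0.
have e0 : 0 <= e.
  rewrite /e addr_ge0// mulr_ge0//.
    by rewrite mulr_ge0 ?exprn_ge0// cross0// ler1n.
  by rewrite divr_ge0 ?cross0// ltW.
apply: (@sampling_number_le m d.+1 _ _ _ _ (fun=> 0) (fun i => @grid_point R N d.+1 (T i))).
- exact: torus_Lp2_zero.
- by move=> f Wf nf; exact: sobolev_ball_Lp2 Wf nf.
move=> f g Wf nf Wg ng eqs.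
apply: (@le_trans _ _ (2 * e)%:E); last by rewrite lee_fin.
have [fr fi] := sobolev_sparse_approx p1 p2 pr Wf nf.
have [gr gi] := sobolev_sparse_approx p1 p2 pr Wg ng.
have [_ [mf _] _] := Wf; have [_ [mg _] _] := Wg.
have [_ mfr mfi] := mf; have [_ mgr mgi] := mg.
(* The points were chosen for all real coefficient vectors at once, so the same ones serve the real
   and the imaginary parts. *)
apply: torus_L2_sub_le => //.
  by apply: (sparse_approx_distance p1 p2 pr N0 s0 t1 hT cnt' fr gr) => // i; rewrite eqs.
by apply: (sparse_approx_distance p1 p2 pr N0 s0 t1 hT cnt' fi gi) => // i; rewrite eqs.
Qed.

End recovery.

Unset Implicit Arguments.
Set Strict Implicit.

Theorem corollary4p16 (R : realType) (d : nat) (p r : R)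
    (hd : (0 < d)%N) (hp1 : 1 < p) (hp2 : p < 2) (hr : p^-1 < r) :
  exists C : R, 0 < C /\
  exists c : R, 0 < c /\
  forall n : nat, (0 < n)%N ->
    let L : R := ln (n.+1%:R) in
    (sampling_number `|Num.ceil (C * n%:R * L ^+ 3)|%N
       (@sobolevW R r p d) (@sobolevW_norm R r p d)
       (@torus_Lp R d 2) (@torus_Lnorm R d 2)
     <= (c * ((L ^+ d.-1 / n%:R) `^ (r - p^-1 + 2^-1)
              * L `^ (2^-1 - (d%:R - 1) * (p^-1 - 2^-1))))%:E)%E.
Proof.
case: d hd => // d _.
have [C C0 [c c0 bound]] := sampling_number_sobolev_le d hp1 hp2 hr.
exists C; split=> //; exists c; split=> // n n0 /=.
have L0 : 0 <= ln (n.+1%:R : R) by rewrite ln_ge0// ler1n.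
have x0 : 0 <= C * n%:R * ln n.+1%:R ^+ 3.
  by rewrite mulr_ge0 ?exprn_ge0// mulr_ge0// ltW.
have m_ge : C * n%:R * ln n.+1%:R ^+ 3 <= `|Num.ceil (C * n%:R * ln n.+1%:R ^+ 3)|%N%:R.
  apply: (le_trans (ceil_ge _)); rewrite natr_absz ger0_norm//.
  by rewrite ceil_ge0//; apply: lt_le_trans x0; rewrite ltrN10.
have := bound n _ n0 m_ge.
by rewrite /rate -[d.+1%:R]natr1 addrK.
Qed.
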